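(* Let $\{\mathscr{L}_\gamma=(\mathbb{C}^N,\|\cdot\|_\gamma):\gamma\in\mathbb{T}\}$ be an interpolation family of compatible Banach lattices (with respect to the canonical basis of $\mathbb{C}^N$). Then for every $x\in\mathbb{C}^N$, $$\log\|x\|_{\mathscr{L}[0]}=\inf\int_{\mathbb{T}}\log\|f(\gamma)\|_\gamma\,dm(\gamma),$$ where the infimum runs over all measurable coordinate bounded functions $f=(f_1,\dots,f_N):\mathbb{T}\to\mathbb{C}^N$ (i.e. each $f_k:\mathbb{T}\to\mathbb{C}$ is bounded) such that (with the convention $\log0:=-\infty$) $$\log|x|\le\int_{\mathbb{T}}\log|f(\gamma)|\,dm(\gamma).$$ In particular, if $M:\mathbb{T}\to\mathbb{T}$ is measure preserving and $\widetilde{\mathscr{L}}_\gamma=\mathscr{L}_{M(\gamma)}$ for $\gamma\in\mathbb{T}$, then $Id:\mathscr{L}[0]\to\widetilde{\mathscr{L}}[0]$ is isometric.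
   Context: $\mathbb{D}$ is the open unit disc, $\mathbb{T}$ the unit circle with normalized Lebesgue measure $m$. A norm on $\mathbb{C}^N$ makes it a (complex) Banach lattice with respect to the basis $(e_1,\dots,e_N)$ if $\|\sum x_ke_k\|\le\|\sum y_ke_k\|$ whenever $|x_k|\le|y_k|$ for all $k$. A family $\{\mathscr{L}_\gamma=(\mathbb{C}^N,\|\cdot\|_\gamma):\gamma\in\mathbb{T}\}$, with $\gamma\mapsto\|x\|_\gamma$ measurable for each $x$, is a family of compatible Banach lattices with respect to the canonical basis $(e_k)$ if for a.e. $\gamma$ the space $\mathscr{L}_\gamma$ is a Banach lattice with respect to $(e_k)$, and $0<\operatorname{ess\,inf}_\gamma\|e_k\|_\gamma\le\operatorname{ess\,sup}_\gamma\|e_k\|_\gamma<\infty$ for all $1\le k\le N$. Expressions such as $|x|$, $\log|x|$, $\log|f(\gamma)|$ and the inequality between vectors are understood coordinatewise. The interpolated space $\mathscr{L}[0]$ is $\mathbb{C}^N$ with norm $\|x\|_{\mathscr{L}[0]}=\inf\{\operatorname{ess\,sup}_{\gamma}\|f(\gamma)\|_{\gamma}\}$, the infimum over bounded analytic $f:\mathbb{D}\to\mathbb{C}^N$ with $f(0)=x$ ($f(\gamma)$ being the boundary values). *)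

(* Defs.v *)
From HB Require Import structures.
From mathcomp Require Import all_boot all_order all_algebra.
From mathcomp Require Import complex.
From mathcomp Require Import all_classical all_reals all_analysis.
From mathcomp Require Import ess_sup_inf.

Set Implicit Arguments.
Unset Strict Implicit.
Unset Printing Implicit Defensive.
Import Order.TTheory GRing.Theory Num.Theory.
Import numFieldNormedType.Exports.

Local Open Scope classical_set_scope.
Local Open Scope complex_scope.
Local Open Scope ring_scope.

(* `|z| takes its values in R[i]; cmod z is the modulus as an element of R. *)
Notation cmod := Normc.normc.

Section circle.
Variable R : realType.

Record circle := Circle { circle_val :> R[i]; _ : `|circle_val| == 1 }.
HB.instance Definition _ := [isSub for circle_val].
HB.instance Definition _ := [Choice of circle by <:].

(* The reals with the Lebesgue sigma-algebra (the domain of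
   completed_lebesgue_measure), which is larger than the Borel one. *)
Definition lebesgueR := caratheodory_type ((wlength (@idfun R))^*)%mu.

Lemma circle_param_subproof (t : R) :
  `|(cos (2 * pi * t) +i* sin (2 * pi * t)) : R[i]| == 1.
Proof. by rewrite normc_def /= cos2Dsin2 sqrtr1. Qed.

Definition circle_param (t : lebesgueR) : circle :=
  Circle (circle_param_subproof t).

HB.instance Definition _ := isPointed.Build circle (circle_param (0 : R)).

(* A set A of the circle is Lebesgue measurable when {t | e^(2 i pi t) \in A}
   is a Lebesgue measurable set of reals. *)
Definition circle_measurable : set (set circle) :=
  image_set_system setT circle_param
    (@measurable _ lebesgueR : set (set lebesgueR)).

Lemma circle_sigma_algebra : sigma_algebra setT circle_measurable.
Proof.
apply: sigma_algebra_image.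
split; first exact: measurable0.
- by move=> A mA; rewrite setTD; exact: measurableC.
- by move=> F mF; exact: bigcup_measurable.
Qed.

Let circle_measurable0 : circle_measurable set0.
Proof. by case: circle_sigma_algebra. Qed.

Let circle_measurableC A : circle_measurable A -> circle_measurable (~` A).
Proof. by case: circle_sigma_algebra => _ /[swap] _ /[apply]; rewrite setTD. Qed.

Let circle_measurable_bigcup (F : (set circle)^nat) :
  (forall i, circle_measurable (F i)) -> circle_measurable (\bigcup_i F i).
Proof. by case: circle_sigma_algebra => _ _; apply. Qed.

HB.instance Definition _ := @isMeasurable.Build default_measure_display circle
  circle_measurable circle_measurable0 circle_measurableC
  circle_measurable_bigcup.

Lemma measurable_circle_param : measurable_fun setT circle_param.
Proof. by move=> _ A. Qed.

Lemma measurable_unit_itv : measurable (`[0 : R, 1[ : set lebesgueR).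
Proof.
apply: sub_caratheodory => /=.
exact: (measurable_itv (`[0, 1[ : interval R)).
Qed.

Definition unit_lebesgue : set lebesgueR -> \bar R :=
  mrestr (@completed_lebesgue_measure R) measurable_unit_itv.
HB.instance Definition _ := Measure.on unit_lebesgue.

Definition circle_mu : set circle -> \bar R :=
  pushforward unit_lebesgue circle_param.

Let circle_mu0 : circle_mu set0 = 0%E.
Proof. exact: measure0. Qed.

Let circle_mu_ge0 A : (0 <= circle_mu A)%E.
Proof. exact: measure_ge0. Qed.

Let circle_mu_sigma_additive : semi_sigma_additive circle_mu.
Proof.
exact: (@measure_semi_sigma_additive _ _ _
  (pushforward [the measure _ _ of unit_lebesgue] circle_param)).
Qed.

HB.instance Definition _ := isMeasure.Build _ _ _ circle_mu
  circle_mu0 circle_mu_ge0 circle_mu_sigma_additive.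

Let circle_muT : circle_mu setT = 1%E.
Proof.
rewrite /circle_mu /pushforward preimage_setT /unit_lebesgue /mrestr setTI.
have <- : lebesgue_measure (`[0 : R, 1[%classic : set R) = 1%E.
  by rewrite lebesgue_measure_itv /= lte_fin ltr01 sube0.
by [].
Qed.

HB.instance Definition _ := Measure_isProbability.Build _ _ _ circle_mu
  circle_muT.

End circle.

Arguments circle_mu {R}.

Section families.
Variables (R : realType) (N : nat).
Notation V := 'rV[R[i]]_N.
Notation T := (circle R).
Notation m := (@circle_mu R).

Implicit Types (nrm : T -> V -> R) (F : R[i] -> V) (f : T -> V) (x : V).

Definition basis_vector (k : 'I_N) : V := delta_mx 0 k.

Record complex_norm (p : V -> R) : Prop := ComplexNorm {
  complex_norm_eq0 : forall x, p x = 0 -> x = 0;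
  complex_normZ : forall (a : R[i]) x, p (a *: x) = cmod a * p x;
  complex_normD : forall x y, p (x + y) <= p x + p y }.

Definition lattice_norm (p : V -> R) : Prop :=
  forall x y : V, (forall k, cmod (x 0 k) <= cmod (y 0 k)) -> p x <= p y.

Record compatible_family nrm : Prop := CompatibleFamily {
  family_norm : forall g, complex_norm (nrm g);
  family_measurable : forall x, measurable_fun setT (fun g => nrm g x);
  family_lattice : \forall g \ae m, lattice_norm (nrm g);
  family_bounds : forall k : 'I_N,
    let e g := (nrm g (basis_vector k))%:E in
    [/\ (0 < ess_inf m e)%E, (ess_inf m e <= ess_sup m e)%E
      & (ess_sup m e < +oo)%E] }.

(* The functions on the disc are total functions on R[i] of which only the
   values on the open unit disc matter. *)
Definition bounded_analytic F : Prop :=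
  (forall k z, `|z| < 1 ->
     derivable ((fun w => F w 0 k) : R[i]^o -> R[i]^o) z 1) /\
  (forall k, exists K : R, forall z, `|z| < 1 -> cmod (F z 0 k) <= K).

(* Radial limits; for a bounded analytic F they exist at almost every point of
   the circle, and elsewhere lim is a default value. *)
Definition boundary_value F (g : T) : V :=
  \row_k lim ((F (r%:C * circle_val g) 0 k : R[i]^o) @[r --> (1 : R)^'-]).

Definition interp_norm nrm x : \bar R :=
  ereal_inf [set ess_sup m (fun g => (nrm g (boundary_value F g))%:E) |
             F in [set F | bounded_analytic F /\ F 0 = x]].

Definition bounded_measurable f : Prop :=
  forall k, [/\ measurable_fun setT (fun g => complex.Re (f g 0 k)),
    measurable_fun setT (fun g => complex.Im (f g 0 k))
    & exists K : R, forall g, cmod (f g 0 k) <= K].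

(* lne 0 = -oo, and the integral of a measurable function bounded above is
   an element of [-oo, +oo[. *)
Definition log_dominates f x : Prop :=
  forall k, (lne (cmod (x 0 k))%:E <= \int[m]_g lne (cmod (f g 0 k))%:E)%E.

Definition measure_preserving (M : T -> T) : Prop :=
  measurable_fun setT M /\
  forall A : set T, measurable A -> m (M @^-1` A) = m A.

End families.

(* Main.v *)
(* A bounded analytic function has radial limits almost everywhere and satisfies
   Jensen's inequality, so its boundary function is admissible for the infimum;
   this bounds the infimum by [log ||x||]. Conversely, if bounded functions satisfy
   [log |x_k| <= \int w_k] and [log ||exp w||_g <= psi g], the outer functions with
   boundary modulus [exp (w_k - psi + \int psi)] give, after multiplication by
   constants of modulus at most [1], an analytic [F] with [F 0 = x] and boundary
   norms at most [exp (\int psi)].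

   Such [w] and [psi] are produced from any [f] admissible for the family
   [||.||_(M g)], where [M] preserves the measure. Approximate [log (|f| + e)] by a
   function with finitely many values [tau_i], and cut the circle into finitely many
   pieces [A_j] on which each function [g |-> log (||exp tau_i||_g + e)] is nearly
   constant; on [A_j] let [w] be the average of the approximation over [M^-1 A_j].
   Lattice norms are logarithmically convex, so [psi] can be taken with [\int psi]
   at most the integral of [log ||f g||_(M g)], up to an error vanishing with [e].
   The case [M = id] completes the formula, and the general case, together with the
   map [f |-> f \o M] in the other direction, shows that [M] preserves the norm. *)
Require Import Defs.
From HB Require Import structures.
From mathcomp Require Import all_boot all_order all_algebra.
From mathcomp Require Import complex.
From mathcomp Require Import all_classical all_reals all_analysis.
From mathcomp Require Import ess_sup_inf measurable_realfun.
From mathcomp Require Import ring lra.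
Import Order.TTheory GRing.Theory Num.Theory.
Import numFieldNormedType.Exports.
Set Implicit Arguments.
Unset Strict Implicit.
Unset Printing Implicit Defensive.
Local Open Scope classical_set_scope.
Local Open Scope ring_scope.

(** The norm is an infimum of essential suprema, whereas the formula averages logarithms. The gap
    closes because the lattice property makes only moduli of boundary values count: an outer factor
    can even out the norm over the circle without changing its geometric mean. The obstacle is that
    [M] need not be invertible. A function admissible for the composed family pairs its value at [g]
    with the norm at [M g], and it cannot be composed with an inverse of [M]; a conditional mean
    along [M] takes the place of that composition. Finite partitions make this mean a finite convex
    combination, to which the triangle inequality applies. Logarithms stay bounded through the shift
    by [e], so [log 0 = -oo] enters only in a monotone limit. Radial limits rest on L2 norms over
    the circles of radius [r]: they increase with [r] and are bounded, so the dilates of a bounded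
    analytic function are Cauchy in L2 and a sequence of them converges almost everywhere. Its limit
    has the function as Poisson integral, and Lebesgue points do the rest. *)

Section complex_modulus.
Context {R : realType}.
Local Notation C := R[i].
Local Notation Re := complex.Re.
Local Notation Im := complex.Im.
Implicit Types (z w : C).

Lemma cmodE z : cmod z = Num.sqrt (Re z ^+ 2 + Im z ^+ 2).
Proof. by case: z. Qed.

Lemma normc_cmod z : `|z| = (cmod z)%:C%C.
Proof. by rewrite normc_def cmodE. Qed.

Lemma cmod_lt z (r : R) : (`|z| < r%:C%C) = (cmod z < r).
Proof. by rewrite normc_cmod ltcR. Qed.

Lemma cmod_ge0 z : 0 <= cmod z.
Proof. by rewrite cmodE sqrtr_ge0. Qed.

Lemma cmod_gt0 z : (0 < cmod z) = (z != 0).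
Proof.
rewrite lt_def cmod_ge0 andbT; congr (~~ _); apply/eqP/eqP => [|->].
  exact: Normc.eq0_normc.
exact: Normc.normc0.
Qed.

Lemma cmodM z w : cmod (z * w) = cmod z * cmod w.
Proof. exact: Normc.normcM. Qed.

Lemma cmodV z : cmod z^-1 = (cmod z)^-1.
Proof. exact: Normc.normcV. Qed.

Lemma cmodN z : cmod (- z) = cmod z.
Proof. exact: normcN. Qed.

Lemma cmodD z w : cmod (z + w) <= cmod z + cmod w.
Proof. exact: le_normcD. Qed.

Lemma cmodB z w : cmod (z - w) = cmod (w - z).
Proof. by rewrite -cmodN opprB. Qed.

Lemma cmod_sub_ge z w : cmod z - cmod w <= cmod (z - w).
Proof. by rewrite lerBlDr (le_trans _ (cmodD _ _))// subrK. Qed.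

Lemma cmodr (r : R) : cmod r%:C%C = `|r|.
Proof. by rewrite cmodE /= expr0n /= addr0 sqrtr_sqr. Qed.

Lemma cmod_sqr z : cmod z ^+ 2 = Re z ^+ 2 + Im z ^+ 2.
Proof. by rewrite cmodE sqr_sqrtr// addr_ge0// sqr_ge0. Qed.

Lemma normRe_le_cmod z : `|Re z| <= cmod z.
Proof.
by rewrite -(@ler_pXn2r _ 2) ?nnegrE ?cmod_ge0// cmod_sqr real_normK ?num_real// lerDl sqr_ge0.
Qed.

Lemma normIm_le_cmod z : `|Im z| <= cmod z.
Proof.
by rewrite -(@ler_pXn2r _ 2) ?nnegrE ?cmod_ge0// cmod_sqr real_normK ?num_real// lerDr sqr_ge0.
Qed.

Lemma cmod_le_ReIm z : cmod z <= `|Re z| + `|Im z|.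
Proof.
rewrite -(@ler_pXn2r _ 2) ?nnegrE ?cmod_ge0// ?addr_ge0// cmod_sqr sqrrD.
by rewrite !real_normK ?num_real// lerD2r lerDl mulrn_wge0// mulr_ge0.
Qed.

Lemma ReD z w : Re (z + w) = Re z + Re w. Proof. by case: z; case: w. Qed.
Lemma ImD z w : Im (z + w) = Im z + Im w. Proof. by case: z; case: w. Qed.
Lemma ReN z : Re (- z) = - Re z. Proof. by case: z. Qed.
Lemma ImN z : Im (- z) = - Im z. Proof. by case: z. Qed.
Lemma ReM z w : Re (z * w) = Re z * Re w - Im z * Im w.
Proof. by case: z; case: w. Qed.
Lemma ImM z w : Im (z * w) = Re z * Im w + Im z * Re w.
Proof. by case: z; case: w. Qed.
Lemma ReV z : Re z^-1 = Re z / cmod z ^+ 2.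
Proof. by rewrite cmod_sqr; case: z. Qed.
Lemma ImV z : Im z^-1 = - Im z / cmod z ^+ 2.
Proof. by rewrite cmod_sqr mulNr; case: z. Qed.

Lemma complex_eqP z w : Re z = Re w -> Im z = Im w -> z = w.
Proof. by case: z => a b; case: w => c d /= -> ->. Qed.

Definition ReImE := (ReD, ImD, ReN, ImN, ReM, ImM).

End complex_modulus.

(** * Complex derivatives *)

Section complex_derivative.
Context {R : realType}.
Local Notation C := R[i].
Local Notation Re := complex.Re.
Local Notation Im := complex.Im.

(** Scalars are taken in the field [R[i]], so the derivative in the direction [1] is the complex
    derivative. *)
Definition holo (f : C -> C) (z : C) := derivable (f : C^o -> C^o) z 1.

(* The o(h) formulation uses real-valued moduli, as [`|z|] is an element of [R[i]]. *)
Lemma holoP (f : C -> C) z : holo f z <->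
  exists l : C, forall e : R, 0 < e -> exists2 d : R, 0 < d &
    forall h : C, cmod h < d -> cmod (f (z + h) - f z - l * h) <= e * cmod h.
Proof.
split.
  rewrite /holo /derivable => /cvg_ex[/= l fl]; exists l => e e0.
  move/cvgrPdist_le : fl => /(_ e%:C%C); rewrite ltcR => /(_ e0).
  rewrite /dnbhs /within /= => /nbhs_ballP[d /=]; case: d => d d'.
  rewrite ltcE /= => /andP[/eqP -> d0] H.
  exists d => // h hd.
  have [->|h0] := eqVneq h 0.
    by rewrite mulr0 addr0 subr0 subrr Normc.normc0 mulr0.
  have := H h; rewrite /ball /= sub0r normrN => /(_ _ h0).
  have -> : (`|h| < d +i* 0)%C by rewrite -[(d +i* 0)%C]/(d%:C%C) cmod_lt.
  move=> /(_ isT); rewrite normc_cmod lecR.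
  have hp : 0 < cmod h by rewrite cmod_gt0.
  rewrite [h%:A]mulr1 -(ler_pM2r hp) -cmodM => /(le_trans _); apply.
  rewrite -cmodN le_eqVlt; apply/orP; left; apply/eqP; congr cmod.
  by rewrite (addrC z h) -[_ *: _]/(h^-1 * (f (h + z) - f z)); field.
move=> [l H]; apply/cvg_ex; exists l; apply/cvgrPdist_le => /= -[e e'].
rewrite ltcE /= => /andP[/eqP -> e0].
have [d d0 Hd] := H _ e0.
rewrite /dnbhs /within /=; apply/nbhs_ballP; exists d%:C%C => /=.
  by rewrite ltcR.
move=> h; rewrite /ball /= sub0r normrN cmod_lt => hd h0.
have hp : 0 < cmod h by rewrite cmod_gt0.
rewrite normc_cmod lecR -(ler_pM2r hp) -cmodM.
apply: le_trans (Hd _ hd).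
rewrite -cmodN le_eqVlt; apply/orP; left; apply/eqP; congr cmod.
by rewrite [h%:A]mulr1 (addrC z h) -[_ *: _]/(h^-1 * (f (h + z) - f z)); field.
Qed.

Lemma holo_cst (c z : C) : holo (fun _ => c) z.
Proof. exact: derivable_cst. Qed.

Lemma holo_id (z : C) : holo id z.
Proof. exact: derivable_id. Qed.

Lemma holoD (f g : C -> C) z : holo f z -> holo g z -> holo (fun w => f w + g w) z.
Proof. exact: derivableD. Qed.

Lemma holoB (f g : C -> C) z : holo f z -> holo g z -> holo (fun w => f w - g w) z.
Proof. exact: derivableB. Qed.

Lemma holoM (f g : C -> C) z : holo f z -> holo g z -> holo (fun w => f w * g w) z.
Proof. exact: derivableM. Qed.

Lemma holoV (f : C -> C) z : f z != 0 -> holo f z -> holo (fun w => (f w)^-1) z.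
Proof. exact: derivableV. Qed.

Lemma holo_comp (f g : C -> C) z : holo f (g z) -> holo g z -> holo (fun w => f (g w)) z.
Proof.
rewrite /holo => /derivable1_diffP df /derivable1_diffP dg.
by apply/derivable1_diffP; exact: (differentiable_comp dg df).
Qed.

Lemma holo_continuous (f : C -> C) z : holo f z ->
  forall e : R, 0 < e -> exists2 d : R, 0 < d &
    forall w, cmod (w - z) < d -> cmod (f w - f z) < e.
Proof.
move=> /holoP[l H] e e0.
have [d d0 Hd] := H 1 ltr01.
have K0 : 0 < cmod l + 1 by rewrite ltr_wpDl ?cmod_ge0.
exists (Num.min d (e / (cmod l + 1))); first by rewrite lt_min d0 divr_gt0.
move=> w; rewrite lt_min => /andP[/Hd + we].
rewrite (addrC z) subrK mul1r => H1.
have -> : f w - f z = (f w - f z - l * (w - z)) + l * (w - z) by ring.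
rewrite (le_lt_trans (cmodD _ _))// cmodM (@le_lt_trans _ _ ((cmod l + 1) * cmod (w - z)))//.
  by rewrite mulrDl mul1r addrC lerD2l.
by rewrite mulrC -ltr_pdivlMr.
Qed.

Lemma holo_eq (f g : C -> C) z (d : R) : 0 < d ->
  (forall w, cmod (w - z) < d -> f w = g w) -> holo f z -> holo g z.
Proof.
move=> d0 fg /holoP[l H]; apply/holoP; exists l => e e0.
have [k k0 Hk] := H e e0; exists (Num.min d k); first by rewrite lt_min d0.
move=> h; rewrite lt_min => /andP[hd hk].
by rewrite -!fg ?Hk// ?subrr ?Normc.normc0// (addrC z) addrK.
Qed.

End complex_derivative.

(** * Bounded measurable functions *)

Section bounded_measurable_functions.
Context d (T : measurableType d) (R : realType).
Implicit Types (D : set T) (f g : T -> R).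

(** A class closed under ring operations and integrable on sets of finite measure, so that
    integrability never needs a separate estimate. *)
Definition bdmeas D f :=
  measurable_fun D f /\ exists B : R, forall t, D t -> `|f t| <= B.

Lemma bdmeas_cst D (c : R) : bdmeas D (fun _ => c).
Proof. by split; [exact: measurable_cst|exists `|c|]. Qed.

Lemma bdmeasD D f g : bdmeas D f -> bdmeas D g -> bdmeas D (fun t => f t + g t).
Proof.
move=> [mf [A fA]] [mg [B gB]]; split; first exact: measurable_funD.
by exists (A + B) => t Dt; rewrite (le_trans (ler_normD _ _))// lerD ?fA ?gB.
Qed.

Lemma bdmeasM D f g : bdmeas D f -> bdmeas D g -> bdmeas D (fun t => f t * g t).
Proof.
move=> [mf [A fA]] [mg [B gB]]; split; first exact: measurable_funM.
by exists (A * B) => t Dt; rewrite normrM ler_pM ?fA ?gB.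
Qed.

Lemma bdmeasN D f : bdmeas D f -> bdmeas D (fun t => - f t).
Proof.
move=> [mf [A fA]]; split; first exact: measurableT_comp.
by exists A => t Dt; rewrite normrN fA.
Qed.

Lemma bdmeasB D f g : bdmeas D f -> bdmeas D g -> bdmeas D (fun t => f t - g t).
Proof. by move=> hf hg; apply: bdmeasD => //; exact: bdmeasN. Qed.

Lemma bdmeas_norm D f : bdmeas D f -> bdmeas D (fun t => `|f t|).
Proof.
move=> [mf [A fA]]; split; first exact: measurableT_comp.
by exists A => t Dt; rewrite normr_id fA.
Qed.

Lemma bdmeasS D E f : measurable D -> E `<=` D -> bdmeas D f -> bdmeas E f.
Proof.
move=> mD ED [mf [A fA]]; split; first exact: measurable_funS mf.
by exists A => t /ED /fA.
Qed.

Lemma eq_bdmeas D f g : (forall t, D t -> f t = g t) -> bdmeas D f -> bdmeas D g.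
Proof.
move=> fg [mf [A fA]]; split.
  by apply: eq_measurable_fun mf => t; rewrite inE => /fg.
by exists A => t Dt; rewrite -fg// fA.
Qed.

Lemma bdmeas_integrable (mu : {measure set T -> \bar R}) D f :
  measurable D -> (mu D < +oo)%E -> bdmeas D f -> mu.-integrable D (EFin \o f).
Proof.
move=> mD muD [mf [B fB]]; apply: measurable_bounded_integrable => //.
exists B; split; rewrite ?num_real// => M BM t Dt.
exact: le_trans (fB _ Dt) (ltW BM).
Qed.

End bounded_measurable_functions.

(** * Integrals over compact intervals *)

Section interval_integrals.
Context {R : realType}.
Local Notation mu := (@lebesgue_measure R).
Implicit Types (f g : R -> R) (a b : R).

Lemma lebesgue_itv_lty a b : (mu `[a, b]%classic < +oo)%E.
Proof. by rewrite lebesgue_measure_itv; case: ifP => // _; rewrite -EFinB ltry. Qed.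

Lemma itv_integrable a b f : bdmeas `[a, b] f -> mu.-integrable `[a, b] (EFin \o f).
Proof. by move=> h; apply: (bdmeas_integrable (mu := mu)) h => //; exact: lebesgue_itv_lty. Qed.

Lemma continuous_bdmeas a b f : (forall x, a <= x <= b -> {for x, continuous f}) ->
  bdmeas `[a, b] f.
Proof.
move=> cf.
have cw : {within `[a, b], continuous f}.
  by apply: continuous_in_subspaceT => x; rewrite inE /= in_itv /= => /cf.
split; first by apply: subspace_continuous_measurable_fun.
have [ab|ab] := leP a b; last first.
  by exists 0 => t /=; rewrite in_itv /= => /andP[h1 h2]; have := le_trans h1 h2; rewrite leNgt ab.
have cw' : {within `[a, b], continuous (fun x => `|f x|)}.
  apply: continuous_in_subspaceT => x; rewrite inE /= in_itv /= => /cf fx.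
  by apply: continuous_comp fx _; exact: norm_continuous.
have [c _ H] := EVT_max ab cw'.
by exists `|f c| => t tab; apply: H.
Qed.

Lemma lebesgue_itvE a b : a <= b -> mu `[a, b]%classic = (b - a)%:E.
Proof.
move=> ab; rewrite lebesgue_measure_itv /= lte_fin.
by case: ltP => [|ba]; rewrite -?EFinB//; have -> : a = b; [lra|rewrite subrr].
Qed.

Lemma Rintegral_itv_cst a b (c : R) : a <= b ->
  \int[mu]_(x in `[a, b]) c = c * (b - a).
Proof.
move=> ab; rewrite Rintegral_cst//; congr (c * _).
by rewrite -[RHS]/(fine (b - a)%:E); congr fine; exact: lebesgue_itvE.
Qed.

Lemma Rintegral_split a m b f : a <= m <= b -> bdmeas `[a, b] f ->
  \int[mu]_(x in `[a, b]) f x =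
  \int[mu]_(x in `[a, m]) f x + \int[mu]_(x in `[m, b]) f x.
Proof.
move=> /andP[am mb] hf; apply/eqP; rewrite addrC -subr_eq; apply/eqP.
rewrite Rintegral_itvB ?bnd_simp//; last exact: itv_integrable.
rewrite Rintegral_itv_obnd_cbnd//.
apply: (integrableS (mu := mu) _ _ _ (itv_integrable hf)) => // x /=.
by rewrite !in_itv /= => /andP[mx ->]; rewrite (le_trans am (ltW mx)).
Qed.

Lemma le_norm_Rintegral_itv a b f (K : R) : a <= b -> bdmeas `[a, b] f ->
  (forall x, a <= x <= b -> `|f x| <= K) ->
  `|\int[mu]_(x in `[a, b]) f x| <= K * (b - a).
Proof.
move=> ab hf fK; rewrite -Rintegral_itv_cst//.
apply: le_trans (le_normr_Rintegral _ (itv_integrable hf)) _ => //.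
apply: le_Rintegral => //; first exact: (itv_integrable (bdmeas_norm hf)).
exact: (itv_integrable (bdmeas_cst _ _)).
Qed.

End interval_integrals.

(** * Goursat's theorem on rectangles *)

Section goursat_bisection.
Context {R : realType}.
Variables (J : R -> R -> R -> R -> R) (a b c d : R).
Hypotheses (ab : a <= b) (cd : c <= d).
Hypothesis J_hsplit : forall x x' y y', a <= x -> x <= x' -> x' <= b ->
  c <= y -> y <= y' -> y' <= d ->
  J x x' y y' = J x ((x + x') / 2) y y' + J ((x + x') / 2) x' y y'.
Hypothesis J_vsplit : forall x x' y y', a <= x -> x <= x' -> x' <= b ->
  c <= y -> y <= y' -> y' <= d ->
  J x x' y y' = J x x' y ((y + y') / 2) + J x x' ((y + y') / 2) y'.
Hypothesis J_small : forall X Y, a <= X <= b -> c <= Y <= d ->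
  forall e : R, 0 < e -> exists2 r : R, 0 < r &
  forall x x' y y', a <= x -> x <= X <= x' -> x' <= b ->
    c <= y -> y <= Y <= y' -> y' <= d -> x' - x < r -> y' - y < r ->
    `|J x x' y y'| <= e * ((x' - x) + (y' - y)) ^+ 2.

(** Here [u] and [v] are half the sides. If all four quarters failed, the triangle inequality for
    the sum of the four values would be violated. *)
Let quadrant (x y u v : R) : 0 <= u -> 0 <= v ->
  a <= x -> x + u + u <= b -> c <= y -> y + v + v <= d ->
  exists q : R * R, [/\ x <= q.1 <= x + u, y <= q.2 <= y + v &
    `|J x (x + u + u) y (y + v + v)| <= 4 * `|J q.1 (q.1 + u) q.2 (q.2 + v)|].
Proof.
move=> u0 v0 ax xb cy yd.
have mx : (x + (x + u + u)) / 2 = x + u by field.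
have my : (y + (y + v + v)) / 2 = y + v by field.
have xu : x <= x + u by rewrite lerDl.
have xuu : x + u <= x + u + u by rewrite lerDl.
have yv : y <= y + v by rewrite lerDl.
have yvv : y + v <= y + v + v by rewrite lerDl.
have yvv' := le_trans yv yvv; have xub := le_trans xuu xb.
have axu := le_trans ax xu; have xuu' := le_trans xu xuu.
have := J_hsplit ax xuu' xb cy yvv' yd; rewrite mx => ->.
have := J_vsplit ax xu xub cy yvv' yd; rewrite my => ->.
have := J_vsplit axu xuu xb cy yvv' yd; rewrite my => ->.
set A := J _ _ _ _; set B := J _ _ _ _; set A' := J _ _ _ _; set B' := J _ _ _ _.
have [hA|hA] := leP (`|A + B + (A' + B')|) (4 * `|A|).
  by exists (x, y); rewrite /= !lexx !lerDl ?u0 ?v0.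
have [hB|hB] := leP (`|A + B + (A' + B')|) (4 * `|B|).
  by exists (x, y + v); rewrite /= !lexx !lerDl ?u0 ?v0.
have [hA'|hA'] := leP (`|A + B + (A' + B')|) (4 * `|A'|).
  by exists (x + u, y); rewrite /= !lexx !lerDl ?u0 ?v0.
have [hB'|hB'] := leP (`|A + B + (A' + B')|) (4 * `|B'|).
  by exists (x + u, y + v); rewrite /= !lexx !lerDl ?u0 ?v0.
have := ler_normD (A + B) (A' + B'); have := ler_normD A B; have := ler_normD A' B'.
lra.
Qed.

Let w n := (b - a) / 2 ^+ n.
Let h n := (d - c) / 2 ^+ n.
Let Q n (p : R * R) : R := `|J p.1 (p.1 + w n) p.2 (p.2 + h n)|.

Let wS n : w n = w n.+1 + w n.+1.
Proof. by rewrite /w exprS; field; rewrite expf_neq0. Qed.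
Let hS n : h n = h n.+1 + h n.+1.
Proof. by rewrite /h exprS; field; rewrite expf_neq0. Qed.
Let w0 n : 0 <= w n.
Proof. by rewrite divr_ge0 ?subr_ge0// exprn_ge0. Qed.
Let h0 n : 0 <= h n.
Proof. by rewrite divr_ge0 ?subr_ge0// exprn_ge0. Qed.

Let inside n (p : R * R) :=
  [/\ a <= p.1, p.1 + w n <= b, c <= p.2 & p.2 + h n <= d].

Let step n p : inside n p -> exists q : R * R,
  [/\ p.1 <= q.1 <= p.1 + w n.+1, p.2 <= q.2 <= p.2 + h n.+1 &
      Q n p <= 4 * Q n.+1 q].
Proof.
case: p => x y [/= ax xb cy yd].
rewrite wS addrA in xb; rewrite hS addrA in yd.
have [q Hq] := quadrant (w0 _) (h0 _) ax xb cy yd.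
by exists q; rewrite /Q /= (wS n) (hS n) !addrA.
Qed.

(** Following a worst quarter at each step loses a factor [4] per step, while the squared sides
    shrink by [4]. At the common point of the nested rectangles [J_small] then bounds the original
    value by [e] times a constant. *)
Lemma bisection_eq0 : J a b c d = 0.
Proof.
(* The fallback [p] only makes [nxt] total; [sin] shows that it is never reached. *)
pose nxt n p := if pselect (inside n p) is left H then projT1 (cid (step H)) else p.
pose s := fix s n := if n is k.+1 then nxt k (s k) else (a, c).
have sin n : inside n (s n).
  elim: n => [|n IH]; first by split; rewrite //= /w /h expr0 divr1; lra.
  rewrite /= /nxt; case: pselect => // H; case: cid => q /= [/andP[q1 q2] /andP[q3 q4] _].
  move: H => [? ? ? ?]; have := wS n; have := hS n => e1 e2.
  by split; lra.
have sS n : [/\ (s n).1 <= (s n.+1).1 <= (s n).1 + w n.+1,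
    (s n).2 <= (s n.+1).2 <= (s n).2 + h n.+1 & Q n (s n) <= 4 * Q n.+1 (s n.+1)].
  by rewrite /= /nxt; case: pselect => [H|/(_ (sin n))//]; case: cid.
have mono1 n m : (s n).1 <= (s (n + m)%N).1 /\ (s (n + m)%N).1 + w (n + m)%N <= (s n).1 + w n.
  elim: m => [|m [I1 I2]]; first by rewrite addn0.
  rewrite addnS; have [/andP[u v] _ _] := sS (n + m)%N; have e1 := wS (n + m)%N.
  by split; [exact: le_trans I1 u|lra].
have mono2 n m : (s n).2 <= (s (n + m)%N).2 /\ (s (n + m)%N).2 + h (n + m)%N <= (s n).2 + h n.
  elim: m => [|m [I1 I2]]; first by rewrite addn0.
  rewrite addnS; have [_ /andP[u v] _] := sS (n + m)%N; have e1 := hS (n + m)%N.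
  by split; [exact: le_trans I1 u|lra].
(* Each left end lies below each right end, whichever rectangle is the smaller, so the supremum of
   the left ends belongs to all the intervals. *)
have ub1 n : ubound (range (fun k => (s k).1)) ((s n).1 + w n).
  move=> _ [k _ <-] /=; have [nk|kn] := leqP n k.
    have [_] := mono1 n (k - n)%N; rewrite subnKC//; have := w0 k; lra.
  have [+ _] := mono1 k (n - k)%N; rewrite subnKC ?(ltnW kn)//; have := w0 n; lra.
have ub2 n : ubound (range (fun k => (s k).2)) ((s n).2 + h n).
  move=> _ [k _ <-] /=; have [nk|kn] := leqP n k.
    have [_] := mono2 n (k - n)%N; rewrite subnKC//; have := h0 k; lra.
  have [+ _] := mono2 k (n - k)%N; rewrite subnKC ?(ltnW kn)//; have := h0 n; lra.
pose X := sup (range (fun k => (s k).1)); pose Y := sup (range (fun k => (s k).2)).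
have X1 n : (s n).1 <= X <= (s n).1 + w n.
  apply/andP; split; last by apply: ge_sup; [exists a; exists 0%N|exact: ub1].
  apply: ub_le_sup; last by exists n.
  by exists ((s 0%N).1 + w 0%N); exact: ub1.
have Y1 n : (s n).2 <= Y <= (s n).2 + h n.
  apply/andP; split; last by apply: ge_sup; [exists c; exists 0%N|exact: ub2].
  apply: ub_le_sup; last by exists n.
  by exists ((s 0%N).2 + h 0%N); exact: ub2.
have Qn n : Q 0%N (a, c) <= 4 ^+ n * Q n (s n).
  elim: n => [|n IH]; first by rewrite expr0 mul1r.
  apply: le_trans IH _; rewrite exprSr -mulrA ler_wpM2l ?exprn_ge0//.
  by have [] := sS n.
have Q0E : Q 0%N (a, c) = `|J a b c d|.
  by rewrite /Q /w /h /= expr0 !divr1 !(addrC _ (_ - _)) !subrK.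
apply/eqP; rewrite -normr_le0 leNgt; apply/negP => K0.
(* With this choice [e] times the squared half-perimeter is at most half of the value to be refuted;
   the added [1] covers a degenerate rectangle. *)
pose e := `|J a b c d| / (2 * (((b - a) + (d - c)) ^+ 2 + 1)).
have D0 : 0 < ((b - a) + (d - c)) ^+ 2 + 1 by rewrite ltr_wpDl ?sqr_ge0.
have e0 : 0 < e by rewrite divr_gt0 // mulr_gt0.
have XX : a <= X <= b.
  by have := X1 0%N; rewrite /w /= expr0 divr1 addrC subrK.
have YY : c <= Y <= d.
  by have := Y1 0%N; rewrite /h /= expr0 divr1 addrC subrK.
have [r r0 Hr] := J_small XX YY e0.
have [n nr] : exists n, w n < r /\ h n < r.
  have [n Hn] : exists n : nat, (b - a + (d - c)) / r < n%:R.
    by exists (Num.truncn ((b - a + (d - c)) / r)).+1; rewrite truncnS_gt.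
  exists n; have n2 : (n%:R : R) <= 2 ^+ n by rewrite -natrX ler_nat ltnW// ltn_expl.
  have p2 : 0 < 2 ^+ n :> R by rewrite exprn_gt0.
  have : b - a + (d - c) < r * 2 ^+ n.
    by rewrite mulrC -ltr_pdivrMr// (lt_le_trans Hn).
  by rewrite /w /h !ltr_pdivrMr// => ?; split; lra.
have [i1 i2 i3 i4] := sin n.
have := Hr _ _ _ _ i1 (X1 n) i2 i3 (Y1 n) i4.
rewrite !(addrC _ (w n)) !(addrC _ (h n)) !addrK => /(_ nr.1 nr.2).
rewrite !(addrC (w n)) !(addrC (h n)) => Hn.
have : `|J a b c d| <= 4 ^+ n * (e * (w n + h n) ^+ 2).
  by rewrite -Q0E (le_trans (Qn n))// ler_wpM2l ?exprn_ge0.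
have -> : 4 ^+ n * (e * (w n + h n) ^+ 2) = e * ((b - a) + (d - c)) ^+ 2.
  have -> : 4 ^+ n = (2 ^+ n) ^+ 2 :> R by rewrite -exprM mulnC exprM; congr (_ ^+ n); ring.
  by rewrite /w /h; field; rewrite expf_neq0.
rewrite /e mulrAC ler_pdivlMr ?mulr_gt0// => H.
have := mulr_gt0 K0 D0; nra.
Qed.

End goursat_bisection.

Section interval_integral_linearity.
Context {R : realType}.
Local Notation mu := (@lebesgue_measure R).
Variables (a b : R).
Implicit Types f g : R -> R.

Lemma itv_intD f g : bdmeas `[a, b] f -> bdmeas `[a, b] g ->
  \int[mu]_(t in `[a, b]) (f t + g t) =
  \int[mu]_(t in `[a, b]) f t + \int[mu]_(t in `[a, b]) g t.
Proof. by move=> hf hg; apply: RintegralD => //; exact: itv_integrable. Qed.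

Lemma itv_intB f g : bdmeas `[a, b] f -> bdmeas `[a, b] g ->
  \int[mu]_(t in `[a, b]) (f t - g t) =
  \int[mu]_(t in `[a, b]) f t - \int[mu]_(t in `[a, b]) g t.
Proof. by move=> hf hg; apply: RintegralB => //; exact: itv_integrable. Qed.

Lemma itv_intZ (c : R) f : bdmeas `[a, b] f ->
  \int[mu]_(t in `[a, b]) (c * f t) = c * \int[mu]_(t in `[a, b]) f t.
Proof. by move=> hf; apply: RintegralZl => //; exact: itv_integrable. Qed.

Lemma le_itv_int f g : bdmeas `[a, b] f -> bdmeas `[a, b] g ->
  (forall t, a <= t <= b -> f t <= g t) ->
  \int[mu]_(t in `[a, b]) f t <= \int[mu]_(t in `[a, b]) g t.
Proof.
move=> hf hg fg; apply: le_Rintegral => //; first exact: itv_integrable.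
exact: itv_integrable.
Qed.

Lemma eq_itv_int f g : (forall t, a <= t <= b -> f t = g t) ->
  \int[mu]_(t in `[a, b]) f t = \int[mu]_(t in `[a, b]) g t.
Proof. by move=> fg; apply: eq_Rintegral => t; rewrite inE /= in_itv /= => /fg. Qed.

End interval_integral_linearity.

Lemma continuous_epsdelta {R : realType} (f : R -> R) (x : R) :
  (forall e, 0 < e -> exists2 d : R, 0 < d & forall t, `|t - x| < d -> `|f t - f x| < e) ->
  {for x, continuous f}.
Proof.
move=> H; apply/cvgrPdist_lt => e /H[d d0 Hd]; apply/nbhs_ballP; exists d => //= t.
by rewrite /ball /= distrC => /Hd; rewrite distrC.
Qed.

Section goursat_rectangle.
Context {R : realType}.
Local Notation mu := (@lebesgue_measure R).
Variables (p q : R -> R -> R) (a b c d : R).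
Hypotheses (ab : a <= b) (cd : c <= d).
Hypothesis closed_form : forall x y, a <= x <= b -> c <= y <= d ->
  exists k l m : R, forall e : R, 0 < e -> exists2 r : R, 0 < r &
  forall u v, `|u| < r -> `|v| < r ->
    `|p (x + u) (y + v) - p x y - (k * u + l * v)| <= e * (`|u| + `|v|) /\
    `|q (x + u) (y + v) - q x y - (l * u + m * v)| <= e * (`|u| + `|v|).

Let slope_continuous (f : R -> R) (x k : R) :
  (exists2 r : R, 0 < r & forall u, `|u| < r -> `|f (x + u) - f x - k * u| <= `|u|) ->
  {for x, continuous f}.
Proof.
move=> [r r0 H]; apply: continuous_epsdelta => e e0.
have K0 : 0 < 1 + `|k| by rewrite ltr_pwDl.
exists (Num.min r (e / (1 + `|k|))); first by rewrite lt_min r0 divr_gt0.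
move=> t; rewrite lt_min => /andP[/H + te].
rewrite (addrC x) subrK => Ht.
have -> : f t - f x = (f t - f x - k * (t - x)) + k * (t - x) by ring.
rewrite (le_lt_trans (ler_normD _ _))// normrM.
rewrite (@le_lt_trans _ _ ((1 + `|k|) * `|t - x|))//; first by rewrite mulrDl mul1r lerD2r.
by rewrite mulrC -ltr_pdivlMr.
Qed.

Let p_continuous x y : a <= x <= b -> c <= y <= d -> {for x, continuous (p ^~ y)}.
Proof.
move=> xab ycd; have [k [l [m H]]] := closed_form xab ycd.
have [r r0 Hr] := H 1 ltr01.
apply: (@slope_continuous _ _ k); exists r => // u ur.
have [] := Hr u 0 ur; first by rewrite normr0.
by rewrite mulr0 !addr0 normr0 mul1r addr0.
Qed.

Let q_continuous x y : a <= x <= b -> c <= y <= d -> {for y, continuous (q x)}.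
Proof.
move=> xab ycd; have [k [l [m H]]] := closed_form xab ycd.
have [r r0 Hr] := H 1 ltr01.
apply: (@slope_continuous _ _ m); exists r => // v vr.
have [] := Hr 0 v; [by rewrite normr0|by []|move=> _].
by rewrite mulr0 add0r !addr0 normr0 mul1r add0r.
Qed.

Let p_bd x x' y : a <= x -> x' <= b -> c <= y <= d -> bdmeas `[x, x'] (p ^~ y).
Proof.
move=> ax xb ycd; apply: continuous_bdmeas => t /andP[t1 t2].
by apply: p_continuous => //; rewrite (le_trans ax t1) (le_trans t2 xb).
Qed.

Let q_bd x y y' : a <= x <= b -> c <= y -> y' <= d -> bdmeas `[y, y'] (q x).
Proof.
move=> xab cy yd; apply: continuous_bdmeas => t /andP[t1 t2].
by apply: q_continuous => //; rewrite (le_trans cy t1) (le_trans t2 yd).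
Qed.

Let J x x' y y' := \int[mu]_(t in `[x, x']) (p t y - p t y') +
  \int[mu]_(t in `[y, y']) (q x' t - q x t).

Let pB_bd x x' y y' : a <= x -> x' <= b -> c <= y <= d -> c <= y' <= d ->
  bdmeas `[x, x'] (fun t => p t y - p t y').
Proof. by move=> *; apply: bdmeasB; apply: p_bd. Qed.

Let qB_bd x x' y y' : c <= y -> y' <= d -> a <= x <= b -> a <= x' <= b ->
  bdmeas `[y, y'] (fun t => q x' t - q x t).
Proof. by move=> *; apply: bdmeasB; apply: q_bd. Qed.

(** The hypothesis [closed_form] is pointwise: [p dx + q dy] has a symmetric derivative, with no
    continuity assumed, which is why bisection is used. Near a point the affine part of the form
    contributes nothing around a rectangle, and the remainder is small against the squared sides. *)
Lemma goursat_rectangle :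
  \int[mu]_(t in `[a, b]) (p t c - p t d) +
  \int[mu]_(t in `[c, d]) (q b t - q a t) = 0.
Proof.
apply: (@bisection_eq0 _ J a b c d) => //.
- move=> x x' y y' ax xx xb cy yy yd.
  have ycd : c <= y <= d by rewrite cy (le_trans yy yd).
  have ycd' : c <= y' <= d by rewrite yd (le_trans cy yy).
  have xab : a <= x <= b by rewrite ax (le_trans xx xb).
  have xab' : a <= x' <= b by rewrite xb (le_trans ax xx).
  set m := (x + x') / 2.
  have xm : x <= m by rewrite /m; lra.
  have mx : m <= x' by rewrite /m; lra.
  have mab : a <= m <= b by rewrite (le_trans ax xm) (le_trans mx xb).
  rewrite /J (@Rintegral_split _ x m x') ?xm//; last exact: pB_bd.
  have -> : \int[mu]_(t in `[y, y']) (q x' t - q x t) =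
      \int[mu]_(t in `[y, y']) (q m t - q x t) + \int[mu]_(t in `[y, y']) (q x' t - q m t).
    rewrite -itv_intD; [|exact: qB_bd..].
    by apply: eq_Rintegral => t _; ring.
  by rewrite addrACA.
- move=> x x' y y' ax xx xb cy yy yd.
  have ycd : c <= y <= d by rewrite cy (le_trans yy yd).
  have ycd' : c <= y' <= d by rewrite yd (le_trans cy yy).
  have xab : a <= x <= b by rewrite ax (le_trans xx xb).
  have xab' : a <= x' <= b by rewrite xb (le_trans ax xx).
  set m := (y + y') / 2.
  have ym : y <= m by rewrite /m; lra.
  have my : m <= y' by rewrite /m; lra.
  have mcd : c <= m <= d by rewrite (le_trans cy ym) (le_trans my yd).
  rewrite /J (@Rintegral_split _ y m y') ?ym//; last exact: qB_bd.
  have -> : \int[mu]_(t in `[x, x']) (p t y - p t y') =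
      \int[mu]_(t in `[x, x']) (p t y - p t m) + \int[mu]_(t in `[x, x']) (p t m - p t y').
    rewrite -itv_intD; [|exact: pB_bd..].
    by apply: eq_Rintegral => t _; ring.
  by rewrite addrACA.
move=> X Y Xab Ycd e e0.
have [k [l [m H]]] := closed_form Xab Ycd.
have e40 : 0 < e / 4 by rewrite divr_gt0.
have [r r0 Hr] := H _ e40; exists r => // x x' y y' ax /andP[xX Xx] xb cy /andP[yY Yy] yd xr yr.
have xx : x <= x' := le_trans xX Xx; have yy : y <= y' := le_trans yY Yy.
have ycd : c <= y <= d by rewrite cy (le_trans yy yd).
have ycd' : c <= y' <= d by rewrite yd (le_trans cy yy).
have xab : a <= x <= b by rewrite ax (le_trans xx xb).
have xab' : a <= x' <= b by rewrite xb (le_trans ax xx).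
set S := (x' - x) + (y' - y).
have pt s t : x <= s <= x' -> y <= t <= y' ->
    `|p s t - p X Y - (k * (s - X) + l * (t - Y))| <= e / 4 * S /\
    `|q s t - q X Y - (l * (s - X) + m * (t - Y))| <= e / 4 * S.
  move=> /andP[s1 s2] /andP[t1 t2].
  have sX : `|s - X| <= x' - x by rewrite ler_norml; lra.
  have tY : `|t - Y| <= y' - y by rewrite ler_norml; lra.
  have := Hr _ _ (le_lt_trans sX xr) (le_lt_trans tY yr).
  rewrite (addrC X) (addrC Y) !subrK => -[h1 h2].
  by split; [apply: le_trans h1 _|apply: le_trans h2 _];
    rewrite ler_wpM2l ?(ltW e40)// lerD.
(* The two constants subtracted integrate to opposite values because the same [l] occurs in both;
   this is where the symmetry of the derivative enters. *)
have -> : J x x' y y' =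
    \int[mu]_(t in `[x, x']) ((p t y - p t y') - l * (y - y')) +
    \int[mu]_(t in `[y, y']) ((q x' t - q x t) - l * (x' - x)).
  rewrite itv_intB; [|exact: pB_bd|exact: bdmeas_cst].
  rewrite [in X in _ + X]itv_intB; [|exact: qB_bd|exact: bdmeas_cst].
  by rewrite !Rintegral_itv_cst// /J; ring.
have Iy : y <= y <= y' by rewrite lexx.
have Iy' : y <= y' <= y' by rewrite lexx andbT.
have Ix : x <= x <= x' by rewrite lexx.
have Ix' : x <= x' <= x' by rewrite lexx andbT.
have I1 : `|\int[mu]_(t in `[x, x']) ((p t y - p t y') - l * (y - y'))| <= e / 2 * S * (x' - x).
  apply: le_norm_Rintegral_itv => //.
    by apply: bdmeasB; [exact: pB_bd|exact: bdmeas_cst].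
  move=> t tx; have [h1 _] := pt t y tx Iy; have [h2 _] := pt t y' tx Iy'.
  have -> : p t y - p t y' - l * (y - y') =
    (p t y - p X Y - (k * (t - X) + l * (y - Y))) - (p t y' - p X Y - (k * (t - X) + l * (y' - Y))) by ring.
  rewrite (le_trans (ler_normB _ _))//.
  have -> : e / 2 * S = e / 4 * S + e / 4 * S by field.
  by rewrite lerD.
have I2 : `|\int[mu]_(t in `[y, y']) ((q x' t - q x t) - l * (x' - x))| <= e / 2 * S * (y' - y).
  apply: le_norm_Rintegral_itv => //.
    by apply: bdmeasB; [exact: qB_bd|exact: bdmeas_cst].
  move=> t ty; have [_ h1] := pt x' t Ix' ty; have [_ h2] := pt x t Ix ty.
  have -> : q x' t - q x t - l * (x' - x) =
    (q x' t - q X Y - (l * (x' - X) + m * (t - Y))) - (q x t - q X Y - (l * (x - X) + m * (t - Y))) by ring.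
  rewrite (le_trans (ler_normB _ _))//.
  have -> : e / 2 * S = e / 4 * S + e / 4 * S by field.
  by rewrite lerD.
rewrite (le_trans (ler_normD _ _))// (le_trans (lerD I1 I2))// -mulrDr -/S expr2 mulrA.
rewrite ler_wpM2r ?ler_wpM2r//; first by rewrite /S addr_ge0 ?subr_ge0.
  by rewrite /S addr_ge0 ?subr_ge0.
by lra.
Qed.

End goursat_rectangle.

(** * Circular means *)

Section complex_exponential.
Context {R : realType}.
Local Notation C := R[i].
Local Notation Re := complex.Re.
Local Notation Im := complex.Im.
Local Notation mu := (@lebesgue_measure R).

Definition expi (t : R) : C := (cos (2 * pi * t) +i* sin (2 * pi * t))%C.

Definition cexp (z : C) : C :=
  (expR (Re z) * cos (Im z) +i* (expR (Re z) * sin (Im z)))%C.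

Lemma cexpD z w : cexp (z + w) = cexp z * cexp w.
Proof.
apply: complex_eqP; rewrite /cexp ReImE /= !ReImE /= expRD ?cosD ?sinD; ring.
Qed.

Lemma cmod_cexp z : cmod (cexp z) = expR (Re z).
Proof.
rewrite /= !exprMn -mulrDr cos2Dsin2 mulr1 sqrtr_sqr ger0_norm// expR_ge0.
Qed.

Lemma cmod_expi t : cmod (expi t) = 1.
Proof. by rewrite /= cos2Dsin2 sqrtr1. Qed.

Lemma expiE t : expi t = cexp (0 +i* (2 * pi * t))%C.
Proof. by rewrite /cexp /= expR0 !mul1r. Qed.

Lemma expi_neq0 t : expi t != 0.
Proof. by rewrite -cmod_gt0 cmod_expi. Qed.

Lemma expi0 : expi 0 = 1.
Proof. by rewrite /expi mulr0 cos0 sin0. Qed.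

Lemma expi1 : expi 1 = 1.
Proof. by rewrite /expi mulr1 mulr_natl cos2pi sin2pi. Qed.

Lemma is_derive_epsdelta (f : R -> R) (x l : R) : is_derive x 1 f l ->
  forall e : R, 0 < e -> exists2 d : R, 0 < d &
    forall h : R, `|h| < d -> `|f (x + h) - f x - l * h| <= e * `|h|.
Proof.
move=> [df fl] e e0.
have : h^-1 *: ((f \o shift x) h%:A - f x) @[h --> 0^'] --> l.
  by move: df; rewrite /derivable -fl; exact.
move/cvgrPdist_le => /(_ e e0).
rewrite /dnbhs /within /= => /nbhs_ballP[d /= d0] H.
exists d => // h hd.
have [->|h0] := eqVneq h 0.
  by rewrite mulr0 addr0 subr0 subrr normr0 mulr0.
have := H h; rewrite /ball /= sub0r normrN => /(_ hd h0).
have hp : 0 < `|h| by rewrite normr_gt0.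
rewrite [h%:A]mulr1 -(ler_pM2r hp) -normrM => /(le_trans _); apply.
rewrite -normrN le_eqVlt; apply/orP; left; apply/eqP; congr (`|_|).
by rewrite (addrC x h) -[_ *: _]/(h^-1 * (f (h + x) - f x)); field.
Qed.

(** The functional equation reduces the claim to an estimate of [cexp h - 1 - h] at the origin,
    which follows from the real derivatives of [expR], [cos] and [sin] at [0]. *)
Lemma holo_cexp z : holo cexp z.
Proof.
apply/holoP; exists (cexp z) => e e0.
pose A := expR 1 : R; have A0 : 0 < A by exact: expR_gt0.
pose M := expR (Re z) : R; have M0 : 0 < M by exact: expR_gt0.
(* The estimates [P1] and [P2] add up to [k * (2 * A + 3) * cmod h], and [M] is the modulus of the
   factor [cexp z]; [A] bounds [expR (Re h)] as long as [cmod h <= 1]. *)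
pose k := e / (M * (2 * A + 3)).
have D0 : 0 < M * (2 * A + 3) by rewrite mulr_gt0// ltr_wpDl// mulr_ge0// ltW.
have k0 : 0 < k by exact: divr_gt0.
have [r1 r10 H1] := is_derive_epsdelta (is_derive_expR 0) k0.
have [r2 r20 H2] := is_derive_epsdelta (is_derive_cos 0) k0.
have [r3 r30 H3] := is_derive_epsdelta (is_derive_sin 0) k0.
have [r4 r40 H4] := is_derive_epsdelta (is_derive_expR 0) ltr01.
exists (Num.min (Num.min (Num.min r1 r2) (Num.min r3 r4)) (Num.min k 1)).
  by rewrite !lt_min r10 r20 r30 r40 k0 ltr01.
move=> h; rewrite !lt_min => /andP[/andP[/andP[h1 h2] /andP[h3 h4]] /andP[h5 h6]].
have ha := normRe_le_cmod h; have hb := normIm_le_cmod h.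
have := H1 _ (le_lt_trans ha h1); have := H2 _ (le_lt_trans hb h2).
have := H3 _ (le_lt_trans hb h3); have := H4 _ (le_lt_trans ha h4).
rewrite !add0r cos0 sin0 expR0 oppr0 mul0r !mul1r !subr0 addr0 => e4 e3 e2 e1.
have -> : cexp (z + h) - cexp z - cexp z * h = cexp z * (cexp h - 1 - h).
  by rewrite cexpD; ring.
rewrite cmodM cmod_cexp -/M.
set a := Re h in ha e1 e4 *; set b := Im h in hb e2 e3 *.
have EA : expR a <= A.
  by rewrite ler_expR (le_trans (ler_norm _))// (le_trans ha)// ltW.
have Ea0 := expR_ge0 a.
have cm0 := cmod_ge0 h.
have P1 : `|expR a * cos b - 1 - a| <= k * cmod h + A * (k * cmod h).
  have -> : expR a * cos b - 1 - a = (expR a - 1 - a) + expR a * (cos b - 1) by ring.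
  rewrite (le_trans (ler_normD _ _))// lerD//.
    by rewrite (le_trans e1)// ler_wpM2l// ltW.
  rewrite normrM (ger0_norm Ea0) ler_pM// (le_trans e2)// ler_wpM2l// ltW//.
have P2 : `|expR a * sin b - b| <= A * (k * cmod h) + 2 * k * cmod h.
  have -> : expR a * sin b - b = expR a * (sin b - b) + (expR a - 1) * b by ring.
  rewrite (le_trans (ler_normD _ _))// lerD//.
    by rewrite normrM (ger0_norm Ea0) ler_pM// (le_trans e3)// ler_wpM2l// ltW.
  have : `|expR a - 1| <= 2 * k.
    have -> : expR a - 1 = (expR a - 1 - a) + a by ring.
    rewrite (le_trans (ler_normD _ _))// (le_trans (lerD e4 (lexx _)))//.
    by have := le_trans ha (ltW h5); lra.
  by move=> H; rewrite normrM ler_pM.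
have : cmod (cexp h - 1 - h) <= k * (2 * A + 3) * cmod h.
  rewrite (le_trans (cmod_le_ReIm _))//.
  rewrite !ReImE /= -/a -/b oppr0 addr0 (le_trans (lerD P1 P2))//.
  by rewrite le_eqVlt; apply/orP; left; apply/eqP; ring.
move=> H; have -> : e * cmod h = M * (k * (2 * A + 3) * cmod h).
  by rewrite /k; field; rewrite !gt_eqF// ltr_wpDl// mulr_ge0// ltW.
by rewrite ler_wpM2l// ltW.
Qed.


(* In the coordinate [w] with [z = exp w] concentric circles become vertical
   segments, and by periodicity the horizontal sides of the rectangle cancel. *)
Lemma circle_mean_cst (f : C -> C) (r1 r2 : R) : 0 < r1 <= r2 ->
  (forall z, r1 <= cmod z <= r2 -> holo f z) ->
  \int[mu]_(t in `[0, 1]) Re (f (r1%:C%C * expi t)) =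
  \int[mu]_(t in `[0, 1]) Re (f (r2%:C%C * expi t)).
Proof.
move=> /andP[r10 r12] hf; have r20 := lt_le_trans r10 r12.
pose w (x y : R) : C := (x +i* (2 * pi * y))%C.
pose G (x y : R) := f (cexp (w x y)).
have pi2 := pi_ge2 R; have pi0 : 0 < pi :> R by lra.
(* The form [Im G dx + 2 pi Re G dy] is the imaginary part of [G dw]; the symmetry of its derivative
   is the Cauchy-Riemann relation for the complex derivative [L]. *)
have H : forall x y : R, ln r1 <= x <= ln r2 -> 0 <= y <= 1 ->
    exists k l m : R, forall e : R, 0 < e -> exists2 r : R, 0 < r &
    forall u v : R, `|u| < r -> `|v| < r ->
    `|Im (G (x + u) (y + v)) - Im (G x y) - (k * u + l * v)| <= e * (`|u| + `|v|) /\
    `|2 * pi * Re (G (x + u) (y + v)) - 2 * pi * Re (G x y) - (l * u + m * v)|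
      <= e * (`|u| + `|v|).
  move=> x y /andP[x1 x2] _.
  have : holo (fun z => f (cexp z)) (w x y).
    apply: holo_comp; last exact: holo_cexp.
    apply: hf; rewrite cmod_cexp -[r1]lnK// -[r2]lnK// !ler_expR.
    by rewrite x1.
  move=> /holoP[L HL]; exists (Im L), (2 * pi * Re L), (- (2 * pi) ^+ 2 * Im L) => e e0.
  have P0 : 0 < (2 * pi) ^+ 2 :> R by rewrite exprn_gt0// mulr_gt0.
  have P1 : 1 <= 2 * pi :> R by lra.
  have [r r0 Hr] := HL (e / (2 * pi) ^+ 2) (divr_gt0 e0 P0).
  exists (r / (2 * (2 * pi))); first by rewrite divr_gt0 // !mulr_gt0.
  move=> u v; rewrite !ltr_pdivlMr ?mulr_gt0// => ur vr.
  have hc : cmod (u +i* (2 * pi * v))%C <= 2 * pi * (`|u| + `|v|).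
    rewrite (le_trans (cmod_le_ReIm _))//= normrM (gtr0_norm (mulr_gt0 _ pi0))//.
    by rewrite [leRHS]mulrDr lerD2r ler_peMl.
  have := Hr (u +i* (2 * pi * v))%C; have -> : w x y + (u +i* (2 * pi * v))%C = w (x + u) (y + v).
    by apply: complex_eqP; rewrite ReImE /=; ring.
  rewrite -/(G _ _) -/(G x y) => Hc.
  have {}Hc : cmod (G (x + u) (y + v) - G x y - L * (u +i* (2 * pi * v))%C) <= e / (2 * pi) * (`|u| + `|v|).
    apply: le_trans (Hc _) _; first by apply: le_lt_trans hc _; lra.
    rewrite (le_trans (ler_wpM2l _ hc))//; first by rewrite ltW// divr_gt0.
    by rewrite le_eqVlt; apply/orP; left; apply/eqP; field; lra.
  have e1 : e / (2 * pi) * (`|u| + `|v|) <= e * (`|u| + `|v|).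
    rewrite ler_wpM2r ?addr_ge0//.
    by rewrite ler_pdivrMr ?mulr_gt0// ler_peMr// ltW.
  split.
    apply: le_trans (le_trans (normIm_le_cmod _) (le_trans Hc e1)).
    rewrite !ReImE /= le_eqVlt; apply/orP; left; apply/eqP; congr (`|_|); ring.
  have -> : 2 * pi * Re (G (x + u) (y + v)) - 2 * pi * Re (G x y) -
      (2 * pi * Re L * u + - (2 * pi) ^+ 2 * Im L * v) =
      2 * pi * Re (G (x + u) (y + v) - G x y - L * (u +i* (2 * pi * v))%C).
    by rewrite !ReImE /=; ring.
  rewrite normrM gtr0_norm ?mulr_gt0// (le_trans (ler_wpM2l _ (le_trans (normRe_le_cmod _) Hc)))//.
    by rewrite mulr_ge0// ltW.
  by rewrite le_eqVlt; apply/orP; left; apply/eqP; field; lra.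
have ln12 : ln r1 <= ln r2 by rewrite ler_ln.
have := goursat_rectangle ln12 ler01 H.
have wE x y : cexp (w x y) = (expR x)%:C%C * expi y.
  by apply: complex_eqP; rewrite ReImE /=; ring.
have -> : \int[mu]_(t in `[ln r1, ln r2]) (Im (G t 0) - Im (G t 1)) = 0.
  rewrite (@eq_itv_int _ _ _ _ (fun=> 0)); first by rewrite Rintegral_itv_cst ?mul0r.
  by move=> t _; rewrite /G !wE expi0 expi1 subrr.
rewrite add0r => E0.
have hG (x : R) : ln r1 <= x <= ln r2 -> bdmeas `[0 : R, 1] (fun t => Re (G x t)).
  move=> xab; apply: continuous_bdmeas => y y01.
  have [k [l [m /(_ 1 ltr01)[r r0 Hr]]]] := H x y xab y01.
  apply: continuous_epsdelta => e e0.
  exists (Num.min r (e / (1 + `|m|))).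
    by rewrite lt_min r0 divr_gt0// ltr_pwDl.
  move=> t; rewrite lt_min => /andP[tr te].
  have [] := Hr 0 (t - y); [by rewrite normr0|exact: tr|move=> _].
  rewrite addr0 (addrC y) subrK normr0 mulr0 !add0r mul1r => Ht.
  have : `|2 * pi * (Re (G x t) - Re (G x y))| < e.
    have -> : 2 * pi * (Re (G x t) - Re (G x y)) =
      (2 * pi * Re (G x t) - 2 * pi * Re (G x y) - m * (t - y)) + m * (t - y) by ring.
    rewrite (le_lt_trans (ler_normD _ _))// normrM.
    rewrite (le_lt_trans (lerD Ht (lexx _)))// -[X in X + _]mul1r -mulrDl mulrC.
    by rewrite -ltr_pdivlMr// ltr_pwDl.
  apply: le_lt_trans; rewrite normrM (gtr0_norm (mulr_gt0 _ pi0))// ler_peMl//; lra.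
have : \int[mu]_(t in `[0, 1]) (2 * pi * (Re (G (ln r2) t) - Re (G (ln r1) t))) = 0.
  by rewrite -[RHS]E0; apply: eq_itv_int => t _; rewrite mulrBr.
rewrite itv_intZ; last by apply: bdmeasB; apply: hG; rewrite lexx ?ln12.
move/eqP; rewrite mulf_eq0 gt_eqF ?mulr_gt0//= itv_intB; [|by apply: hG; rewrite lexx ?ln12..].
rewrite subr_eq0 => /eqP E1.
transitivity (\int[mu]_(t in `[0, 1]) (Re (G (ln r1) t))).
  by apply: eq_itv_int => t _; rewrite /G wE lnK.
by rewrite -E1; apply: eq_itv_int => t _; rewrite /G wE lnK.
Qed.

Lemma expi_epsdelta (y e : R) : 0 < e -> exists2 d : R, 0 < d &
  forall t, `|t - y| < d -> cmod (expi t - expi y) < e.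
Proof.
move=> e0.
have [k k0 Hk] := holo_continuous (@holo_cexp (0 +i* (2 * pi * y))%C) e0.
have pi2 := pi_ge2 R; have pi0 : 0 < pi :> R by lra.
exists (k / (2 * pi)); first by rewrite divr_gt0// mulr_gt0.
move=> t; rewrite ltr_pdivlMr ?mulr_gt0// => tk.
have := Hk (0 +i* (2 * pi * t))%C; rewrite -!expiE; apply.
have -> : ((0 +i* (2 * pi * t)) - (0 +i* (2 * pi * y)))%C = (0 +i* ((t - y) * (2 * pi)))%C :> C.
  by apply: complex_eqP; rewrite ReImE /=; ring.
by rewrite /= expr0n /= add0r sqrtr_sqr normrM (gtr0_norm (mulr_gt0 _ pi0)).
Qed.

Lemma continuous_ReIm_expi (r : R) (f : C -> C) (y : R) : holo f (r%:C%C * expi y) ->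
  {for y, continuous (fun t => Re (f (r%:C%C * expi t)))} /\
  {for y, continuous (fun t => Im (f (r%:C%C * expi t)))}.
Proof.
move=> /holo_continuous hf.
suff H : forall e : R, 0 < e -> exists2 d : R, 0 < d & forall t : R, `|t - y| < d ->
    cmod (f (r%:C%C * expi t) - f (r%:C%C * expi y)) < e.
  split; apply: continuous_epsdelta => e /H[d d0 Hd]; exists d => // t /Hd; apply: le_lt_trans.
    by have := normRe_le_cmod (f (r%:C%C * expi t) - f (r%:C%C * expi y)); rewrite !ReImE.
  by have := normIm_le_cmod (f (r%:C%C * expi t) - f (r%:C%C * expi y)); rewrite !ReImE.
move=> e /hf[d d0 Hd].
have K0 : 0 < `|r| + 1 by rewrite ltr_wpDl.
have [k k0 Hk] := expi_epsdelta y (divr_gt0 d0 K0).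
exists k => // t /Hk Ht; apply: Hd.
rewrite -mulrBr cmodM cmodr.
rewrite (@le_lt_trans _ _ ((`|r| + 1) * cmod (expi t - expi y)))//.
  by rewrite ler_wpM2r ?cmod_ge0// lerDl.
by rewrite mulrC -ltr_pdivlMr.
Qed.

Lemma bdmeas_Re_circle (r : R) (f : C -> C) :
  (forall z, cmod z = `|r| -> holo f z) ->
  bdmeas `[0 : R, 1] (fun t => Re (f (r%:C%C * expi t))).
Proof.
move=> hf; apply: continuous_bdmeas => x _.
have hx : holo f (r%:C%C * expi x) by apply: hf; rewrite cmodM cmod_expi cmodr mulr1.
by have [] := continuous_ReIm_expi hx.
Qed.

Lemma bdmeas_Im_circle (r : R) (f : C -> C) :
  (forall z, cmod z = `|r| -> holo f z) ->
  bdmeas `[0 : R, 1] (fun t => Im (f (r%:C%C * expi t))).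
Proof.
move=> hf; apply: continuous_bdmeas => x _.
have hx : holo f (r%:C%C * expi x) by apply: hf; rewrite cmodM cmod_expi cmodr mulr1.
by have [] := continuous_ReIm_expi hx.
Qed.

(** The mean does not depend on the positive radius, and by continuity at [0] it approaches
    [Re (f 0)] on small circles. *)
Lemma circle_mean_center (f : C -> C) (r : R) : 0 <= r ->
  (forall z, cmod z <= r -> holo f z) ->
  \int[mu]_(t in `[0, 1]) Re (f (r%:C%C * expi t)) = Re (f 0).
Proof.
rewrite le_eqVlt => /predU1P[<- _|r0 hf].
  rewrite (@eq_itv_int _ _ _ _ (fun=> Re (f 0))); last by move=> t _; rewrite mul0r.
  by rewrite Rintegral_itv_cst// subr0 mulr1.
apply/eqP; rewrite -subr_eq0 -normr_le0; apply/ler_addgt0Pr => e e0; rewrite add0r.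
have f0 : holo f 0 by apply: hf; rewrite Normc.normc0 ltW.
have [d d0 Hd] := holo_continuous f0 e0.
pose s := Num.min r (d / 2).
have s0 : 0 < s by rewrite lt_min r0 divr_gt0.
have sr : s <= r by rewrite ge_min lexx.
have sd : s < d by rewrite (@le_lt_trans _ _ (d / 2))// ?ge_min ?lexx ?orbT//; lra.
rewrite -(@circle_mean_cst _ s r); [|by rewrite s0|by move=> z /andP[_ /hf]].
have hs : bdmeas `[0 : R, 1] (fun t => Re (f (s%:C%C * expi t))).
  by apply: bdmeas_Re_circle => z zs; apply: hf; rewrite zs ger0_norm// ltW.
rewrite -[X in _ - X]mulr1 -{2}(subr0 1) -Rintegral_itv_cst// -itv_intB//; last exact: bdmeas_cst.
rewrite -[e]mulr1 -{2}(subr0 1); apply: le_norm_Rintegral_itv => //.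
  by apply: bdmeasB => //; exact: bdmeas_cst.
move=> t _; have := Hd (s%:C%C * expi t).
rewrite subr0 cmodM cmod_expi cmodr mulr1 gtr0_norm// => /(_ sd)/ltW; apply: le_trans.
by have := normRe_le_cmod (f (s%:C%C * expi t) - f 0); rewrite !ReImE.
Qed.

End complex_exponential.

(** * The Poisson kernel *)

Section poisson_kernel.
Context {R : realType}.
Local Notation C := R[i].
Local Notation Re := complex.Re.
Local Notation Im := complex.Im.
Local Notation mu := (@lebesgue_measure R).
Implicit Types (z a : C) (t : R).

(** The Poisson kernel of the disc, with the boundary point given in turns. *)
Definition pkernel z t : R := (1 - cmod z ^+ 2) / cmod (expi t - z) ^+ 2.

Lemma expi_sub_gt0 z t : cmod z < 1 -> 0 < cmod (expi t - z).
Proof.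
move=> z1; rewrite (lt_le_trans _ (cmod_sub_ge _ _))// subr_gt0.
by rewrite cmod_expi.
Qed.

Lemma pkernel_ge0 z t : cmod z < 1 -> 0 <= pkernel z t.
Proof.
by move=> z1; rewrite divr_ge0 ?sqr_ge0// subr_ge0 expr_le1 ?cmod_ge0// ltW.
Qed.

Lemma cmod_sqr_conj z : (cmod z ^+ 2)%:C%C = z * (z^*)%C.
Proof.
by case: z => x y; apply: complex_eqP; rewrite cmod_sqr ReImE /=; ring.
Qed.

Lemma cmod_conj z : cmod (z^*)%C = cmod z.
Proof. by rewrite !cmodE; case: z => x y /=; rewrite sqrrN. Qed.

Lemma ReE_div z w : Re (z / w) = (Re z * Re w + Im z * Im w) / cmod w ^+ 2.
Proof. by rewrite ReImE ReV ImV mulrA mulNr mulrN opprK mulrA -mulrDl. Qed.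

Lemma pkernelE z t : pkernel z t = Re ((expi t + z) / (expi t - z)).
Proof.
rewrite ReE_div /pkernel; congr (_ / _).
rewrite -(expr1n R 2) -(cmod_expi t) !cmod_sqr !ReImE; ring.
Qed.

Lemma conj_expiB z t : ((expi t - z)^*)%C = (expi t)^-1 - (z^*)%C.
Proof.
rewrite rmorphB; congr (_ - _); apply: (mulfI (expi_neq0 t)).
by rewrite divff ?expi_neq0// -cmod_sqr_conj cmod_expi expr1n.
Qed.

(** The kernel is the Cauchy kernel plus a function of [expi t] that extends analytically to the
    disc and vanishes at [0]. Integrated against an analytic function, the second part therefore
    disappears. *)
Lemma pkernel_cauchy z t : cmod z < 1 ->
  (pkernel z t)%:C%C = expi t / (expi t - z) + (z^*)%C * expi t / (1 - (z^*)%C * expi t).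
Proof.
move=> z1; have e0 := expi_neq0 t.
have ez : expi t - z != 0 by rewrite -cmod_gt0 expi_sub_gt0.
have ez' : 1 - (z^*)%C * expi t != 0.
  rewrite -cmod_gt0 (lt_le_trans _ (cmod_sub_ge _ _))// subr_gt0.
  by rewrite cmodM cmod_expi cmod_conj mulr1 Normc.normc1.
have ezc := conj_expiB z t.
have ezc0 : (expi t)^-1 - (z^*)%C != 0 by rewrite -ezc conjc_eq0.
rewrite /pkernel rmorphM /= fmorphV /= rmorphB /= rmorph1 !cmod_sqr_conj ezc.
have -> : (expi t)^-1 - (z^*)%C = (1 - (z^*)%C * expi t) / expi t by field.
by field; rewrite ez ez' e0.
Qed.

Lemma holo_mobius (b c d e z : C) : c * z + d != 0 ->
  holo (fun w => (b * w + e) / (c * w + d)) z.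
Proof.
move=> h; apply: holoM.
  by apply: holoD; [apply: holoM; [exact: holo_cst|exact: holo_id]|exact: holo_cst].
apply: (holoV (f := fun w => c * w + d)) => //.
by apply: holoD; [apply: holoM; [exact: holo_cst|exact: holo_id]|exact: holo_cst].
Qed.

Lemma bdmeas_pkernel z : cmod z < 1 -> bdmeas `[0 : R, 1] (pkernel z).
Proof.
move=> z1.
have : bdmeas `[0 : R, 1] (fun t => Re ((1 * (1%:C%C * expi t) + z) / (1 * (1%:C%C * expi t) - z))).
  apply: (@bdmeas_Re_circle _ 1 (fun w => (1 * w + z) / (1 * w - z))) => w; rewrite normr1 => w1; apply: holo_mobius.
  rewrite mul1r -cmod_gt0 (lt_le_trans _ (cmod_sub_ge _ _))// subr_gt0.
  by rewrite w1.
by apply: eq_bdmeas => t _; rewrite pkernelE !mul1r.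
Qed.

(** On the circle the kernel is the real part of a function [g] analytic on the closed disc with
    [g 0 = 1]. *)
Lemma int_pkernel z : cmod z < 1 -> \int[mu]_(t in `[0, 1]) pkernel z t = 1.
Proof.
move=> z1.
have h w : cmod w <= 1 -> - (z^*)%C * w + 1 != 0.
  move=> w1; rewrite mulNr addrC -cmod_gt0 (lt_le_trans _ (cmod_sub_ge _ _))// subr_gt0.
  rewrite Normc.normc1 cmodM cmod_conj (le_lt_trans _ z1)//.
  by rewrite ler_piMr// cmod_ge0.
pose g w := ((z^*)%C * w + 1) / (- (z^*)%C * w + 1).
transitivity (Re (g 0)); last by rewrite /g !mulr0 !add0r divff ?oner_neq0.
rewrite -[RHS](@circle_mean_center _ g 1 ler01); last by move=> w /h; exact: holo_mobius.
rewrite /g.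
apply: eq_itv_int => t _; rewrite mul1r ReE_div /pkernel.
have -> : - (z^*)%C * expi t + 1 = expi t * ((expi t - z)^*)%C.
  by rewrite conj_expiB; field; exact: expi_neq0.
rewrite cmodM cmod_expi mul1r cmod_conj; congr (_ / _).
have -> : cmod z ^+ 2 = cmod ((z^*)%C * expi t) ^+ 2.
  by rewrite cmodM cmod_expi mulr1 cmod_conj.
have -> : expi t * ((expi t - z)^*)%C = 1 - (z^*)%C * expi t.
  by rewrite conj_expiB; field; exact: expi_neq0.
rewrite cmod_sqr; set w := (z^*)%C * expi t; rewrite !ReImE /=; ring.
Qed.

(** Since [1 - r] is at most the distance of [expi t] to [r * e0], that distance is at least half
    the distance to [e0], hence at least [d / 2]. The constant [8] is [4] from this halving times
    [2] from [1 - r ^+ 2 <= 2 * (1 - r)]. *)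
Lemma pkernel_le (e0 : C) (r d : R) t : cmod e0 = 1 -> 0 <= r < 1 -> 0 < d ->
  d <= cmod (expi t - e0) -> pkernel (r%:C%C * e0) t <= 8 * (1 - r) / d ^+ 2.
Proof.
move=> e01 /andP[r0 r1] d0 dt.
have z1 : cmod (r%:C%C * e0) < 1 by rewrite cmodM cmodr e01 mulr1 ger0_norm.
have c0 := expi_sub_gt0 t z1.
have H1 : 1 - r <= cmod (expi t - r%:C%C * e0).
  apply: le_trans (cmod_sub_ge _ _).
  by rewrite cmod_expi cmodM cmodr e01 mulr1 ger0_norm.
have H2 : cmod (expi t - e0) <= 2 * cmod (expi t - r%:C%C * e0).
  have -> : expi t - e0 = (expi t - r%:C%C * e0) - (1 - r)%:C%C * e0.
    by rewrite rmorphB rmorph1; ring.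
  rewrite (le_trans (cmodD _ _))// cmodN cmodM cmodr e01 mulr1 ger0_norm ?subr_ge0 ?(ltW r1)//.
  by lra.
have H3 : d / 2 <= cmod (expi t - r%:C%C * e0) by lra.
rewrite /pkernel ler_pdivrMr ?exprn_gt0//.
rewrite cmodM cmodr e01 mulr1 ger0_norm//.
have -> : 8 * (1 - r) / d ^+ 2 * cmod (expi t - r%:C%C * e0) ^+ 2 =
  (1 - r) * (2 * (cmod (expi t - r%:C%C * e0) / (d / 2)) ^+ 2).
  by field; rewrite gt_eqF.
have -> : 1 - r ^+ 2 = (1 - r) * (1 + r) by ring.
rewrite ler_wpM2l ?subr_ge0 ?(ltW r1)// (@le_trans _ _ 2)//; first by lra.
by rewrite ler_peMr// exprn_ege1// ler_pdivlMr ?mul1r// divr_gt0.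
Qed.

(** The kernel is an approximate identity: its total mass [1] meets the oscillation [e] near [e0],
    and its smallness away from [e0] meets the global bound [B]. *)
Lemma poisson_concentration (u : R -> R) (c B e d r : R) (e0 : C) :
  bdmeas `[0 : R, 1] u -> cmod e0 = 1 -> 0 <= r < 1 -> 0 < d -> 0 <= e -> 0 <= B ->
  (forall t, 0 <= t <= 1 -> `|u t - c| <= B) ->
  (forall t, 0 <= t <= 1 -> cmod (expi t - e0) < d -> `|u t - c| <= e) ->
  `|\int[mu]_(t in `[0, 1]) (u t * pkernel (r%:C%C * e0) t) - c|
    <= e + B * (8 * (1 - r) / d ^+ 2).
Proof.
move=> hu e01 r01 d0 ege0 B0 uB ue; have /andP[r0 r1] := r01.
set z := r%:C%C * e0.
have z1 : cmod z < 1 by rewrite cmodM cmodr e01 mulr1 ger0_norm.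
have hp := bdmeas_pkernel z1.
have huc : bdmeas `[0 : R, 1] (fun t => u t - c) by apply: bdmeasB => //; exact: bdmeas_cst.
have -> : \int[mu]_(t in `[0, 1]) (u t * pkernel z t) - c =
    \int[mu]_(t in `[0, 1]) ((u t - c) * pkernel z t).
  have cE : c = \int[mu]_(t in `[0, 1]) (c * pkernel z t).
    by rewrite itv_intZ// int_pkernel// mulr1.
  rewrite {1}cE -itv_intB.
  - by apply: eq_itv_int => t _; rewrite mulrBl.
  - exact: bdmeasM.
  - by apply: bdmeasM => //; exact: bdmeas_cst.
apply: le_trans (le_normr_Rintegral _ _) _ => //; first exact: (itv_integrable (bdmeasM huc hp)).
set K := 8 * (1 - r) / d ^+ 2.
have K0 : 0 <= K by rewrite divr_ge0 ?sqr_ge0// mulr_ge0// subr_ge0 ltW.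
(* One majorant valid on both ranges of [t] avoids splitting the interval. *)
apply: (@le_trans _ _ (\int[mu]_(t in `[0, 1]) (e * pkernel z t + B * K))).
  apply: le_itv_int.
  - exact: (bdmeas_norm (bdmeasM huc hp)).
  - apply: bdmeasD; last exact: bdmeas_cst.
    by apply: bdmeasM => //; exact: bdmeas_cst.
  move=> t t01; have p0 := pkernel_ge0 t z1.
  rewrite normrM (ger0_norm p0).
  have [td|dt] := ltP (cmod (expi t - e0)) d.
    by rewrite (le_trans (ler_wpM2r p0 (ue _ t01 td)))// lerDl mulr_ge0.
  rewrite (@le_trans _ _ (B * K))//; last by rewrite lerDr mulr_ge0.
  by apply: ler_pM => //; [exact: uB|exact: pkernel_le].
rewrite itv_intD; [|by apply: bdmeasM => //; exact: bdmeas_cst|exact: bdmeas_cst].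
by rewrite itv_intZ// int_pkernel// mulr1 Rintegral_itv_cst// subr0 mulr1.
Qed.

Lemma int_pkernel0 (u : R -> R) :
  \int[mu]_(t in `[0, 1]) (u t * pkernel 0 t) = \int[mu]_(t in `[0, 1]) u t.
Proof.
apply: eq_itv_int => t _.
by rewrite /pkernel Normc.normc0 subr0 cmod_expi expr0n subr0 expr1n divr1 mulr1.
Qed.

(* For fixed [a] the integral over the circle of radius [s] is independent of
   [s > |a|], and the circle is then shrunk onto [|z| = |a|]. *)
Lemma poisson_formula_circle (f : C -> C) (B : R) (a : C) (s : R) :
  (forall z, cmod z < 1 -> holo f z) -> (forall z, cmod z < 1 -> cmod (f z) <= B) ->
  cmod a < s < 1 ->
  \int[mu]_(t in `[0, 1]) (Re (f (s%:C%C * expi t)) * pkernel (a / s%:C%C) t) = Re (f a).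
Proof.
move=> hf fB /andP[as1 s1].
have s_gt0 (x : R) : cmod a < x -> 0 < x by apply: le_lt_trans; exact: cmod_ge0.
have [a0|a0] := eqVneq a 0.
  rewrite a0 mul0r int_pkernel0; apply: (@circle_mean_center _ f s); first exact/ltW/s_gt0.
  by move=> z zs; apply: hf; exact: le_lt_trans s1.
have am0 : 0 < cmod a by rewrite cmod_gt0.
pose h z := f z * (z / (z - a)).
pose A := \int[mu]_(t in `[0, 1]) Re (h (s%:C%C * expi t)).
have key (x : R) : cmod a < x -> x < 1 ->
    \int[mu]_(t in `[0, 1]) (Re (f (x%:C%C * expi t)) * pkernel (a / x%:C%C) t) = A.
  move=> ax x1; have x0 := s_gt0 _ ax.
  have xC0 : x%:C%C != 0 :> C by rewrite -cmod_gt0 cmodr gtr0_norm.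
  have z1 : cmod (a / x%:C%C) < 1.
    by rewrite cmodM cmodV cmodr gtr0_norm// ltr_pdivrMr// mul1r.
  (* The second part of [pkernel_cauchy] for [a / x], written on the circle of radius [x]; it is
     analytic inside and vanishes at [0], so its mean is [0]. *)
  pose g (z : C) := f z * ((a^*)%C * z / ((x ^+ 2)%:C%C - (a^*)%C * z)).
  have D2 z : cmod z <= x -> - (a^*)%C * z + (x ^+ 2)%:C%C != 0.
    move=> zx; rewrite mulNr addrC -cmod_gt0 (lt_le_trans _ (cmod_sub_ge _ _))// subr_gt0.
    rewrite cmodr cmodM cmod_conj ger0_norm ?sqr_ge0//.
    by rewrite (@le_lt_trans _ _ (cmod a * x))// ?ler_wpM2l ?cmod_ge0// expr2 ltr_pM2r.
  have hg z : cmod z <= x -> holo g z.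
    move=> zx; apply: holoM; first by apply: hf; exact: le_lt_trans x1.
    have := @holo_mobius (a^*)%C (- (a^*)%C) (x ^+ 2)%:C%C 0 z (D2 _ zx).
    by apply: (@holo_eq _ _ _ _ 1) => // w _; rewrite addr0 mulNr (addrC (- _)).
  have hh z : cmod a < cmod z -> cmod z < 1 -> holo h z.
    move=> az z1'; apply: holoM; first exact: hf.
    have D : 1 * z + (- a) != 0.
      by rewrite mul1r -cmod_gt0 (lt_le_trans _ (cmod_sub_ge _ _))// subr_gt0.
    have := @holo_mobius 1 1 (- a) 0 z D.
    by apply: (@holo_eq _ _ _ _ 1) => // w _; rewrite !mul1r addr0.
  have -> : A = \int[mu]_(t in `[0, 1]) Re (h (x%:C%C * expi t)).
    have [sx|/ltW xs] := leP s x; [|symmetry]; apply: (@circle_mean_cst _ h); rewrite ?x0 ?s_gt0//.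
      by move=> z /andP[z2 z3]; apply: hh; [exact: lt_le_trans z2|exact: le_lt_trans x1].
    by move=> z /andP[z2 z3]; apply: hh; [exact: lt_le_trans z2|exact: le_lt_trans s1].
  have G0 : \int[mu]_(t in `[0, 1]) Re (g (x%:C%C * expi t)) = 0.
    rewrite (@circle_mean_center _ g)//; last exact: ltW.
    by rewrite /g !mulr0 mul0r mulr0.
  transitivity (\int[mu]_(t in `[0, 1]) Re (h (x%:C%C * expi t)) +
    \int[mu]_(t in `[0, 1]) Re (g (x%:C%C * expi t))); last by rewrite G0 addr0.
  rewrite -itv_intD.
  - apply: eq_itv_int => t _.
    have -> : Re (f (x%:C%C * expi t)) * pkernel (a / x%:C%C) t =
        Re (f (x%:C%C * expi t) * (pkernel (a / x%:C%C) t)%:C%C).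
      by rewrite ReImE /= mulr0 subr0.
    rewrite pkernel_cauchy// -ReD /g /h -mulrDr; congr (Re (_ * _)).
    have xe0 := expi_neq0 t.
    have xconj : ((x%:C%C)^*)%C = x%:C%C :> C by exact: conjc_real.
    have e1 : x%:C%C * expi t - a != 0.
      have := expi_sub_gt0 t z1; rewrite cmod_gt0; apply: contra => /eqP H.
      have -> : a = x%:C%C * expi t by apply/eqP; rewrite eq_sym -subr_eq0 H.
      by rewrite mulrC mulKf// subrr.
    have e2 : (x ^+ 2)%:C%C - (a^*)%C * (x%:C%C * expi t) != 0.
      have := D2 (x%:C%C * expi t); rewrite cmodM cmod_expi cmodr mulr1 gtr0_norm// lexx.
      by move=> /(_ isT); rewrite mulNr addrC.
    have -> : ((a / x%:C%C)^*)%C = (a^*)%C / x%:C%C.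
      transitivity ((a^*)%C * ((x%:C%C^-1)^*)%C); first exact: rmorphM.
      by rewrite conjc_inv xconj.
    have e3 : expi t - a / x%:C%C = (x%:C%C * expi t - a) / x%:C%C by field.
    have e4 : 1 - (a^*)%C / x%:C%C * expi t = ((x ^+ 2)%:C%C - (a^*)%C * (x%:C%C * expi t)) / (x%:C%C ^+ 2).
      by rewrite rmorphXn /=; field.
    rewrite e3 e4; field.
    apply/and3P; split; [|exact: e1|exact: xC0].
    by move: e2; rewrite rmorphXn.
  - by apply: (@bdmeas_Re_circle _ x h) => z; rewrite gtr0_norm// => zx; apply: hh; rewrite zx.
  - by apply: (@bdmeas_Re_circle _ x g) => z; rewrite gtr0_norm// => zx; apply: hg; rewrite zx.
rewrite key//; apply/eqP; rewrite -subr_eq0 -normr_le0; apply/ler_addgt0Pr => e e_gt0.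
rewrite add0r.
have B0 : 0 <= B by apply: le_trans (fB 0 _); rewrite ?cmod_ge0// Normc.normc0.
have e2 : 0 < e / 2 by rewrite divr_gt0.
have a1 : cmod a < 1 := lt_trans as1 s1.
have [d d0 Hd] := holo_continuous (hf _ a1) e2.
(* With [r = cmod a / x] the factor [1 - r] is at most [(x - cmod a) / cmod a]. Hence
   [k * (x - cmod a)] bounds the error term of [poisson_concentration], where [2 * B] bounds the
   oscillation of [Re f]. *)
pose k := 2 * B * (8 / (cmod a * (d / 2) ^+ 2)).
have k0 : 0 <= k.
  rewrite /k; apply: mulr_ge0; first exact: mulr_ge0.
  by apply: divr_ge0 => //; apply: mulr_ge0; [exact: cmod_ge0|exact: sqr_ge0].
pose x := Num.min ((cmod a + s) / 2) (cmod a + Num.min (d / 2) (e / 2 / (k + 1))).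
have k10 : 0 < k + 1 by rewrite ltr_wpDl.
have ax : cmod a < x.
  rewrite lt_min ltrDl lt_min !divr_gt0 ?andbT//.
  by rewrite ltr_pdivlMr//; lra.
have xs : x < s by rewrite gt_min ltr_pdivrMr//; apply/orP; left; lra.
have x0 := s_gt0 _ ax.
have xd : x - cmod a <= d / 2.
  by rewrite lerBlDl ge_min lerD2l ge_min lexx orbT.
have xe : x - cmod a <= e / 2 / (k + 1).
  by rewrite lerBlDl ge_min lerD2l ge_min lexx !orbT.
have x1 := lt_trans xs s1.
rewrite -(key x)//.
pose e0 := a / (cmod a)%:C%C.
have amC : (cmod a)%:C%C != 0 :> C by rewrite -cmod_gt0 cmodr gtr0_norm.
have e01 : cmod e0 = 1 by rewrite cmodM cmodV cmodr gtr0_norm// divff// gt_eqF.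
have aE : a = (cmod a)%:C%C * e0 by rewrite /e0; field.
have -> : a / x%:C%C = (cmod a / x)%:C%C * e0.
  by rewrite {1}aE rmorphM /= fmorphV /=; ring.
have d2 : 0 < d / 2 by rewrite divr_gt0.
have rx : 0 <= cmod a / x < 1.
  by rewrite divr_ge0 ?cmod_ge0 ?(ltW x0)//= ltr_pdivrMr// mul1r.
have hfx : bdmeas `[0 : R, 1] (fun t => Re (f (x%:C%C * expi t))).
  by apply: (@bdmeas_Re_circle _ x f) => z; rewrite gtr0_norm// => zx; apply: hf; rewrite zx.
have cx t : cmod (x%:C%C * expi t) < 1 by rewrite cmodM cmod_expi cmodr gtr0_norm// mulr1.
apply: le_trans (@poisson_concentration _ _ (2 * B) (e / 2) (d / 2) _ _ hfx e01 rx d2 (ltW e2) _ _ _) _.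
- by rewrite mulr_ge0.
- move=> t _; rewrite (le_trans (ler_normB _ _))// mulr_natl mulr2n lerD//;
    by rewrite (le_trans (normRe_le_cmod _))// fB.
- move=> t _ td; have : cmod (x%:C%C * expi t - a) < d.
    have -> : x%:C%C * expi t - a = (x - cmod a)%:C%C * expi t + (cmod a)%:C%C * (expi t - e0).
      by rewrite [X in _ - X = _]aE rmorphB /=; ring.
    rewrite (le_lt_trans (cmodD _ _))// !cmodM cmod_expi mulr1 !cmodr.
    rewrite gtr0_norm ?subr_gt0// (gtr0_norm am0).
    have : cmod a * cmod (expi t - e0) <= cmod (expi t - e0) by rewrite ler_piMl ?cmod_ge0 ?ltW.
    lra.
  move=> /Hd/ltW; apply: le_trans; rewrite -ReN -ReD; exact: normRe_le_cmod.
have : 2 * B * (8 * (1 - cmod a / x) / (d / 2) ^+ 2) <= k * (x - cmod a).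
  have -> : 1 - cmod a / x = (x - cmod a) / x by field; rewrite gt_eqF.
  have -> : 2 * B * (8 * ((x - cmod a) / x) / (d / 2) ^+ 2) =
     2 * B * (8 / (x * (d / 2) ^+ 2)) * (x - cmod a) by field; rewrite !gt_eqF.
  rewrite ler_wpM2r ?subr_ge0 ?(ltW ax)// ler_wpM2l ?mulr_ge0// ler_wpM2l//.
  by rewrite lef_pV2 ?posrE ?mulr_gt0 ?exprn_gt0// ler_wpM2r ?sqr_ge0// ltW.
have : k * (x - cmod a) <= e / 2.
  rewrite (le_trans (ler_wpM2l k0 xe))// mulrCA ler_piMr ?(ltW e2)//.
  by rewrite ler_pdivrMr// mul1r lerDl.
lra.
Qed.

End poisson_kernel.

(** * Radial limits of Poisson integrals at Lebesgue points *)

Section radial_limits_of_poisson_integrals.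
Context {R : realType}.
Local Notation C := R[i].
Local Notation Re := complex.Re.
Local Notation Im := complex.Im.
Local Notation mu := (@lebesgue_measure R).

Lemma expiD (s t : R) : expi (s + t) = expi s * expi t.
Proof.
rewrite !expiE -cexpD; congr cexp.
by apply: complex_eqP; rewrite ReImE /=; ring.
Qed.

Lemma cmod_expi_sub (s t : R) : cmod (expi t - expi s) = cmod (expi (t - s) - 1).
Proof.
have -> : expi t = expi s * expi (t - s) by rewrite -expiD addrC subrK.
by rewrite -{2}(mulr1 (expi s)) -mulrBr cmodM cmod_expi mul1r.
Qed.

(** The imaginary part is [sin (2 * pi * s)], which for small [s] is at least half of [2 * pi * s]
    in absolute value. *)
Lemma expi_sub1_ge : exists2 d : R, 0 < d &
  forall s, `|s| < d -> `|s| <= cmod (expi s - 1).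
Proof.
have [d d0 H] := is_derive_epsdelta (is_derive_sin (0 : R)) (divr_gt0 ltr01 (ltr0n R 2)).
have pi2 := pi_ge2 R; have pi0 : 0 < pi :> R by lra.
exists (d / (2 * pi)); first by rewrite divr_gt0// mulr_gt0.
move=> s; rewrite ltr_pdivlMr ?mulr_gt0// => sd.
have nE : `|2 * pi * s| = `|s| * (2 * pi) by rewrite normrM (gtr0_norm (mulr_gt0 _ pi0))// mulrC.
have := H (2 * pi * s); rewrite nE => /(_ sd).
rewrite sin0 cos0 add0r subr0 !mul1r => H1.
have := normIm_le_cmod (expi s - 1); rewrite ImD ImN /= subr0; apply: le_trans.
have H2 := cmod_ge0 (0 : C).
have : `|2 * pi * s| <= `|sin (2 * pi * s)| + `|sin (2 * pi * s) - 2 * pi * s|.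
  by rewrite distrC (le_trans _ (ler_normD _ _))// addrC subrK.
have s0 := normr_ge0 s; rewrite nE.
have : `|s| * 4 <= `|s| * (2 * pi) by rewrite ler_wpM2l//; lra.
lra.
Qed.

Lemma expi_neq1 (s : R) : 0 < s < 1 -> 0 < cmod (expi s - 1).
Proof.
move=> /andP[s0 s1]; rewrite cmod_gt0 subr_eq0; apply/negP => /eqP H.
have pi0 := pi_gt0 R.
have : cos (2 * pi * s) = 1 by rewrite -[LHS]/(Re (expi s)) H.
have -> : 2 * pi * s = (pi * s) *+ 2 by rewrite mulr2n; ring.
rewrite mulr2n cosD -!expr2 => /eqP; have := cos2Dsin2 (pi * s) => Hcs.
have := @sin_gt0_pi _ (pi * s); rewrite mulr_gt0// gtr_pMr// s1 => /(_ isT) sp.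
by move=> /eqP Hc; have := exprn_gt0 2 sp; lra.
Qed.

(** The distance attains its minimum on each of the two compact intervals left over, and [expi]
    takes its value at [x] nowhere on them. *)
Lemma expi_sub_ge_away (x d : R) : 0 < d -> d <= x -> x + d <= 1 ->
  exists2 c : R, 0 < c & forall t, 0 <= t <= 1 -> d <= `|t - x| -> c <= cmod (expi t - expi x).
Proof.
move=> d0 dx xd.
have cc (a b : R) : {within `[a, b], continuous (fun t => cmod (expi t - expi x))}.
  apply: continuous_in_subspaceT => y _; apply: continuous_epsdelta => e e0.
  have [d1 d10 H1] := expi_epsdelta y e0.
  exists d1 => // t /H1; apply: le_lt_trans.
  rewrite ler_norml; apply/andP; split.
    rewrite lerNl opprB (le_trans (cmod_sub_ge _ _))//.
    by rewrite cmodB opprB addrA subrK.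
  by rewrite (le_trans (cmod_sub_ge _ _))// opprB addrA subrK.
have x0 : 0 < x by lra. have x1 : x < 1 by lra.
have [a1 ha1 H1] := EVT_min (a := 0) (b := x - d) ltac:(lra) (cc _ _).
have [a2 ha2 H2] := EVT_min (a := x + d) (b := 1) ltac:(lra) (cc _ _).
have p1 : 0 < cmod (expi a1 - expi x).
  rewrite cmodB cmod_expi_sub expi_neq1//; move: ha1; rewrite in_itv /=; lra.
have p2 : 0 < cmod (expi a2 - expi x).
  rewrite cmod_expi_sub expi_neq1//; move: ha2; rewrite in_itv /=; lra.
exists (Num.min (cmod (expi a1 - expi x)) (cmod (expi a2 - expi x))).
  by rewrite lt_min p1.
move=> t t01; have [tx|xt] := leP t x.
  rewrite ler0_norm ?subr_le0// => dt; rewrite ge_min H1// in_itv /=; lra.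
rewrite ger0_norm ?subr_ge0 ?(ltW xt)// => dt; rewrite ge_min H2 ?orbT// in_itv /=; lra.
Qed.

Lemma lebesgue_pt_average (u : R -> R) (x e : R) : bdmeas [set: R] u ->
  lebesgue_pt u x -> 0 < e -> exists2 d : R, 0 < d & forall h, 0 < h < d ->
    \int[mu]_(t in `[x - h, x + h]) `|u t - u x| <= h * e.
Proof.
move=> hu; rewrite /lebesgue_pt => H e0.
have e4 : 0 < e / 4 by rewrite divr_gt0.
move/fine_cvgP : H => [F1 /cvgrPdist_lt/(_ _ e4) F2].
have /nbhs_ballP[d /= d0 Hd] : \forall r \near (0 : R)^'+,
    davg u x r \is a fin_num /\ `|0 - fine (davg u x r)| < e / 4.
  by near=> r; split; near: r.
exists (d / 2); first by rewrite divr_gt0.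
move=> h /andP[h0 hd].
(* The open ball of radius [2 * h] contains the closed interval; its measure [4 * h] is compensated
   by the tolerance [e / 4]. *)
have [] := Hd (2 * h).
- by rewrite /ball /= sub0r normrN gtr0_norm ?mulr_gt0//; lra.
- by rewrite mulr_gt0.
move=> fin; rewrite sub0r normrN ger0_norm; last first.
  by rewrite fine_ge0// davg_ge0.
move=> Hf.
have hm : bdmeas [set: R] (fun t => `|u t - u x|).
  by apply: bdmeas_norm; apply: bdmeasB => //; exact: bdmeas_cst.
have hI (A : set R) : measurable A -> (mu A < +oo)%E -> mu.-integrable A (EFin \o (fun t => `|u t - u x|)).
  move=> mA Afin; apply: bdmeas_integrable => //.
  by apply: bdmeasS hm => //.
have muB : mu (ball x (2 * h)) = (4 * h)%:E.
  by rewrite lebesgue_measure_ball ?mulr_ge0 ?ltW//; congr (_%:E); rewrite mulr2n; ring.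
have : (\int[mu]_(t in ball x (2 * h)) `|u t - u x|) <= h * e.
  move: Hf; rewrite /davg /iavg muB inver gt_eqF ?mulr_gt0//.
  have -> : (\int[mu]_(y in ball x (2 * h)) `|((center (u x) \o u) y)%:E|)%E =
     (\int[mu]_(t in ball x (2 * h)) `|u t - u x|)%:E.
    rewrite /Rintegral fineK//.
    apply: integrable_fin_num; first exact: measurable_ball.
    by apply: hI; [exact: measurable_ball|rewrite muB ltry].
  rewrite -EFinM /= => Hf.
  rewrite -(ler_pM2l (x := (4 * h)^-1)) ?invr_gt0 ?mulr_gt0// (le_trans (ltW Hf))//.
  by rewrite le_eqVlt; apply/orP; left; apply/eqP; field; rewrite gt_eqF.
apply: le_trans.
rewrite /Rintegral fine_le//.
- apply: integrable_fin_num => //; apply: hI => //; exact: lebesgue_itv_lty.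
- apply: integrable_fin_num; first exact: measurable_ball.
  by apply: hI; [exact: measurable_ball|rewrite muB ltry].
apply: ge0_subset_integral => //.
- exact: measurable_ball.
- apply/measurable_EFinP; apply: measurable_funS hm.1 => //.
- move=> t /=; rewrite in_itv /= /ball /= => /andP[t1 t2].
  rewrite ltr_norml; lra.
Unshelve. all: by end_near. Qed.

(** Peeling off dyadic rings: where [h / 2 <= |t - x| <= h] the kernel is at most
    [32 * (1 - r) / h ^+ 2], while the oscillation integrates to at most [h * e]. With
    [h = d / 2 ^+ k] a ring costs [32 * (1 - r) * e * 2 ^+ k / d], exactly what doubles the error
    term. *)
Let inner_bound (u : R -> R) (x d e r : R) k :
  bdmeas [set: R] u -> 0 < d -> 0 <= r < 1 -> 0 < e ->
  (forall h, 0 < h <= d -> \int[mu]_(t in `[x - h, x + h]) `|u t - u x| <= h * e) ->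
  (forall t, `|t - x| <= d -> `|t - x| <= cmod (expi t - expi x)) ->
  (forall a b : R, x - d <= a -> b <= x + d -> bdmeas `[a, b] (pkernel (r%:C%C * expi x))) ->
  \int[mu]_(t in `[x - d, x + d]) (`|u t - u x| * pkernel (r%:C%C * expi x) t) <=
  \int[mu]_(t in `[x - d / 2 ^+ k, x + d / 2 ^+ k]) (`|u t - u x| * pkernel (r%:C%C * expi x) t)
  + 32 * (1 - r) * e * 2 ^+ k / d.
Proof.
move=> hu d0 r01 e0 He Hx hp; have /andP[r0 r1] := r01.
have z1 : cmod (r%:C%C * expi x) < 1 by rewrite cmodM cmodr cmod_expi mulr1 ger0_norm.
have hg : bdmeas [set: R] (fun t => `|u t - u x|).
  by apply: bdmeas_norm; apply: bdmeasB => //; exact: bdmeas_cst.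
have hgi (a b : R) : bdmeas `[a, b] (fun t => `|u t - u x|) by apply: bdmeasS hg.
set P := pkernel _.
elim: k => [|k IH].
  by rewrite expr0 divr1 mulr1 lerDl divr_ge0 ?mulr_ge0 ?subr_ge0// ltW.
apply: le_trans IH _.
set h := d / 2 ^+ k.
have p2 : 0 < 2 ^+ k :> R by rewrite exprn_gt0.
have h0 : 0 < h by rewrite divr_gt0.
have hd : h <= d by rewrite ler_pdivrMr// ler_peMr ?(ltW d0)// exprn_ege1// ler1n.
have -> : d / 2 ^+ k.+1 = h / 2 by rewrite /h exprS; field; rewrite gt_eqF.
have hgp (a b : R) : x - d <= a -> b <= x + d -> bdmeas `[a, b] (fun t => `|u t - u x| * P t).
  by move=> ? ?; apply: bdmeasM => //; exact: hp.
have bnd (a b : R) : x - h <= a -> a <= b -> b <= x + h ->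
    (forall t, a <= t <= b -> h / 2 <= `|t - x|) ->
    \int[mu]_(t in `[a, b]) (`|u t - u x| * P t) <=
    (32 * (1 - r) / h ^+ 2) * \int[mu]_(t in `[a, b]) `|u t - u x|.
  move=> ax ab bx far; rewrite -itv_intZ//; apply: le_itv_int; first by apply: hgp; lra.
    by apply: bdmeasM => //; exact: bdmeas_cst.
  move=> t tab; rewrite mulrC ler_wpM2r//.
  have -> : 32 * (1 - r) / h ^+ 2 = 8 * (1 - r) / (h / 2) ^+ 2 by field; rewrite gt_eqF.
  apply: pkernel_le; rewrite ?cmod_expi ?divr_gt0//.
  rewrite (le_trans (far _ tab))// Hx// ler_norml; lra.
have near_ab (t : R) : x - h <= t <= x - h / 2 -> h / 2 <= `|t - x|.
  by move=> ?; rewrite ler_normr; apply/orP; right; lra.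
have near_ab' (t : R) : x + h / 2 <= t <= x + h -> h / 2 <= `|t - x|.
  by move=> ?; rewrite ler_normr; apply/orP; left; lra.
have B1 := bnd (x - h) (x - h / 2) (lexx _) ltac:(lra) ltac:(lra) near_ab.
have B2 := bnd (x + h / 2) (x + h) ltac:(lra) ltac:(lra) (lexx _) near_ab'.
rewrite (@Rintegral_split _ (x - h) (x - h / 2) (x + h)); [|lra|by apply: hgp; lra].
rewrite [X in _ + X + _ <= _](@Rintegral_split _ (x - h / 2) (x + h / 2) (x + h)); [|lra|by apply: hgp; lra].
have := He h; rewrite h0 hd => /(_ isT).
rewrite (@Rintegral_split _ (x - h) (x - h / 2) (x + h)) //; last lra.
rewrite [X in _ + X <= _ -> _](@Rintegral_split _ (x - h / 2) (x + h / 2) (x + h)) //; last lra.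
have mid : 0 <= \int[mu]_(t in `[x - h / 2, x + h / 2]) `|u t - u x| by apply: Rintegral_ge0.
set K := 32 * (1 - r) / h ^+ 2 in B1 B2 *.
have K0 : 0 <= K by rewrite divr_ge0 ?sqr_ge0// mulr_ge0// subr_ge0 ltW.
set I1 := \int[mu]_(t in _) `|_| in B1 *; set I3 := \int[mu]_(t in `[_, x + h]) `|_| in B2 *.
move=> HI.
have HK : K * (I1 + I3) <= K * (h * e).
  by rewrite ler_wpM2l// (le_trans _ HI)// lerD2l lerDr.
have EK : K * (h * e) = 32 * (1 - r) * e * 2 ^+ k / d.
  by rewrite /K /h; field; rewrite !gt_eqF.
have -> : 32 * (1 - r) * e * 2 ^+ k.+1 / d = K * (h * e) + K * (h * e).
  by rewrite EK exprS; field; rewrite gt_eqF.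
rewrite -EK addrCA [leRHS]addrA lerD2r lerD2l (le_trans (lerD B1 B2))//.
by rewrite -mulrDr.
Qed.

(** Far from [x] the kernel is of order [1 - r]. Near [x] the rings are peeled off down to width
    about [1 - r], where the kernel is at most [2 / (1 - r)] and the average of the oscillation
    suffices. *)
Lemma poisson_radial_limit (u : R -> R) (x e : R) : bdmeas [set: R] u ->
  0 < x < 1 -> lebesgue_pt u x -> 0 < e ->
  exists2 q : R, 0 < q & forall r, 0 <= r < 1 -> 1 - r < q ->
  `|\int[mu]_(t in `[0, 1]) (u t * pkernel (r%:C%C * expi x) t) - u x| <= e.
Proof.
move=> hu /andP[x0 x1] ux e0.
(* The central interval costs [2 * e'] and the rings [64 * e']; the two outer intervals cost [e / 4]
   each. *)
pose e' := e / 200.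
have e'0 : 0 < e' by rewrite divr_gt0.
have [d1 d10 Hd1] := lebesgue_pt_average hu ux e'0.
have [d2 d20 Hd2] := expi_sub1_ge.
pose d := Num.min (Num.min (d1 / 2) (d2 / 2)) (Num.min x (1 - x)).
have d0 : 0 < d by rewrite !lt_min !divr_gt0// x0 subr_gt0.
have dd1 : d < d1.
  by rewrite (@le_lt_trans _ _ (d1 / 2))// ?ge_min ?ge_min ?lexx//; lra.
have dd2 : d < d2.
  by rewrite (@le_lt_trans _ _ (d2 / 2))// ?ge_min ?ge_min ?lexx ?orbT//; lra.
have dx : d <= x by rewrite !ge_min lexx !orbT.
have xd : x + d <= 1 by rewrite -lerBrDl !ge_min lexx !orbT.
have [c c0 Hc] := expi_sub_ge_away d0 dx xd.
have [B0 HB0] := hu.2; pose B := Num.max B0 0 * 2.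
have Bge0 : 0 <= B by rewrite mulr_ge0// le_max lexx orbT.
have uB t : `|u t - u x| <= B.
  have H s : `|u s| <= Num.max B0 0 by rewrite le_max HB0.
  by rewrite (le_trans (ler_normB _ _))// /B mulr_natr mulr2n lerD.
have hg : bdmeas [set: R] (fun t => `|u t - u x|).
  by apply: bdmeas_norm; apply: bdmeasB => //; exact: bdmeas_cst.
have hgi (a b : R) : bdmeas `[a, b] (fun t => `|u t - u x|) by apply: bdmeasS hg.
have hui (a b : R) : bdmeas `[a, b] u by apply: bdmeasS hu.
pose q := Num.min d (e / 4 / (B * 8 / c ^+ 2 + 1)).
have D0 : 0 < B * 8 / c ^+ 2 + 1 by rewrite ltr_wpDl// divr_ge0 ?sqr_ge0// mulr_ge0.
exists q; first by rewrite lt_min d0 !divr_gt0.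
move=> r r01; rewrite lt_min => /andP[rd rq]; have /andP[r0 r1] := r01.
set P := pkernel (r%:C%C * expi x).
have z1 : cmod (r%:C%C * expi x) < 1 by rewrite cmodM cmodr cmod_expi mulr1 ger0_norm.
have hP : bdmeas `[0 : R, 1] P by exact: bdmeas_pkernel.
have P0 t : 0 <= P t by exact: pkernel_ge0.
have hPi (a b : R) : 0 <= a -> b <= 1 -> bdmeas `[a, b] P.
  move=> a0 b1; apply: bdmeasS hP => // t /=; rewrite !in_itv /= => /andP[t1 t2].
  by rewrite (le_trans a0 t1) (le_trans t2 b1).
have hgP (a b : R) : 0 <= a -> b <= 1 -> bdmeas `[a, b] (fun t => `|u t - u x| * P t).
  by move=> *; apply: bdmeasM => //; exact: hPi.
have -> : \int[mu]_(t in `[0, 1]) (u t * P t) - u x =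
    \int[mu]_(t in `[0, 1]) ((u t - u x) * P t).
  have cE : u x = \int[mu]_(t in `[0, 1]) (u x * P t).
    by rewrite itv_intZ// int_pkernel// mulr1.
  rewrite {1}cE -itv_intB.
  - by apply: eq_itv_int => t _; rewrite mulrBl.
  - exact: bdmeasM.
  - by apply: bdmeasM => //; exact: bdmeas_cst.
apply: le_trans (le_normr_Rintegral _ _) _ => //.
  apply: itv_integrable; apply: bdmeasM => //; apply: bdmeasB => //; exact: bdmeas_cst.
have -> : \int[mu]_(t in `[0, 1]) `|(u t - u x) * P t| =
    \int[mu]_(t in `[0, 1]) (`|u t - u x| * P t).
  by apply: eq_itv_int => t _; rewrite normrM (ger0_norm (P0 t)).
rewrite (@Rintegral_split _ 0 (x - d) 1); [|lra|exact: hgP].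
rewrite [X in _ + X <= _](@Rintegral_split _ (x - d) (x + d) 1); [|lra|by apply: hgP; lra].
have outer (a b : R) : 0 <= a -> a <= b -> b <= 1 -> (forall t, a <= t <= b -> d <= `|t - x|) ->
    \int[mu]_(t in `[a, b]) (`|u t - u x| * P t) <= e / 4.
  move=> a0 ab b1 far.
  apply: (@le_trans _ _ (\int[mu]_(t in `[a, b]) (B * (8 * (1 - r) / c ^+ 2)))).
    apply: le_itv_int; [exact: hgP|exact: bdmeas_cst|move=> t tab].
    apply: ler_pM => //; apply: pkernel_le => //; first exact: cmod_expi.
    apply: Hc; last exact: far.
    by case/andP: tab => t1 t2; rewrite (le_trans a0 t1) (le_trans t2 b1).
  rewrite Rintegral_itv_cst//.
  have : B * (8 * (1 - r) / c ^+ 2) <= e / 4.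
    have -> : B * (8 * (1 - r) / c ^+ 2) = (1 - r) * (B * 8 / c ^+ 2) by ring.
    rewrite (@le_trans _ _ ((1 - r) * (B * 8 / c ^+ 2 + 1)))//.
      by rewrite ler_wpM2l ?lerDl// subr_ge0 ltW.
    by rewrite -ler_pdivlMr// ltW.
  apply: le_trans; apply: ler_piMr; last lra.
  by rewrite mulr_ge0// divr_ge0 ?sqr_ge0// mulr_ge0// subr_ge0 ltW.
have far1 t : 0 <= t <= x - d -> d <= `|t - x|.
  by move=> ?; rewrite ler_normr; apply/orP; right; lra.
have far2 t : x + d <= t <= 1 -> d <= `|t - x|.
  by move=> ?; rewrite ler_normr; apply/orP; left; lra.
have O1 := outer 0 (x - d) (lexx _) ltac:(lra) ltac:(lra) far1.
have O2 := outer (x + d) 1 ltac:(lra) ltac:(lra) (lexx _) far2.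
have avg h : 0 < h <= d -> \int[mu]_(t in `[x - h, x + h]) `|u t - u x| <= h * e'.
  by move=> /andP[h0 hd]; apply: Hd1; rewrite h0 (le_lt_trans hd dd1).
have near1 t : `|t - x| <= d -> `|t - x| <= cmod (expi t - expi x).
  by move=> td; rewrite cmod_expi_sub; apply: Hd2; exact: le_lt_trans dd2.
have hp' (a b : R) : x - d <= a -> b <= x + d -> bdmeas `[a, b] (pkernel (r%:C%C * expi x)).
  by move=> ? ?; apply: hPi; lra.
have inner k := @inner_bound u x d e' r k hu d0 r01 e'0 avg near1 hp'.
have q0 : 0 < 1 - r by rewrite subr_gt0.
(* The least such [k] makes [d / 2 ^+ k] comparable to [1 - r] from both sides: at most [1 - r]
   keeps the central part small, at least half of it keeps the ring sum bounded. *)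
have [k Hk Hmin] : exists2 k, d / 2 ^+ k <= 1 - r & (forall j, d / 2 ^+ j <= 1 - r -> (k <= j)%N).
  have ex : exists k, d / 2 ^+ k <= 1 - r.
    exists (Num.truncn (d / (1 - r))).+1.
    rewrite ler_pdivrMr ?exprn_gt0// mulrC -ler_pdivrMr//.
    rewrite (le_trans (ltW (truncnS_gt _)))// -natrX ler_nat ltnW// ltn_expl//.
  by exists (ex_minn ex); case: ex_minnP.
case: k Hk Hmin => [|k] Hk Hmin; first by move: Hk; rewrite expr0 divr1; lra.
have Hk' : 1 - r < d / 2 ^+ k.
  by rewrite ltNge; apply/negP => /Hmin; rewrite ltnn.
have p2 : 0 < 2 ^+ k :> R by rewrite exprn_gt0.
set h := d / 2 ^+ k.+1 in Hk.
have h0 : 0 < h by rewrite divr_gt0// exprn_gt0.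
have hd : h <= d by rewrite ler_pdivrMr ?exprn_gt0// ler_peMr ?(ltW d0)// exprn_ege1// ler1n.
have := inner k.+1; rewrite -/h -/P => Hin.
have I1 : \int[mu]_(t in `[x - h, x + h]) (`|u t - u x| * P t) <= 2 * e'.
  apply: (@le_trans _ _ (\int[mu]_(t in `[x - h, x + h]) (2 / (1 - r) * `|u t - u x|))).
    apply: le_itv_int; [by apply: hgP; lra|by apply: bdmeasM => //; exact: bdmeas_cst|].
    move=> t _; rewrite mulrC ler_wpM2r//.
    have zt : 1 - r <= cmod (expi t - r%:C%C * expi x).
      by rewrite (le_trans _ (cmod_sub_ge _ _))// cmod_expi cmodM cmodr cmod_expi mulr1 ger0_norm.
    rewrite /P /pkernel cmodM cmodr cmod_expi mulr1 ger0_norm// ler_pdivrMr; last first.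
      by rewrite exprn_gt0// (lt_le_trans q0).
    apply: (@le_trans _ _ (2 / (1 - r) * (1 - r) ^+ 2)).
      have -> : 2 / (1 - r) * (1 - r) ^+ 2 = 2 * (1 - r) by field; rewrite gt_eqF.
      have -> : 1 - r ^+ 2 = (1 + r) * (1 - r) by ring.
      by rewrite ler_wpM2r ?(ltW q0)//; lra.
    by rewrite ler_wpM2l ?divr_ge0 ?(ltW q0)// ler_sqr ?nnegrE ?cmod_ge0 ?(ltW q0).
  rewrite itv_intZ//.
  rewrite (le_trans (ler_wpM2l _ (avg h _)))// ?divr_ge0 ?(ltW q0)// ?h0//.
  have -> : 2 / (1 - r) * (h * e') = h / (1 - r) * (2 * e') by field; rewrite gt_eqF.
  by apply: ler_piMl; [rewrite mulr_ge0// ltW|rewrite ler_pdivrMr// mul1r].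
have I2 : 32 * (1 - r) * e' * 2 ^+ k.+1 / d <= 64 * e'.
  have -> : 32 * (1 - r) * e' * 2 ^+ k.+1 / d = (1 - r) / (d / 2 ^+ k) * (64 * e').
    by rewrite exprS; field; rewrite !gt_eqF.
  by apply: ler_piMl; [rewrite mulr_ge0// ltW|rewrite ler_pdivrMr ?mul1r ?divr_gt0// ltW].
have : 200 * e' = e by rewrite /e'; field.
lra.
Qed.

End radial_limits_of_poisson_integrals.

Lemma ae_imp d (T : measurableType d) (R : realType) (mu : {measure set T -> \bar R})
  (P Q : T -> Prop) : (forall x, P x -> Q x) ->
  {ae mu, forall x, P x} -> {ae mu, forall x, Q x}.
Proof. exact: (@filterS _ _ (ae_filter_ringOfSetsType mu)). Qed.

Lemma ae_imp2 d (T : measurableType d) (R : realType) (mu : {measure set T -> \bar R})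
  (P Q S : T -> Prop) : (forall x, P x -> Q x -> S x) ->
  {ae mu, forall x, P x} -> {ae mu, forall x, Q x} -> {ae mu, forall x, S x}.
Proof. exact: (@filterS2 _ _ (ae_filter_ringOfSetsType mu)). Qed.

(** * Fatou's theorem on radial limits *)

Section almost_everywhere_convergence.
Context {R : realType}.
Local Notation mu := (@lebesgue_measure R).

(** The series of absolute increments has a finite integral, so it is finite almost everywhere, and
    there the telescoping series converges absolutely. *)
Lemma ae_cvg_of_summable (u : nat -> R -> R) :
  (forall n, bdmeas `[0 : R, 1] (u n)) ->
  (forall n, \int[mu]_(t in `[0, 1]) `|u n.+1 t - u n t| <= 1 / (2 ^ (n + 1))%:R) ->
  {ae mu, forall t, `[0 : R, 1]%classic t -> cvgn (u ^~ t : nat -> R^o)}.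
Proof.
move=> hu Hu.
pose g n t := (`|u n.+1 t - u n t|)%:E.
pose F t := (\sum_(0 <= n <oo) g n t)%E.
have hg n : bdmeas `[0 : R, 1] (fun t => `|u n.+1 t - u n t|).
  by apply: bdmeas_norm; exact: bdmeasB.
have mg n : measurable_fun `[0 : R, 1] (g n) by apply/measurable_EFinP; exact: (hg n).1.
have g0 n t : (0 <= g n t)%E by rewrite lee_fin.
have F0 t : (0 <= F t)%E by apply: nneseries_ge0.
have IF : mu.-integrable `[0 : R, 1] F.
  apply/integrableP; split.
    by apply: (ge0_emeasurable_sum (h := g)) => // n _; exact: mg.
  under eq_integral do rewrite gee0_abs//.
  rewrite integral_nneseries//.
  apply: (@le_lt_trans _ _ (\sum_(0 <= n <oo) (1 / (2 ^ (n + 1))%:R)%:E)%E).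
    apply: lee_nneseries => [n _ _|n _]; first by apply: integral_ge0.
    move: (Hu n); rewrite /Rintegral -lee_fin fineK//.
    exact: (integrable_fin_num _ (itv_integrable (hg n))).
  have := @cvg_geometric_eseries_half R 1 0.
  by move=> /cvg_lim -> //; rewrite ltry.
have := integrable_ae _ IF; move=> /(_ (measurable_itv _)).
apply: ae_imp => t Ht t01; have {}Ht := Ht t01.
have cs : cvgn [normed series (telescope (u ^~ t : nat -> R^o))].
  apply: nondecreasing_is_cvgn.
    apply/nondecreasing_seqP => n.
    by rewrite /normed_series_of /series /= big_nat_recr//= lerDl.
  exists (fine (F t)) => _ [n _ <-] /=.
  rewrite -lee_fin fineK// /normed_series_of /series /= -sumEFin.
  exact: (@nneseries_lim_ge _ _ xpredT 0 n).
have := normed_cvg cs; rewrite telescopeK => h.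
have -> : (u ^~ t : nat -> R^o) = (fun n => (u n t - u 0%N t) + u 0%N t).
  by apply/funext => n; rewrite subrK.
by apply: is_cvgD => //; exact: is_cvg_cst.
Qed.

End almost_everywhere_convergence.

(** * The Poisson representation of a bounded analytic function *)

Section boundary_function.
Context {R : realType}.
Local Notation C := R[i].
Local Notation Re := complex.Re.
Local Notation Im := complex.Im.
Local Notation mu := (@lebesgue_measure R).
Variables (f : C -> C) (B : R).
Hypothesis hf : forall z, cmod z < 1 -> holo f z.
Hypothesis fB : forall z, cmod z < 1 -> cmod (f z) <= B.

Lemma holo_conj (g : C -> C) (z : C) : holo g (z^*)%C -> holo (fun w => ((g (w^*)%C)^*)%C) z.
Proof.
move=> /holoP[l H]; apply/holoP; exists (l^*)%C => e /H[d d0 Hd]; exists d => // h hd.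
have := Hd (h^*)%C; rewrite cmod_conj => /(_ hd).
rewrite -[cmod (_ - _)]cmod_conj.
suff -> : ((g (z^*%C + h^*%C) - g z^*%C - l * h^*%C)^*)%C =
   ((g ((z + h)^*)%C)^*)%C - ((g (z^*)%C)^*)%C - (l^*)%C * h by [].
rewrite !rmorphB !rmorphM /= conjcK; congr (_ - _ - _).
by congr (_ (g _)); rewrite rmorphD.
Qed.

Let cmod_re (r t : R) : 0 <= r -> cmod (r%:C%C * expi t) = r.
Proof. by move=> r0; rewrite cmodM cmodr cmod_expi mulr1 ger0_norm. Qed.

Let phi (r : R) := \int[mu]_(t in `[0, 1]) cmod (f (r%:C%C * expi t)) ^+ 2.

Let hRe (r : R) : 0 <= r < 1 -> bdmeas `[0 : R, 1] (fun t => Re (f (r%:C%C * expi t))).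
Proof.
move=> /andP[r0 r1]; apply: (@bdmeas_Re_circle _ r f) => z zr; apply: hf.
by rewrite zr ger0_norm.
Qed.

Let hIm (r : R) : 0 <= r < 1 -> bdmeas `[0 : R, 1] (fun t => Im (f (r%:C%C * expi t))).
Proof.
move=> /andP[r0 r1]; apply: (@bdmeas_Im_circle _ r f) => z zr; apply: hf.
by rewrite zr ger0_norm.
Qed.

Let hsq (r : R) : 0 <= r < 1 -> bdmeas `[0 : R, 1] (fun t => cmod (f (r%:C%C * expi t)) ^+ 2).
Proof.
move=> r01; apply: (@eq_bdmeas _ _ _ _ (fun t => Re (f (r%:C%C * expi t)) * Re (f (r%:C%C * expi t)) +
  Im (f (r%:C%C * expi t)) * Im (f (r%:C%C * expi t)))).
  by move=> t _; rewrite cmod_sqr !expr2.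
by apply: bdmeasD; apply: bdmeasM; (exact: hRe || exact: hIm).
Qed.

Let hprod (r s : R) : 0 <= r < 1 -> 0 <= s < 1 ->
  bdmeas `[0 : R, 1] (fun t => Re (f (r%:C%C * expi t) * ((f (s%:C%C * expi t))^*)%C)).
Proof.
move=> r01 s01.
apply: (@eq_bdmeas _ _ _ _ (fun t => Re (f (r%:C%C * expi t)) * Re (f (s%:C%C * expi t)) +
  Im (f (r%:C%C * expi t)) * Im (f (s%:C%C * expi t)))).
  by move=> t _; rewrite ReM; case: (f (s%:C%C * _)) => x y /=; rewrite mulrN opprK.
by apply: bdmeasD; apply: bdmeasM; (exact: hRe || exact: hIm).
Qed.

(* [f z * conj (f (conj (p / z)))] is analytic for [p < |z| < 1], hence has
   the same mean over [|z| = r] as over [|z| = sqrt p] when [p = r s]. *)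
Let inner_product (r s : R) : 0 < r < 1 -> 0 < s < 1 ->
  \int[mu]_(t in `[0, 1]) Re (f (r%:C%C * expi t) * ((f (s%:C%C * expi t))^*)%C) =
  phi (Num.sqrt (r * s)).
Proof.
move=> /andP[r0 r1] /andP[s0 s1].
pose p := r * s; have p0 : 0 < p by rewrite mulr_gt0.
have pr : p < r by rewrite gtr_pMr.
have p1 : p < 1 := lt_trans pr r1.
pose q := Num.sqrt p; have q0 : 0 < q by rewrite sqrtr_gt0.
have qq : q * q = p by rewrite -expr2 sqr_sqrtr// ltW.
have q1 : q < 1.
  by rewrite -(@ltr_pXn2r _ 2) ?nnegrE ?(ltW q0)// expr2 qq expr1n.
have pq : p < q by rewrite -qq gtr_pMr.
pose g (z : C) := f z * ((f ((p%:C%C / z)^*)%C)^*)%C.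
have hg z : p < cmod z -> cmod z < 1 -> holo g z.
  move=> pz z1; apply: holoM; first exact: hf.
  have z0 : z != 0 by rewrite -cmod_gt0 (lt_trans p0).
  apply: (@holo_comp _ (fun w => ((f (w^*)%C)^*)%C) (fun w => p%:C%C / w)).
    apply: holo_conj; apply: hf; rewrite cmod_conj cmodM cmodV cmodr gtr0_norm//.
    by rewrite ltr_pdivrMr ?mul1r// (lt_trans p0).
  apply: holoM; first exact: holo_cst.
  by apply: (holoV (f := id)) => //; exact: holo_id.
have gE (x t : R) : 0 < x -> g (x%:C%C * expi t) =
    f (x%:C%C * expi t) * ((f ((p / x)%:C%C * expi t))^*)%C.
  move=> x0; rewrite /g; congr (_ * (f _)^*)%C.
  have xC0 : x%:C%C != 0 :> C by rewrite -cmod_gt0 cmodr gtr0_norm.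
  have ee : ((expi t)^-1^*)%C = expi t.
    by rewrite -[RHS]conjcK; congr (_^*)%C; have := conj_expiB 0 t; rewrite conjc0 !subr0.
  have -> : p%:C%C / (x%:C%C * expi t) = (p / x)%:C%C * (expi t)^-1.
    have -> : (p / x)%:C%C = p%:C%C / x%:C%C :> C by rewrite rmorphM /= fmorphV.
    by field; rewrite xC0 expi_neq0.
  transitivity ((((p / x)%:C)^*)%C * (((expi t)^-1)^*)%C); first exact: rmorphM.
  by rewrite conjc_real ee.
transitivity (\int[mu]_(t in `[0, 1]) Re (g (r%:C%C * expi t))).
  apply: eq_itv_int => t _; rewrite gE// /p; congr (Re (_ * (f (_%:C%C * _))^*)%C).
  by field; rewrite gt_eqF.
transitivity (\int[mu]_(t in `[0, 1]) Re (g (q%:C%C * expi t))).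
  have [rq|/ltW qr] := leP r q; [|symmetry]; apply: (@circle_mean_cst _ g); rewrite ?r0 ?q0//.
    by move=> z /andP[z1 z2]; apply: hg; [exact: lt_le_trans z1|exact: le_lt_trans q1].
  by move=> z /andP[z1 z2]; apply: hg; [exact: lt_le_trans z1|exact: le_lt_trans r1].
apply: eq_itv_int => t _; rewrite gE// -/p -/q.
have -> : p / q = q by rewrite -qq; field; rewrite gt_eqF.
by rewrite -cmod_sqr_conj.
Qed.

(** Expanding the square leaves a cross term, which [inner_product] evaluates at the geometric mean
    of the radii. *)
Let dist_phi (r s : R) : 0 < r < 1 -> 0 < s < 1 ->
  \int[mu]_(t in `[0, 1]) cmod (f (r%:C%C * expi t) - f (s%:C%C * expi t)) ^+ 2 =
  phi r + phi s - 2 * phi (Num.sqrt (r * s)).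
Proof.
move=> r01 s01; rewrite -inner_product//.
have r01' : 0 <= r < 1 by case/andP: r01 => /ltW -> ->.
have s01' : 0 <= s < 1 by case/andP: s01 => /ltW -> ->.
rewrite -itv_intZ ?/phi -?itv_intD -?itv_intB; first last.
- exact: hprod.
- by apply: hsq.
- by apply: hsq.
- by apply: bdmeasM; [exact: bdmeas_cst|exact: hprod].
- by apply: bdmeasD; exact: hsq.
apply: eq_itv_int => t _; rewrite !cmod_sqr.
case: (f (r%:C%C * _)) => a b; case: (f (s%:C%C * _)) => c d /=; ring.
Qed.

Let phi_midpoint (r s : R) : 0 < r < 1 -> 0 < s < 1 -> 2 * phi (Num.sqrt (r * s)) <= phi r + phi s.
Proof.
move=> r01 s01; rewrite -subr_ge0 -dist_phi//; apply: Rintegral_ge0 => t _.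
exact: sqr_ge0.
Qed.

Let B0 : 0 <= B.
Proof. by apply: le_trans (fB (z := 0) _); rewrite ?cmod_ge0// Normc.normc0. Qed.

Let phi_le (r : R) : 0 <= r < 1 -> phi r <= B ^+ 2.
Proof.
move=> /andP[r0 r1].
have -> : B ^+ 2 = \int[mu]_(t in `[0, 1]) (B ^+ 2) by rewrite Rintegral_itv_cst// subr0 mulr1.
apply: le_itv_int; [by apply: hsq; rewrite r0|exact: bdmeas_cst|move=> t _].
by rewrite ler_sqr ?nnegrE ?cmod_ge0// fB// cmod_re.
Qed.

(* Midpoint convexity in [log r] together with boundedness forces monotonicity. *)
Let phi_nondecreasing (r s : R) : 0 < r -> r <= s -> s < 1 -> phi r <= phi s.
Proof.
move=> r0 rs s1; rewrite leNgt; apply/negP => H.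
have s0 := lt_le_trans r0 rs.
pose q := r / s.
have q0 : 0 < q by rewrite divr_gt0.
have q1 : q <= 1 by rewrite ler_pdivrMr// mul1r.
(* A geometric progression beginning with [s] and [r]. If [phi] rose from [s] to the smaller radius
   [r], convexity would make it rise at least as much at every further step, past the bound
   [B ^+ 2]. *)
pose x n := s * q ^+ n.
have x0 n : 0 < x n by rewrite mulr_gt0// exprn_gt0.
have x1 n : x n < 1 by rewrite (le_lt_trans _ s1)// ler_piMr ?(ltW s0)// exprn_ile1// ltW.
have x01 n : 0 < x n < 1 by rewrite x0 x1.
have mid n : 2 * phi (x n.+1) <= phi (x n.+2) + phi (x n).
  have := phi_midpoint (x01 n.+2) (x01 n).
  have -> : x n.+2 * x n = x n.+1 ^+ 2 by rewrite /x !exprS; ring.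
  by rewrite sqrtr_sqr gtr0_norm.
have d0 : 0 < phi r - phi s by rewrite subr_gt0.
have X0 : x 0%N = s by rewrite /x expr0 mulr1.
have X1 : x 1%N = r by rewrite /x expr1 /q; field; rewrite gt_eqF.
have inc n : phi r - phi s <= phi (x n.+1) - phi (x n).
  elim: n => [|n IH]; first by rewrite X0 X1.
  by have := mid n; lra.
have lin n : phi s + n%:R * (phi r - phi s) <= phi (x n).
  elim: n => [|n IH]; first by rewrite mul0r addr0 X0.
  by have := inc n; rewrite -natr1 mulrDl mul1r; lra.
have phis : 0 <= phi s by apply: Rintegral_ge0 => t _; exact: sqr_ge0.
pose n := (Num.truncn (B ^+ 2 / (phi r - phi s))).+1.
have : B ^+ 2 < n%:R * (phi r - phi s) by rewrite -ltr_pdivrMr// truncnS_gt.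
have := lin n; have := phi_le (r := x n); rewrite (ltW (x0 n)) x1 => /(_ isT).
lra.
Qed.

(** Beyond a radius [r0] where [phi] is within [e / 2] of its supremum, all three terms of
    [dist_phi] are, because the geometric mean of two such radii is again at least [r0]. *)
Let L2_cauchy (e : R) : 0 < e -> exists2 r0 : R, 0 < r0 < 1 & forall r s : R, r0 <= r < 1 -> r0 <= s < 1 ->
  \int[mu]_(t in `[0, 1]) cmod (f (r%:C%C * expi t) - f (s%:C%C * expi t)) ^+ 2 <= e.
Proof.
move=> e0.
pose A := [set phi r | r in [set r | 0 < r < 1]].
have Aub : has_ubound A.
  by exists (B ^+ 2) => _ [r /andP[r0 r1] <-]; apply: phi_le; rewrite r1 ltW.
have A0 : A !=set0 by exists (phi (1 / 2)); exists (1 / 2) => //=; lra.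
have [_ [r0 /= r01 <-] Hr0] := sup_adherent (divr_gt0 e0 (ltr0n R 2)) (conj A0 Aub).
exists r0 => // r s /andP[r0r r1] /andP[r0s s1]; case/andP: r01 => r00 r01.
have r_gt0 := lt_le_trans r00 r0r; have s_gt0 := lt_le_trans r00 r0s.
rewrite dist_phi ?r_gt0 ?s_gt0//.
have up x : 0 < x -> x < 1 -> phi x <= sup A.
  by move=> x0 x1; apply: ub_le_sup => //; exists x => //=; rewrite x0.
have U1 := up _ r_gt0 r1; have U2 := up _ s_gt0 s1.
have rs1 : Num.sqrt (r * s) < 1.
  rewrite -sqrtr1 ltr_sqrt// (le_lt_trans _ r1)// ler_piMr ?(ltW r_gt0)// ltW//.
have r0rs : r0 <= Num.sqrt (r * s).
  rewrite -(ger0_norm (ltW r00)) -sqrtr_sqr ler_wsqrtr// expr2 ler_pM// ltW//.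
have := phi_nondecreasing r00 r0rs rs1.
lra.
Qed.

(** The squared L2 distances decrease like [4 ^ - (n + 1)] so that the L1 distances are summable. *)
Let radii : exists s : nat -> R, [/\ forall n, 0 < s n < 1,
  s @ \oo --> (1 : R) &
  forall n, \int[mu]_(t in `[0, 1]) cmod (f ((s n.+1)%:C%C * expi t) - f ((s n)%:C%C * expi t)) ^+ 2
    <= ((2 ^ (n + 1))%:R ^+ 2)^-1].
Proof.
have ep (n : nat) : 0 < ((2 ^ (n + 1))%:R ^+ 2)^-1 :> R.
  by rewrite invr_gt0 exprn_gt0// ltr0n expn_gt0.
pose r0 n := projT1 (cid2 (L2_cauchy (ep n))).
have r01 n : 0 < r0 n < 1 by rewrite /r0; case: cid2.
have Hr n : forall r s : R, r0 n <= r < 1 -> r0 n <= s < 1 ->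
    \int[mu]_(t in `[0, 1]) cmod (f (r%:C%C * expi t) - f (s%:C%C * expi t)) ^+ 2
    <= ((2 ^ (n + 1))%:R ^+ 2)^-1.
  by rewrite /r0; case: cid2.
(* The previous radius enters the maximum so that [s n.+1] also exceeds the threshold [r0 n]; the
   last entry forces convergence to [1]. *)
pose s := fix s n : R := if n is k.+1 then Num.max (Num.max (s k) (r0 n)) (1 - n.+1%:R^-1)
  else r0 0%N.
have s01 n : 0 < s n < 1.
  elim: n => [|n /andP[IH1 IH2]]; first exact: r01.
  have /andP[h1 h2] := r01 n.+1.
  by rewrite /= !lt_max !gt_max IH1 IH2 h2 /= gtrBl invr_gt0 ltr0n.
have sr n : r0 n <= s n by case: n => [|n] //=; rewrite !le_max lexx orbT.
have sS n : s n <= s n.+1 by rewrite /= !le_max lexx.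
have s_ge n : 1 - n.+1%:R^-1 <= s n.
  case: n => [|n]; last by rewrite [leRHS]/= !le_max lexx !orbT.
  by rewrite invr1 subrr; have /andP[/ltW] := s01 0%N.
exists s; split => //.
  apply/cvgrPdist_lt => e e0; near=> n.
  have /andP[_ s1] := s01 n.
  rewrite gtr0_norm ?subr_gt0//.
  have n1 := s_ge n.
  have h : e^-1 < n%:R by near: n; exact: nbhs_infty_gtr.
  have {}h : n.+1%:R^-1 < e.
    by rewrite invf_plt ?posrE// (lt_trans h)// ltr_nat.
  by rewrite (le_lt_trans _ h)// lerBlDr -lerBlDl.
move=> n; have /andP[_ h1] := s01 n; have /andP[_ h2] := s01 n.+1.
by apply: Hr; [rewrite h2 andbT (le_trans (sr n))|rewrite h1 sr].
Unshelve. all: by end_near. Qed.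

(** The boundary function is the almost everywhere limit of the dilates along [radii], and dominated
    convergence carries the Poisson formula to the limit. *)
Lemma poisson_boundary_function : exists2 U : R -> R, bdmeas [set: R] U &
  forall a, cmod a < 1 -> Re (f a) = \int[mu]_(t in `[0, 1]) (U t * pkernel a t).
Proof.
have [s [s01 s1 Hs]] := radii.
have sn0 n : 0 <= s n < 1 by case/andP: (s01 n) => /ltW -> ->.
pose u n t := Re (f ((s n)%:C%C * expi t)).
have uB n t : `|u n t| <= B.
  rewrite (le_trans (normRe_le_cmod _))// fB// cmod_re//; by case/andP: (sn0 n).
have mu_u n : measurable_fun [set: R] (u n).
  apply: continuous_measurable_fun => t.
  have hh : holo f ((s n)%:C%C * expi t).
    by apply: hf; rewrite cmod_re; case/andP: (sn0 n).
  by have [] := continuous_ReIm_expi hh.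
(* An upper limit is defined and measurable everywhere; clamping it to [[- B, B]] makes it bounded
   everywhere without altering it where the limit exists. *)
pose L t := limn_sup (u ^~ t).
have mL : measurable_fun [set: R] L.
  apply: measurable_fun_limn_sup => [t _|t _|//].
  - by exists B => _ [n _ <-]; rewrite (le_trans (ler_norm _)).
  - by exists (- B) => _ [n _ <-]; have := uB n t; rewrite ler_norml => /andP[].
pose U t := Num.max (- B) (Num.min B (L t)).
have hU : bdmeas [set: R] U.
  split; last first.
    exists B => t _; rewrite ler_norml /U le_max lexx /= ge_max ge_min lexx /=.
    by rewrite andbT; have := B0; lra.
  apply: measurable_maxr; first exact: measurable_cst.
  by apply: measurable_minr => //; exact: measurable_cst.
exists U => // a a1.
have hu n : bdmeas `[0 : R, 1] (u n) by exact: hRe.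
have aeU : {ae mu, forall t, `[0 : R, 1]%classic t -> u ^~ t @ \oo --> U t}.
  have := @ae_cvg_of_summable _ u hu.
  have Hsum n : \int[mu]_(t in `[0, 1]) `|u n.+1 t - u n t| <= 1 / (2 ^ (n + 1))%:R.
    set l : R := (2 ^ (n + 1))%:R.
    have l0 : 0 < l by rewrite ltr0n expn_gt0.
    have hd : bdmeas `[0 : R, 1] (fun t => cmod (f ((s n.+1)%:C%C * expi t) - f ((s n)%:C%C * expi t)) ^+ 2).
      apply: (@eq_bdmeas _ _ _ _ (fun t => (u n.+1 t - u n t) * (u n.+1 t - u n t) +
        (Im (f ((s n.+1)%:C%C * expi t)) - Im (f ((s n)%:C%C * expi t))) *
        (Im (f ((s n.+1)%:C%C * expi t)) - Im (f ((s n)%:C%C * expi t))))).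
        by move=> t _; rewrite cmod_sqr !ReImE !expr2.
      by apply: bdmeasD; apply: bdmeasM; apply: bdmeasB; (exact: hRe || exact: hIm).
    (* The inequality [x <= l / 2 * x ^+ 2 + l^-1 / 2] replaces Cauchy-Schwarz; with
       [l = 2 ^ (n + 1)] each summand integrates to at most [l^-1 / 2]. *)
    apply: (@le_trans _ _ (\int[mu]_(t in `[0, 1]) (l / 2 * cmod (f ((s n.+1)%:C%C * expi t) - f ((s n)%:C%C * expi t)) ^+ 2 + l^-1 / 2))).
      apply: le_itv_int.
      - by apply: bdmeas_norm; exact: bdmeasB.
      - by apply: bdmeasD; [apply: bdmeasM => //|]; exact: bdmeas_cst.
      move=> t _.
      have h1 : `|u n.+1 t - u n t| <= cmod (f ((s n.+1)%:C%C * expi t) - f ((s n)%:C%C * expi t)).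
        by rewrite /u -ReN -ReD; exact: normRe_le_cmod.
      apply: le_trans h1 _; set x := cmod _.
      have -> : l / 2 * x ^+ 2 + l^-1 / 2 = x + l / 2 * (x - l^-1) ^+ 2 by field; rewrite gt_eqF.
      by rewrite lerDl mulr_ge0 ?sqr_ge0// divr_ge0// ltW.
    rewrite itv_intD; [|by apply: bdmeasM => //; exact: bdmeas_cst|exact: bdmeas_cst].
    rewrite itv_intZ// Rintegral_itv_cst// subr0 mulr1.
    have -> : 1 / l = l / 2 * (l ^+ 2)^-1 + l^-1 / 2 by field; rewrite gt_eqF.
    by rewrite lerD2r ler_wpM2l// divr_ge0// ltW.
  move=> /(_ Hsum); apply: ae_imp => t Ht t01; have {}Ht := Ht t01.
  have -> : U t = limn (u ^~ t).
    rewrite /U /L cvg_limn_supE//.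
    have l1 : limn (u ^~ t) <= B.
      by apply: limr_le => //; apply: nearW => n; rewrite (le_trans (ler_norm _)).
    have l2 : - B <= limn (u ^~ t).
      by apply: limr_ge => //; apply: nearW => n; have := uB n t; rewrite ler_norml => /andP[].
    by rewrite min_r// max_r.
  exact: Ht.
have hP := bdmeas_pkernel a1.
have P0 t : 0 <= pkernel a t by exact: pkernel_ge0.
have hUi : bdmeas `[0 : R, 1] U by apply: bdmeasS hU.
have huP n : bdmeas `[0 : R, 1] (fun t => u n t * pkernel a t) by apply: bdmeasM.
have hUP : bdmeas `[0 : R, 1] (fun t => U t * pkernel a t) by apply: bdmeasM.
have intE g : bdmeas `[0 : R, 1] g -> (\int[mu]_(t in `[0%R, 1%R]) (g t)%:E = (\int[mu]_(t in `[0, 1]) g t)%:E)%E.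
  by move=> hg; rewrite /Rintegral fineK//; exact: (integrable_fin_num _ (itv_integrable hg)).
have [] := @dominated_convergence _ _ _ mu `[0 : R, 1]%classic (measurable_itv _)
  (fun n t => (u n t * pkernel a t)%:E) (fun t => (U t * pkernel a t)%:E)
  (fun t => (B * pkernel a t)%:E).
- by move=> n; apply/measurable_EFinP; exact: (huP n).1.
- by apply/measurable_EFinP; exact: hUP.1.
- apply: ae_imp aeU => t Ht t01.
  apply: cvg_EFin; first exact: nearW.
  by apply: cvgMl; exact: Ht.
- by apply: itv_integrable; apply: bdmeasM => //; exact: bdmeas_cst.
- apply: aeW => t n _; rewrite lee_fin normrM (ger0_norm (P0 t)).
  by rewrite ler_wpM2r.
move=> _ _; rewrite intE// => H.
(* On the circle of radius [s n] the formula is applied at [s n * a], so that the kernel is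
   [pkernel a] for every [n]. *)
have {H} : (fun n => (Re (f ((s n)%:C%C * a)))%:E) @ \oo -->
    (\int[mu]_(t in `[0, 1]) (U t * pkernel a t))%:E.
  apply: cvg_trans H; apply: near_eq_cvg; apply: nearW => n.
  have /andP[sp s1'] := s01 n.
  have sC : (s n)%:C%C != 0 :> C by rewrite -cmod_gt0 cmodr gtr0_norm.
  transitivity ((\int[mu]_(t in `[0, 1]) (u n t * pkernel a t))%:E); first exact: (intE _ (huP n)).
  congr (_%:E).
  have h1 : cmod ((s n)%:C%C * a) < s n < 1.
    by rewrite s1' andbT cmodM cmodr gtr0_norm// gtr_pMr.
  have := poisson_formula_circle hf fB h1.
  by have -> : (s n)%:C%C * a / (s n)%:C%C = a by field.
move=> H1.
have H2 : (fun n => (Re (f ((s n)%:C%C * a)))%:E) @ \oo --> (Re (f a))%:E.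
  apply: cvg_EFin; first exact: nearW.
  apply/cvgrPdist_lt => e e0.
  have [d d0 Hd] := holo_continuous (hf a1) e0.
  move/cvgrPdist_lt : s1 => /(_ d d0); apply: filterS => n Hn.
  have : cmod ((s n)%:C%C * a - a) < d.
    have -> : (s n)%:C%C * a - a = - ((1 - s n)%:C%C * a) by rewrite rmorphB /=; ring.
    rewrite cmodN cmodM cmodr (le_lt_trans _ Hn)// ler_piMr// ltW//.
  move=> /Hd; rewrite distrC; apply: le_lt_trans.
  by rewrite -ReN -ReD normRe_le_cmod.
apply/esym/EFin_inj; exact: (cvg_unique (@ereal_hausdorff R) H1 H2).
Qed.

End boundary_function.

Section fatou.
Context {R : realType}.
Local Notation C := R[i].
Local Notation Re := complex.Re.
Local Notation Im := complex.Im.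
Local Notation mu := (@lebesgue_measure R).

Lemma ae_poisson_radial_limit (u : R -> R) : bdmeas [set: R] u ->
  {ae mu, forall x, 0 < x < 1 -> forall e : R, 0 < e ->
    exists2 q : R, 0 < q & forall r : R, 0 <= r < 1 -> 1 - r < q ->
    `|\int[mu]_(t in `[0, 1]) (u t * pkernel (r%:C%C * expi x) t) - u x| <= e}.
Proof.
move=> hu; have hloc : locally_integrable [set: R] u.
  split; [exact: hu.1|exact: openT|move=> K _ cK].
  have [B uB] := hu.2.
  apply: (@le_lt_trans _ _ (\int[mu]_(x in K) B%:E)%E).
    apply: ge0_le_integral => //; first exact: compact_measurable.
    - apply/measurable_EFinP; apply: measurableT_comp => //.
      by apply: measurable_funS hu.1.
    - by move=> x _; rewrite lee_fin uB.
  rewrite integral_cst//=; last exact: compact_measurable.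
  have B0 : 0 <= B := le_trans (normr_ge0 _) (uB 0 I).
  apply: lte_mul_pinfty => //; exact: compact_finite_measure.
have := lebesgue_differentiation hloc.
apply: ae_imp => x ux x01 e e0; exact: poisson_radial_limit.
Qed.

Lemma fatou_Re (f : C -> C) (B : R) :
  (forall z, cmod z < 1 -> holo f z) -> (forall z, cmod z < 1 -> cmod (f z) <= B) ->
  exists2 U : R -> R, bdmeas [set: R] U &
  {ae mu, forall x, 0 < x < 1 -> forall e : R, 0 < e ->
    exists2 q : R, 0 < q & forall r : R, 0 <= r < 1 -> 1 - r < q ->
    `|Re (f (r%:C%C * expi x)) - U x| <= e}.
Proof.
move=> hf fB; have [U hU HU] := poisson_boundary_function hf fB.
exists U => //; have := ae_poisson_radial_limit hU; apply: ae_imp => x Hx x01 e e0.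
have [q q0 Hq] := Hx x01 e e0; exists q => // r r01 rq.
rewrite HU; first exact: Hq.
by case/andP: r01 => r0 r1; rewrite cmodM cmodr cmod_expi mulr1 ger0_norm.
Qed.

(** The imaginary part of [f] is the real part of [- 'i * f], which is again bounded and
    analytic. *)
Theorem fatou (f : C -> C) (B : R) :
  (forall z, cmod z < 1 -> holo f z) -> (forall z, cmod z < 1 -> cmod (f z) <= B) ->
  exists U V : R -> R, [/\ bdmeas [set: R] U, bdmeas [set: R] V &
  {ae mu, forall x, 0 < x < 1 -> forall e : R, 0 < e ->
    exists2 q : R, 0 < q & forall r : R, 0 <= r < 1 -> 1 - r < q ->
    cmod (f (r%:C%C * expi x) - (U x +i* V x)%C) <= e}].
Proof.
move=> hf fB; have [U hU HU] := fatou_Re hf fB.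
pose g z := - 'i%C * f z.
have hg z : cmod z < 1 -> holo g z.
  by move=> z1; apply: holoM; [exact: holo_cst|exact: hf].
have gB z : cmod z < 1 -> cmod (g z) <= B.
  by move=> z1; rewrite cmodM cmodN /= expr0n expr1n add0r sqrtr1 mul1r fB.
have [V hV HV] := fatou_Re hg gB.
exists U, V; split => //.
apply: ae_imp2 HU HV => x hx1 hx2 x01 e e0.
have e2 : 0 < e / 2 by rewrite divr_gt0.
have [q1 q10 H1] := hx1 x01 _ e2; have [q2 q20 H2] := hx2 x01 _ e2.
exists (Num.min q1 q2); first by rewrite lt_min q10.
move=> r r01; rewrite lt_min => /andP[rq1 rq2].
rewrite (le_trans (cmod_le_ReIm _))// [leRHS]splitr lerD//.
  by rewrite ReD ReN; exact: H1.
rewrite ImD ImN /=; apply: le_trans (H2 _ r01 rq2); rewrite /g.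
rewrite le_eqVlt; apply/orP; left; apply/eqP; congr (`|_|).
by rewrite !ReImE /=; ring.
Qed.

End fatou.

(** * Outer functions and Jensen's inequality *)

Section complex_integral.
Context {R : realType}.
Local Notation C := R[i].
Local Notation Re := complex.Re.
Local Notation Im := complex.Im.
Local Notation mu := (@lebesgue_measure R).
Implicit Types (g h : R -> C).

Definition cbdmeas g := bdmeas `[0 : R, 1] (fun t => Re (g t)) /\
  bdmeas `[0 : R, 1] (fun t => Im (g t)).

Definition cint g : C := ((\int[mu]_(t in `[0, 1]) Re (g t)) +i*
  (\int[mu]_(t in `[0, 1]) Im (g t)))%C.

Lemma cbdmeasD g h : cbdmeas g -> cbdmeas h -> cbdmeas (fun t => g t + h t).
Proof.
move=> [g1 g2] [h1 h2]; split.
  by apply: eq_bdmeas (bdmeasD g1 h1) => t _; rewrite ReD.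
by apply: eq_bdmeas (bdmeasD g2 h2) => t _; rewrite ImD.
Qed.

Lemma cbdmeasM g h : cbdmeas g -> cbdmeas h -> cbdmeas (fun t => g t * h t).
Proof.
move=> [g1 g2] [h1 h2]; split.
  by apply: eq_bdmeas (bdmeasB (bdmeasM g1 h1) (bdmeasM g2 h2)) => t _; rewrite ReM.
by apply: eq_bdmeas (bdmeasD (bdmeasM g1 h2) (bdmeasM g2 h1)) => t _; rewrite ImM.
Qed.

Lemma cbdmeas_cst (c : C) : cbdmeas (fun=> c).
Proof. by split; exact: bdmeas_cst. Qed.

Lemma cbdmeas_real (u : R -> R) : bdmeas `[0 : R, 1] u -> cbdmeas (fun t => (u t)%:C%C).
Proof. by move=> hu; split => //; exact: bdmeas_cst. Qed.

Lemma cbdmeas_circle (f : C -> C) : (forall z, cmod z = 1 -> holo f z) ->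
  cbdmeas (fun t => f (expi t)).
Proof.
move=> hf; split.
  have := @bdmeas_Re_circle _ 1 f; rewrite normr1 => /(_ hf).
  by apply: eq_bdmeas => t _; rewrite mul1r.
have := @bdmeas_Im_circle _ 1 f; rewrite normr1 => /(_ hf).
by apply: eq_bdmeas => t _; rewrite mul1r.
Qed.

Lemma cintD g h : cbdmeas g -> cbdmeas h -> cint (fun t => g t + h t) = cint g + cint h.
Proof.
move=> [g1 g2] [h1 h2]; apply: complex_eqP; rewrite ReImE /= -itv_intD//;
  by apply: eq_itv_int => t _; rewrite ReImE.
Qed.

Lemma cintZ c g : cbdmeas g -> cint (fun t => c * g t) = c * cint g.
Proof.
move=> [g1 g2]; apply: complex_eqP; rewrite ReImE /=.
  rewrite -!itv_intZ// -itv_intB; [|by apply: bdmeasM => //; exact: bdmeas_cst..].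
  by apply: eq_itv_int => t _; rewrite ReM.
rewrite -!itv_intZ// -itv_intD; [|by apply: bdmeasM => //; exact: bdmeas_cst..].
by apply: eq_itv_int => t _; rewrite ImM.
Qed.

Lemma eq_cint g h : (forall t, g t = h t) -> cint g = cint h.
Proof. by move=> gh; congr (cint _); apply/funext. Qed.

Lemma cmod_cint_le g (K : R) : cbdmeas g -> (forall t, cmod (g t) <= K) ->
  cmod (cint g) <= 2 * K.
Proof.
move=> [g1 g2] gK; rewrite (le_trans (cmod_le_ReIm _))// mulr_natl mulr2n /=.
have -> : K = K * (1 - 0) by rewrite subr0 mulr1.
rewrite lerD//; apply: le_norm_Rintegral_itv => // t _.
  exact: le_trans (normRe_le_cmod _) (gK t).
exact: le_trans (normIm_le_cmod _) (gK t).
Qed.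

End complex_integral.

Section outer_function.
Context {R : realType}.
Local Notation C := R[i].
Local Notation Re := complex.Re.
Local Notation Im := complex.Im.
Local Notation mu := (@lebesgue_measure R).
Variable u : R -> R.
Hypothesis hu : bdmeas [set: R] u.

Let hu01 : bdmeas `[0 : R, 1] u. Proof. exact: bdmeasS hu. Qed.

(** The Herglotz integral: an analytic function whose real part is the Poisson integral of [u]. *)
Definition herglotz (z : C) : C :=
  cint (fun t => (expi t + z) / (expi t - z) * (u t)%:C%C).

Definition outer (z : C) : C := cexp (herglotz z).

Let holo_sub (z w : C) : holo (fun w => w - z) w.
Proof. by apply: holoB; [exact: holo_id|exact: holo_cst]. Qed.

Let sub_neq0 (z w : C) : cmod z < 1 -> cmod w = 1 -> w - z != 0.
Proof.
move=> z1 w1; rewrite -cmod_gt0 (lt_le_trans _ (cmod_sub_ge _ _))// subr_gt0.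
by rewrite w1.
Qed.

Let hk z : cmod z < 1 -> cbdmeas (fun t => (expi t + z) / (expi t - z) * (u t)%:C%C).
Proof.
move=> z1; apply: cbdmeasM; last exact: cbdmeas_real.
apply: (@cbdmeas_circle _ (fun w => (w + z) / (w - z))) => w w1.
apply: holoM; first by apply: holoD; [exact: holo_id|exact: holo_cst].
by apply: (holoV (f := fun w => w - z)); [exact: sub_neq0|exact: holo_sub].
Qed.

Let hm z : cmod z < 1 -> cbdmeas (fun t => expi t / (expi t - z) ^+ 2 * (u t)%:C%C).
Proof.
move=> z1; apply: cbdmeasM; last exact: cbdmeas_real.
apply: (@cbdmeas_circle _ (fun w => w / (w - z) ^+ 2)) => w w1.
apply: holoM; first exact: holo_id.
apply: (holoV (f := fun w => (w - z) ^+ 2)); first by rewrite expf_neq0// sub_neq0.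
by apply: (holoM (f := fun w => w - z) (g := fun w => w - z)); exact: holo_sub.
Qed.

(** Differentiation under the integral, with the remainder computed exactly: it is [G], which
    carries a factor [h ^+ 2] and denominators bounded away from [0] uniformly in [t]. *)
Lemma holo_herglotz z : cmod z < 1 -> holo herglotz z.
Proof.
move=> z1; have [M uM] := hu.2.
have M0 : 0 <= M := le_trans (normr_ge0 _) (uM 0 I).
pose L := cint (fun t => expi t / (expi t - z) ^+ 2 * (u t)%:C%C).
pose d := 1 - cmod z; have d0 : 0 < d by rewrite subr_gt0.
have et t : d <= cmod (expi t - z).
  by rewrite (le_trans _ (cmod_sub_ge _ _))// cmod_expi.
(* The denominators of [G] are at least [d], [d] and [d / 2], and its numerator has a factor [2];
   one more [2] comes from bounding real and imaginary parts separately in [cmod_cint_le]. *)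
pose K := 8 * M / d ^+ 3.
have K0 : 0 <= K by rewrite divr_ge0 ?exprn_ge0 ?mulr_ge0// ltW.
apply/holoP; exists (2 * L) => e e0.
have K1 : 0 < K + 1 by rewrite ltr_wpDl.
exists (Num.min (d / 2) (e / (K + 1))); first by rewrite lt_min !divr_gt0.
move=> h; rewrite lt_min => /andP[hd he].
have zh1 : cmod (z + h) < 1.
  rewrite (le_lt_trans (cmodD _ _))//; rewrite /d in hd; lra.
have eth t : d / 2 <= cmod (expi t - (z + h)).
  have -> : expi t - (z + h) = (expi t - z) - h by ring.
  rewrite (le_trans _ (cmod_sub_ge _ _))//; have := et t; lra.
pose G t := 2 * h ^+ 2 * (expi t / ((expi t - z) ^+ 2 * (expi t - (z + h))) * (u t)%:C%C).
have ez t : expi t - z != 0 by rewrite -cmod_gt0 (lt_le_trans d0).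
have ezh t : expi t - (z + h) != 0 by rewrite -cmod_gt0 (lt_le_trans _ (eth t))// divr_gt0.
have hG : cbdmeas G.
  apply: cbdmeasM; first exact: cbdmeas_cst.
  apply: cbdmeasM; last exact: cbdmeas_real.
  apply: (@cbdmeas_circle _ (fun w => w / ((w - z) ^+ 2 * (w - (z + h))))) => w w1.
  apply: holoM; first exact: holo_id.
  apply: (holoV (f := fun w => (w - z) ^+ 2 * (w - (z + h)))).
    by rewrite mulf_neq0// ?expf_neq0// sub_neq0.
  apply: (holoM (f := fun w => (w - z) ^+ 2)); last exact: holo_sub.
  by apply: (holoM (f := fun w => w - z) (g := fun w => w - z)); exact: holo_sub.
have -> : herglotz (z + h) - herglotz z - 2 * L * h = cint G.
  suff -> : herglotz (z + h) = herglotz z + ((2 * h) * L + cint G) by ring.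
  rewrite /herglotz /L -cintZ; last exact: hm.
  rewrite -cintD//; last by apply: cbdmeasM; [exact: cbdmeas_cst|exact: hm].
  rewrite -cintD; [|exact: hk|]; last first.
    by apply: cbdmeasD => //; apply: cbdmeasM; [exact: cbdmeas_cst|exact: hm].
  apply: eq_cint => t; rewrite /G; field.
  by apply/andP; split; [exact: ezh|exact: ez].
have GK t : cmod (G t) <= K / 2 * cmod h ^+ 2.
  rewrite /G cmodM cmodM (cmodM (expi t / _)) cmodr cmodM cmod_expi mul1r cmodV cmodM.
  rewrite !expr2 !cmodM.
  have -> : cmod (2 : C) = 2 by have := @cmodr R 2; rewrite ger0_norm// => <-; congr cmod; rewrite rmorph_nat.
  have D0 : 0 < cmod (expi t - z) by rewrite (lt_le_trans d0).
  have D1 : 0 < cmod (expi t - (z + h)) by rewrite (lt_le_trans _ (eth t))// divr_gt0.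
  have -> : K / 2 * (cmod h * cmod h) = 2 * (cmod h * cmod h) * ((d * d * (d / 2))^-1 * M).
    by rewrite /K; field; rewrite gt_eqF.
  rewrite ler_wpM2l//; first by rewrite !mulr_ge0 ?cmod_ge0.
  apply: ler_pM => //; last exact: uM.
    by rewrite invr_ge0 !mulr_ge0 ?cmod_ge0.
  rewrite lef_pV2 ?posrE ?mulr_gt0 ?divr_gt0//.
  by rewrite ler_pM ?mulr_ge0 ?divr_ge0 ?(ltW d0)// ler_pM ?(ltW d0).
rewrite (le_trans (cmod_cint_le hG GK))//.
have -> : 2 * (K / 2 * cmod h ^+ 2) = K * cmod h * cmod h by field.
rewrite ler_wpM2r ?cmod_ge0//.
rewrite (@le_trans _ _ ((K + 1) * cmod h))// ?ler_wpM2r ?cmod_ge0 ?lerDl//.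
by rewrite mulrC -ler_pdivlMr// ltW.
Qed.

Lemma holo_outer z : cmod z < 1 -> holo outer z.
Proof. by move=> z1; apply: holo_comp; [exact: holo_cexp|exact: holo_herglotz]. Qed.

Lemma cmod_outer z : cmod z < 1 ->
  cmod (outer z) = expR (\int[mu]_(t in `[0, 1]) (u t * pkernel z t)).
Proof.
move=> z1; rewrite cmod_cexp; congr expR; apply: eq_itv_int => t _.
by rewrite pkernelE; set k := _ / _; rewrite ReM /= mulr0 subr0 mulrC.
Qed.

Lemma outer0 : outer 0 = (expR (\int[mu]_(t in `[0, 1]) u t))%:C%C.
Proof.
have H0 : herglotz 0 = (\int[mu]_(t in `[0, 1]) u t)%:C%C.
  have E t : (expi t + 0) / (expi t - 0) * (u t)%:C%C = (u t)%:C%C.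
    by rewrite addr0 subr0 divff ?mul1r// expi_neq0.
  rewrite /herglotz (eq_cint E); apply: complex_eqP => //=.
  by rewrite Rintegral_itv_cst// mul0r.
by rewrite /outer H0 /cexp /= cos0 sin0 mulr1 mulr0.
Qed.

Lemma outer_bounded (M : R) z : (forall t, `|u t| <= M) -> cmod z < 1 ->
  cmod (outer z) <= expR M.
Proof.
move=> uM z1; rewrite cmod_outer// ler_expR.
have hp := bdmeas_pkernel z1.
rewrite (@le_trans _ _ (\int[mu]_(t in `[0, 1]) (M * pkernel z t)))//.
  apply: le_itv_int; [exact: bdmeasM|by apply: bdmeasM => //; exact: bdmeas_cst|].
  by move=> t _; rewrite ler_wpM2r ?pkernel_ge0// (le_trans (ler_norm _)).
by rewrite itv_intZ// int_pkernel// mulr1.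
Qed.

(** Only the modulus is followed: it is the exponential of a Poisson integral, whereas the argument
    involves the conjugate function of [u], which may be unbounded. *)
Lemma outer_radial_limit : {ae mu, forall x, 0 < x < 1 -> forall e : R, 0 < e ->
    exists2 q : R, 0 < q & forall r : R, 0 <= r < 1 -> 1 - r < q ->
    `|cmod (outer (r%:C%C * expi x)) - expR (u x)| <= e}.
Proof.
have := ae_poisson_radial_limit hu; apply: ae_imp => x Hx x01 e e0.
have /cvgrPdist_le/(_ _ e0)/nbhs_ballP[d d0' Hd] := @continuous_expR R (u x).
have d0 : 0 < d by [].
have d2 : 0 < d / 2 by rewrite divr_gt0.
have [q q0 Hq] := Hx x01 _ d2; exists q => // r r01 rq.
rewrite cmod_outer; last first.
  by case/andP: r01 => r0 r1; rewrite cmodM cmodr cmod_expi mulr1 ger0_norm.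
rewrite distrC; apply: Hd; rewrite /ball /= distrC (le_lt_trans (Hq _ r01 rq))//; lra.
Qed.

End outer_function.

Lemma ae_unit_itv_interior {R : realType} :
  {ae (@lebesgue_measure R), forall t, `[0 : R, 1]%classic t -> 0 < t < 1}.
Proof.
exists [set 0; 1]; split.
- exact: measurableU.
- apply: countable_lebesgue_measure0; apply: finite_set_countable; exact: finite_set2.
- move=> t /= H; have [->|t0] := eqVneq t 0; first by left.
  have [->|t1] := eqVneq t 1; first by right.
  exfalso; apply: H; rewrite in_itv /= => /andP[t0' t1'].
  by rewrite !lt_def t0 t0' eq_sym t1 t1'.
Qed.

Section jensen.
Context {R : realType}.
Local Notation C := R[i].
Local Notation Re := complex.Re.
Local Notation Im := complex.Im.
Local Notation mu := (@lebesgue_measure R).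

Lemma cvg_of_radial (f : R -> R) (l : R) :
  (forall e : R, 0 < e -> exists2 q : R, 0 < q & forall r : R, 0 <= r < 1 -> 1 - r < q ->
    `|f r - l| <= e) ->
  (fun n => f (1 - n.+1%:R^-1)) @ \oo --> l.
Proof.
move=> H; apply/cvgrPdist_le => e /H[q q0 Hq]; near=> n.
rewrite distrC; apply: Hq.
  by rewrite subr_ge0 invf_le1 ?ltr0n// ler1n/= gtrBl invr_gt0 ltr0n.
rewrite opprB addrC subrK.
have h : q^-1 < n%:R by near: n; exact: nbhs_infty_gtr.
by rewrite invf_plt ?posrE// (lt_trans h)// ltr_nat.
Unshelve. all: by end_near. Qed.

Lemma measurable_sqrtr : measurable_fun [set: R] (@Num.sqrt R).
Proof. exact: (continuous_measurable_fun (@sqrt_continuous R)). Qed.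

Lemma measurable_cmod d (T : measurableType d) (D : set T) (g : T -> C) :
  measurable_fun D (fun t => Re (g t)) -> measurable_fun D (fun t => Im (g t)) ->
  measurable_fun D (fun t => cmod (g t)).
Proof.
move=> mU mV.
have -> : (fun t => cmod (g t)) = (fun t => Num.sqrt (Re (g t) * Re (g t) + Im (g t) * Im (g t))).
  by apply/funext => t; rewrite cmodE /= !expr2.
apply: (measurableT_comp measurable_sqrtr); apply: measurable_funD; exact: measurable_funM.
Qed.

Lemma bdmeas_cmod d (T : measurableType d) (D : set T) (g : T -> C) :
  bdmeas D (fun t => Re (g t)) -> bdmeas D (fun t => Im (g t)) ->
  bdmeas D (fun t => cmod (g t)).
Proof.
move=> [mU [A UA]] [mV [B VB]]; split; first exact: measurable_cmod.
exists (A + B) => t Dt; rewrite ger0_norm ?cmod_ge0// (le_trans (cmod_le_ReIm _))//=.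
by rewrite lerD ?UA ?VB.
Qed.

(** The shift by [e] bounds the logarithm from below, which keeps the regularised integrals real. *)
Lemma bdmeas_ln d (T : measurableType d) (D : set T) (g : T -> R) (e : R) : 0 < e ->
  bdmeas D g -> (forall t, 0 <= g t) -> bdmeas D (fun t => ln (g t + e)).
Proof.
move=> e0 [mg [B gB]] g0; split.
  by apply: (measurableT_comp (@measurable_ln R)); exact: measurable_funD.
exists (Num.max `|ln e| `|ln (B + e)|) => t Dt.
have Bt : g t <= B by rewrite (le_trans (ler_norm _))// gB.
have B0 : 0 <= B := le_trans (g0 t) Bt.
have l1 : ln e <= ln (g t + e) by rewrite ler_ln ?posrE ?lerDr// ltr_wpDl.
have l2 : ln (g t + e) <= ln (B + e) by rewrite ler_ln ?posrE ?lerD2r// ltr_wpDl.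
rewrite le_max; have [h|h] := leP 0 (ln (g t + e)).
  by rewrite (ger0_norm h) (le_trans l2 (ler_norm _)) orbT.
by rewrite (ltr0_norm h) (@le_trans _ _ (- ln e)) ?lerN2// -normrN ler_norm.
Qed.

Variables (f : C -> C) (B : R) (U V : R -> R).
Hypothesis hf : forall z, cmod z < 1 -> holo f z.
Hypothesis fB : forall z, cmod z < 1 -> cmod (f z) <= B.
Hypotheses (hU : bdmeas [set: R] U) (hV : bdmeas [set: R] V).
Hypothesis radial : {ae mu, forall x, 0 < x < 1 -> forall e : R, 0 < e ->
    exists2 q : R, 0 < q & forall r : R, 0 <= r < 1 -> 1 - r < q ->
    cmod (f (r%:C%C * expi x) - (U x +i* V x)%C) <= e}.

(* [outer u] with [exp u = 1 / (|f| + e)] on the circle makes the product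
   [f * outer u] bounded by [1] on the circle, hence at the origin. *)
Lemma jensen (e : R) : 0 < e ->
  cmod (f 0) <= expR (\int[mu]_(t in `[0, 1]) ln (cmod (U t +i* V t)%C + e)).
Proof.
move=> e0; pose m t := cmod (U t +i* V t)%C.
have m0 t : 0 <= m t by exact: cmod_ge0.
have hm : bdmeas [set: R] m by exact: bdmeas_cmod.
have hl : bdmeas [set: R] (fun t => ln (m t + e)) by exact: bdmeas_ln.
pose u t := - ln (m t + e).
have hu : bdmeas [set: R] u by exact: bdmeasN.
have [M uM] := hu.2.
pose g z := f z * outer u z.
have hg z : cmod z < 1 -> holo g z.
  by move=> z1; apply: holoM; [exact: hf|exact: holo_outer].
have B0 : 0 <= B by apply: le_trans (fB (z := 0) _); rewrite ?cmod_ge0// Normc.normc0.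
have gB z : cmod z < 1 -> cmod (g z) <= B * expR M.
  move=> z1; rewrite cmodM ler_pM ?cmod_ge0 ?fB//.
  by apply: outer_bounded => // t; exact: uM.
have hl01 : bdmeas `[0 : R, 1] (fun t => ln (m t + e)) by exact: bdmeasS hl.
suff H : cmod (g 0) <= 1.
  move: H; rewrite /g cmodM outer0 cmodr (gtr0_norm (expR_gt0 _)).
  have -> : \int[mu]_(t in `[0, 1]) u t = - \int[mu]_(t in `[0, 1]) ln (m t + e).
    rewrite -[RHS]mulN1r -itv_intZ//; by apply: eq_itv_int => t _; rewrite mulN1r.
  by rewrite expRN -ler_pdivlMr ?invr_gt0 ?expR_gt0// invrK mul1r.
pose s (n : nat) : R := 1 - n.+1%:R^-1.
have s01 n : 0 <= s n < 1.
  by rewrite subr_ge0 invf_le1 ?ltr0n// ler1n/= gtrBl invr_gt0 ltr0n.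
have cs n t : cmod ((s n)%:C%C * expi t) = s n.
  by case/andP: (s01 n) => r0 _; rewrite cmodM cmodr cmod_expi mulr1 ger0_norm.
have hgn n : bdmeas `[0 : R, 1] (fun t => cmod (g ((s n)%:C%C * expi t))).
  have [s0 s1] := andP (s01 n).
  have h z : cmod z = `|s n| -> holo g z.
    by move=> zs; apply: hg; rewrite zs ger0_norm.
  exact: bdmeas_cmod (bdmeas_Re_circle h) (bdmeas_Im_circle h).
have up n : cmod (g 0) <= \int[mu]_(t in `[0, 1]) cmod (g ((s n)%:C%C * expi t)).
  have [s0 s1] := andP (s01 n).
  have [->|g0] := eqVneq (g 0) 0.
    by rewrite Normc.normc0; apply: Rintegral_ge0 => t _; exact: cmod_ge0.
  have c0 : 0 < cmod (g 0) by rewrite cmod_gt0.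
  (* A constant of modulus [1] that rotates [g 0] onto its modulus, so that the mean value property
     for [Re (l * g)] bounds [cmod (g 0)]. *)
  pose l := ((g 0)^*)%C / (cmod (g 0))%:C%C.
  have cC : (cmod (g 0))%:C%C != 0 :> C by rewrite -cmod_gt0 cmodr gtr0_norm.
  have l1 : cmod l = 1 by rewrite cmodM cmodV cmod_conj cmodr gtr0_norm// divff// gt_eqF.
  pose k z := l * g z.
  have hk z : cmod z <= s n -> holo k z.
    move=> zs; apply: holoM; first exact: holo_cst.
    by apply: hg; exact: le_lt_trans s1.
  have := @circle_mean_center _ k (s n) s0 hk.
  have -> : Re (k 0) = cmod (g 0).
    rewrite /k /l; have -> : ((g 0)^*)%C / (cmod (g 0))%:C%C * g 0 =
      g 0 * ((g 0)^*)%C / (cmod (g 0))%:C%C by ring.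
    by rewrite -cmod_sqr_conj expr2 rmorphM mulfK.
  move=> <-; apply: le_itv_int => //.
    apply: (@bdmeas_Re_circle _ (s n) k) => z zs; apply: hk.
    by rewrite zs ger0_norm.
  move=> t _; rewrite (le_trans (ler_norm _))// (le_trans (normRe_le_cmod _))//.
  by rewrite cmodM l1 mul1r.
have hlim : bdmeas `[0 : R, 1] (fun t => m t * expR (u t)).
  apply: bdmeasM; first exact: bdmeasS hm.
  apply: (@bdmeasS _ _ _ [set: R]) => //; split.
    apply: (measurableT_comp (@measurable_expR R)); exact: hu.1.
  exists (expR M) => t _; rewrite gtr0_norm ?expR_gt0// ler_expR (le_trans (ler_norm _))//.
  exact: uM.
have le1 t : m t * expR (u t) <= 1.
  have me0 : 0 < m t + e by rewrite ltr_wpDl.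
  rewrite /u expRN lnK//; first by rewrite ler_pdivrMr// mul1r lerDl ltW.
have aecv : {ae mu, forall t, `[0 : R, 1]%classic t ->
    (fun n => cmod (g ((s n)%:C%C * expi t))) @ \oo --> m t * expR (u t)}.
  have := outer_radial_limit hu.
  move=> ho; have rh := ae_imp2 (fun x h1 h2 => conj h1 h2) radial ho.
  apply: ae_imp2 rh (@ae_unit_itv_interior R).
  move=> t [h1 h2] + tI => /(_ tI) t01.
  have E : (fun n => cmod (g ((s n)%:C%C * expi t))) =
     (fun n => cmod (f ((s n)%:C%C * expi t)) * cmod (outer u ((s n)%:C%C * expi t))).
    by apply/funext => n; rewrite cmodM.
  rewrite E; apply: cvgM.
    apply: (cvg_of_radial (f := fun r => cmod (f (r%:C%C * expi t)))) => d d0.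
    have [q q0 Hq] := h1 t01 d d0; exists q => // r r01 rq.
    apply: le_trans (Hq r r01 rq); rewrite ler_norml cmod_sub_ge andbT.
    by rewrite lerNl opprB cmodB cmod_sub_ge.
  by apply: (cvg_of_radial (f := fun r => cmod (outer u (r%:C%C * expi t)))); exact: h2.
have intE h : bdmeas `[0 : R, 1] h -> (\int[mu]_(t in `[0%R, 1%R]) (h t)%:E = (\int[mu]_(t in `[0, 1]) h t)%:E)%E.
  by move=> hh; rewrite /Rintegral fineK//; exact: (integrable_fin_num _ (itv_integrable hh)).
have [] := @dominated_convergence _ _ _ mu `[0 : R, 1]%classic (measurable_itv _)
  (fun n t => (cmod (g ((s n)%:C%C * expi t)))%:E) (fun t => (m t * expR (u t))%:E)
  (fun t => (B * expR M)%:E).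
- by move=> n; apply/measurable_EFinP; exact: (hgn n).1.
- by apply/measurable_EFinP; exact: hlim.1.
- apply: ae_imp aecv => t Ht t01; apply: cvg_EFin; first exact: nearW.
  exact: Ht.
- by apply: itv_integrable; exact: bdmeas_cst.
- apply: aeW => t n _; rewrite lee_fin ger0_norm ?cmod_ge0// gB// cs.
  by case/andP: (s01 n).
move=> _ _ Hc.
rewrite -lee_fin; apply: (@le_trans _ _ (\int[mu]_(t in `[0%R, 1%R]) (m t * expR (u t))%:E)%E).
  have <- := cvg_lim (@ereal_hausdorff R) Hc.
  apply: lime_ge; first by apply/cvg_ex; eexists; exact: Hc.
  apply: nearW => n.
  suff : ((cmod (g 0))%:E <= (\int[mu]_(t in `[0, 1]) cmod (g ((s n)%:C%C * expi t)))%:E)%E.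
    by rewrite -intE.
  by rewrite lee_fin up.
rewrite intE// lee_fin.
have E1 : \int[mu]_(t in `[0, 1]) 1 = 1 :> R by rewrite Rintegral_itv_cst// subr0 mulr1.
rewrite -[leRHS]E1; by apply: le_itv_int => //; exact: bdmeas_cst.
Qed.

End jensen.

(** * Lebesgue measure on the circle *)

Section circle_argument.
Context {R : realType}.
Local Notation C := R[i].
Local Notation mu := (@lebesgue_measure R).
Local Notation T := (circle R).

Lemma expi_nat (n : nat) : expi (n%:R : R) = 1.
Proof.
elim: n => [|n IH]; first exact: expi0.
by rewrite -natr1 expiD IH expi1 mulr1.
Qed.

Lemma expi_int (k : int) : expi (k%:~R : R) = 1.
Proof.
case: k => n; first exact: expi_nat.
have := @expiD R (Negz n)%:~R n.+1%:R; rewrite expi_nat mulr1 => <-.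
by rewrite NegzE rmorphN addNr expi0.
Qed.

Definition fracr (t : R) : R := t - (Num.floor t)%:~R.

Lemma fracr_itv (t : R) : 0 <= fracr t < 1.
Proof.
have /andP[l1 l2] := floor_itv t; rewrite /fracr subr_ge0 l1/= ltrBlDl.
by rewrite intrD addrC in l2; rewrite addrC.
Qed.

Lemma expi_fracr t : expi (fracr t) = expi t.
Proof.
by have := expiD (fracr t) (Num.floor t)%:~R; rewrite expi_int mulr1 subrK.
Qed.

Lemma expi_inj (t t' : R) : 0 <= t < 1 -> 0 <= t' < 1 -> expi t = expi t' -> t = t'.
Proof.
wlog tt' : t t' / t < t' => [H h h' e|].
  case: (ltgtP t t') => // l; first exact: H.
  by apply/esym; apply: H.
move=> /andP[t0 t1] /andP[t'0 t'1] e; exfalso.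
have : 0 < cmod (expi (t' - t) - 1).
  by apply: expi_neq1; rewrite subr_gt0 tt'/= ltrBlDr ltr_wpDr.
suff -> : expi (t' - t) = 1 by rewrite subrr Normc.normc0 ltxx.
by apply: (mulIf (expi_neq0 t)); rewrite -expiD subrK mul1r.
Qed.

Lemma expi_surj (z : C) : cmod z = 1 -> exists t, expi t = z.
Proof.
have pos (a b : R) : 0 <= b -> a ^+ 2 + b ^+ 2 = 1 -> expi (acos a / (2 * pi)) = (a +i* b)%C.
  move=> b0 ab.
  have a1 : -1 <= a <= 1 by rewrite -ler_norml -(@expr_le1 _ 2)// real_normK ?num_real// -ab lerDl sqr_ge0.
  have p0 : 2 * pi != 0 :> R by rewrite mulf_neq0 ?pnatr_eq0 ?gt_eqF ?pi_gt0.
  rewrite /expi [2 * pi * _]mulrC mulfVK//.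
  rewrite acosK ?in_itv//= sin_acos//; congr (_ +i* _)%C.
  by rewrite -ab addrAC subrr add0r sqrtr_sqr ger0_norm.
move=> z1; have : cmod z ^+ 2 = 1 by rewrite z1 expr1n.
rewrite cmod_sqr; case: z {z1} => a b /= ab.
have [b0|b0] := leP 0 b; first by exists (acos a / (2 * pi)); exact: pos.
exists (- (acos a / (2 * pi))).
have := @pos a (- b); rewrite sqrrN oppr_ge0 => /(_ (ltW b0) ab).
by rewrite /expi mulrN cosN sinN => -[-> ->]; rewrite opprK.
Qed.

(** An inverse of [circle_param] on [[0, 1[]: [xget] picks some preimage, which exists by
    [expi_surj], and [fracr] makes the choice canonical. *)
Definition carg (g : T) : R := fracr (xget 0 [set t | expi t = circle_val g]).

Lemma carg_itv g : 0 <= carg g < 1. Proof. exact: fracr_itv. Qed.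

Lemma expi_carg g : expi (carg g) = circle_val g.
Proof.
rewrite /carg expi_fracr; apply: (@xgetPex _ 0 [set t | expi t = circle_val g]).
apply: expi_surj; have /eqP := valP g.
by rewrite -[\val g]/(circle_val g) normc_cmod => -[].
Qed.

Lemma carg_param (t : R) : carg (circle_param t) = fracr t.
Proof.
apply: expi_inj; rewrite ?carg_itv ?fracr_itv//.
by rewrite expi_carg expi_fracr.
Qed.

Lemma fracr_id t : 0 <= t < 1 -> fracr t = t.
Proof. by move=> h; apply: expi_inj; rewrite ?fracr_itv ?expi_fracr. Qed.

Lemma circle_paramK g : circle_param (carg g) = g.
Proof. by apply: val_inj; exact: expi_carg. Qed.

Lemma measurable_fracr : measurable_fun [set: R] fracr.
Proof.
apply: measurable_funB => //; apply: nondecreasing_measurable => //.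
by move=> x y xy; rewrite ler_int; exact: le_floor.
Qed.

Lemma measurable_carg : measurable_fun [set: T] carg.
Proof.
move=> _ Y mY; rewrite setTI; rewrite /measurable/= /circle_measurable /image_set_system/= setTI.
apply: sub_caratheodory.
have e : @circle_param R @^-1` (carg @^-1` Y) = (fracr : lebesgueR R -> R) @^-1` Y.
  by apply/seteqP; split => t /=; rewrite carg_param.
by rewrite e; have := measurable_fracr measurableT mY; rewrite setTI.
Qed.

Lemma circle_mu_carg (Y : set R) : measurable Y ->
  circle_mu (carg @^-1` Y) = mu (Y `&` `[0, 1[).
Proof.
move=> mY; rewrite /circle_mu /pushforward/= /unit_lebesgue/= /mrestr/=.
have e : @circle_param R @^-1` (carg @^-1` Y) `&` `[0 : R, 1[ =
    (Y `&` `[0, 1[ : set (lebesgueR R)).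
  apply/seteqP; split => t [/= Yt t01]; have h : 0 <= (t : R) < 1 by [];
  by split => //=; move: Yt; rewrite carg_param (fracr_id h).
by rewrite e.
Qed.

Lemma bdmeas_carg (g : R -> R) : bdmeas [set: R] g -> bdmeas [set: T] (g \o carg).
Proof.
move=> [mg [B gB]]; split; first exact: (measurableT_comp mg measurable_carg).
by exists B => t _; exact: gB.
Qed.

(** The image of the circle measure under [carg] is Lebesgue measure on [[0, 1[]. *)
Lemma circle_int_carg (g : R -> R) : bdmeas [set: R] g ->
  \int[@circle_mu R]_x g (carg x) = \int[mu]_(t in `[0, 1]) g t.
Proof.
move=> hg; have hg01 : mu.-integrable `[0 : R, 1[%classic (EFin \o g).
  apply: bdmeas_integrable; last exact: bdmeasS hg.
    exact: measurable_itv.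
  by rewrite [ltLHS]lebesgue_measure_itv/= lte_fin ltr01 oppr0 adde0 ltry.
rewrite -Rintegral_itv_bndo_bndc// /Rintegral; congr fine.
pose D : set R := `[0, 1[%classic.
have cD : carg @^-1` D = [set: T].
  by apply/seteqP; split => // x _ /=; rewrite /D/= in_itv/= carg_itv.
have mg : measurable_fun [set: R] (EFin \o g) by apply/measurable_EFinP; exact: hg.1.
have ig : (@circle_mu R).-integrable (carg @^-1` D) ((EFin \o g) \o carg).
  rewrite cD; apply: bdmeas_integrable (bdmeas_carg hg); first exact: measurableT.
  by rewrite [ltLHS]probability_setT ltry.
have mD : measurable D by exact: measurable_itv.
have E := @integral_pushforward _ _ _ (measurableTypeR R) _ _ measurable_carg
  (@circle_mu R) _ _ mg ig mD.
rewrite cD in E; etransitivity; first exact: (esym E).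
pose nu : {measure set (measurableTypeR R) -> \bar R} :=
  pushforward (@circle_mu R) (carg : T -> measurableTypeR R).
refine (@eq_measure_integral _ (measurableTypeR R) R D mu (nu measurable_carg) (EFin \o g) _).
move=> A mA AD.
etransitivity; first exact: (circle_mu_carg mA).
by congr (mu _); apply/seteqP; split => [t []//|t At]; split => //; exact: AD.
Qed.

Lemma ae_carg (P : R -> Prop) : {ae mu, forall t, 0 < t < 1 -> P t} ->
  {ae (@circle_mu R), forall x, P (carg x)}.
Proof.
move=> [A [mA A0 PA]].
(* The property is known only for [0 < t < 1], so the point of argument [0] joins the exceptional
   set. *)
exists (carg @^-1` (A `|` [set 0])); split.
- rewrite -[X in measurable X]setTI; apply: measurable_carg => //.
  exact: measurableU.
- rewrite circle_mu_carg; last exact: measurableU.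
  apply/eqP; rewrite eq_le measure_ge0 andbT.
  apply: (@le_trans _ _ (mu (A `|` [set 0]))).
    apply: le_measure; rewrite ?inE; [apply: measurableI => //|exact: measurableU|exact: subIsetl].
    exact: measurableU.
  by rewrite (null_set_setU mA (measurable_set1 (0 : R)) A0 (lebesgue_measure_set1 0)).
- move=> x /= nP; have /andP[c0 c1] := carg_itv x.
  have [e|n0] := eqVneq (carg x) 0; first by right.
  by left; apply: PA => /= h; apply: nP; apply: h; rewrite lt_def n0 c0.
Qed.


Lemma lebesgue_measurableE (A : set (lebesgueR R)) : measurable A ->
  exists B : set R, exists2 N : set R, measurable B &
    [/\ measurable N, mu N = 0 & forall t, ~ N t -> (A t <-> B t)].
Proof.
move=> mA; have : (completed_algebra_gen mu).-sigma.-measurable (A : set R).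
  by rewrite completed_caratheodory_measurable; exact: mA.
rewrite g_sigma_completed_algebra_genE => -[B mB [N0 [N [mN N0' sN]]] <-]; exists B; exists N => //; split => // t nN.
by split => [[//|/sN]//|]; left.
Qed.

(** Functions on the circle are Lebesgue measurable, while the integrals on the line use Borel ones.
    The sets where [h] exceeds a rational are countably many; each agrees with a Borel set off a
    null set, and [h] is set to [0] on the union of these null sets. *)
Lemma borel_representative (f : T -> R) : bdmeas [set: T] f ->
  exists2 g : R -> R, bdmeas [set: R] g &
    {ae (@circle_mu R), forall x, f x = g (carg x)}.
Proof.
move=> [mf [K fK]]; pose h (t : R) := f (circle_param t).
have hA (q : rat) : exists BN : set R * set R, [/\ measurable BN.1, measurable BN.2,
    mu BN.2 = 0 & forall t, ~ BN.2 t -> (h t > ratr q <-> BN.1 t)].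
  have mA : measurable ((h : lebesgueR R -> R) @^-1` [set y | ratr q < y]).
    have mr : measurable [set y : R | ratr q < y].
      by have := measurable_itv `]ratr q : R, +oo[; rewrite set_itvE.
    have := mf measurableT _ mr; rewrite setTI => mfr.
    by have := @measurable_circle_param R measurableT _ mfr; rewrite setTI.
  have [B [N mB [mN N0 BN]]] := lebesgue_measurableE mA.
  by exists (B, N); split.
have [BN hBN] := choice hA.
(* The rationals are enumerated by [unpickle]; indices that code none default to [0] and only repeat
   a set of the union. *)
pose N := \bigcup_(n : nat) (BN (odflt 0 (unpickle n))).2.
have mN : measurable N.
  by apply: bigcup_measurable => n _; case: (hBN (odflt 0 (unpickle n))).
have N0 : mu N = 0.
  apply: measure_negligible => //; apply: negligible_bigcup => n.
  have [_ m2 n2 _] := hBN (odflt 0 (unpickle n)).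
  by exists (BN (odflt 0 (unpickle n))).2; split.
have nN (q : rat) t : ~ N t -> (h t > ratr q <-> (BN q).1 t).
  move=> Nt; have [_ _ _] := hBN q; apply => H; apply: Nt; exists (pickle q) => //.
  by rewrite pickleK.
pose g t := h t * \1_(~` N) t.
have gN t : N t -> g t = 0 by move=> Nt; rewrite /g indicE memNset ?mulr0// => /(_ Nt).
have gnN t : ~ N t -> g t = h t by move=> Nt; rewrite /g indicE mem_set ?mulr1.
exists g; first split.
- apply: (measurability _ (RGenOInfty.measurableE R)) => _ [_ [a ->] <-].
  (* Off [N] a value exceeds [a] exactly when it exceeds some rational [q >= a]; on [N] the value is
     [0], so [N] belongs to the set exactly when [a < 0]. *)
  have -> : setT `&` g @^-1` `]a, +oo[%classic = (\bigcup_(n : nat)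
      (if a <= ratr (odflt 0 (unpickle n)) then (BN (odflt 0 (unpickle n))).1 `\` N
       else set0)) `|` (if a < 0 then N else set0).
    apply/seteqP; split => t /=.
      move=> [_]; rewrite in_itv/= andbT; have [Nt|Nt] := pselect (N t).
        by rewrite gN// => ->; right.
      rewrite gnN// => /rat_in_itvoo[q]; rewrite in_itv/= => /andP[aq qh].
      left; exists (pickle q) => //; rewrite pickleK/= (ltW aq); split => //.
      exact/(nN q t Nt).
    move=> [[n _]|]; last first.
      by case: ifPn => // a0 Nt; split => //; rewrite in_itv/= andbT gN.
    case: ifPn => // an [Bt Nt]; split => //; rewrite in_itv/= andbT gnN//.
    by apply: (le_lt_trans an); apply/(nN _ t Nt).
  apply: measurableU; last by case: ifP.
  apply: bigcup_measurable => n _; case: ifP => // _.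
  by apply: measurableD => //; case: (hBN (odflt 0 (unpickle n))).
- exists K => t _; have [Nt|Nt] := pselect (N t).
    by rewrite (gN _ Nt) normr0; have := fK (circle_param (0:R)) I; apply: le_trans.
  by rewrite gnN//; exact: fK.
have H : {ae mu, forall t, 0 < t < 1 -> f (circle_param t) = g t}.
  exists N; split => // t /= H; apply: contrapT => Nt; apply: H => _.
  by rewrite gnN.
by apply: ae_imp (ae_carg H) => x <-; rewrite circle_paramK.
Qed.

End circle_argument.

(** * Norms on the coordinate space *)

Section norms.
Context {R : realType} {N : nat}.
Local Notation C := R[i].
Local Notation Re := complex.Re.
Local Notation Im := complex.Im.
Local Notation V := 'rV[C]_N.
Implicit Types (p : V -> R) (x y : V).

Lemma complex_norm0 p : complex_norm p -> p 0 = 0.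
Proof. by move=> [_ hZ _]; rewrite -(scale0r (0 : V)) hZ Normc.normc0 mul0r. Qed.

Lemma complex_normN p : complex_norm p -> forall x, p (- x) = p x.
Proof. by move=> [_ hZ _] x; rewrite -scaleN1r hZ cmodN Normc.normc1 mul1r. Qed.

Lemma complex_norm_ge0 p : complex_norm p -> forall x, 0 <= p x.
Proof.
move=> hp x; have := complex_normD hp x (- x).
rewrite subrr complex_norm0// complex_normN// -mulr2n => h.
by rewrite -(pmulrn_lge0 (p x) (n := 2)).
Qed.

Lemma complex_normB_le p : complex_norm p -> forall x y, p x <= p y + p (x - y).
Proof. by move=> hp x y; have := complex_normD hp y (x - y); rewrite addrC subrK. Qed.

Lemma complex_norm_sum p : complex_norm p ->
  forall x, p x <= \sum_(k < N) cmod (x 0 k) * p (basis_vector R k).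
Proof.
move=> hp x; rewrite {1}(row_sum_delta x).
apply: (big_ind2 (fun u v => p u <= v)) => [|u a v b ua vb|k _].
- by rewrite complex_norm0.
- by rewrite (le_trans (complex_normD hp _ _))// lerD.
- by rewrite (complex_normZ hp).
Qed.

(** Rounding to a grid of mesh [1 / (n + 1)], which leaves countably many values. *)
Definition gridround (n : nat) (z : C) : C :=
  ((Num.floor (n.+1%:R * Re z))%:~R / n.+1%:R +i* ((Num.floor (n.+1%:R * Im z))%:~R / n.+1%:R))%C.

Lemma cmod_gridround n z : cmod (z - gridround n z) <= 2 / n.+1%:R.
Proof.
have h (a : R) : `|a - (Num.floor (n.+1%:R * a))%:~R / n.+1%:R| <= n.+1%:R^-1.
  have n0 : 0 < n.+1%:R :> R by rewrite ltr0n.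
  have /andP[l1 l2] := floor_itv (n.+1%:R * a).
  rewrite intrD in l2.
  have -> : a - (Num.floor (n.+1%:R * a))%:~R / n.+1%:R =
      (n.+1%:R * a - (Num.floor (n.+1%:R * a))%:~R) / n.+1%:R.
    by rewrite mulrBl mulrAC divff ?mul1r// gt_eqF.
  rewrite normrM [X in _ * X]gtr0_norm ?invr_gt0// ler_piMl ?invr_ge0 ?(ltW n0)//.
  by rewrite ger0_norm ?subr_ge0// lerBlDl ltW.
rewrite (le_trans (cmod_le_ReIm _))// ReD ImD ReN ImN /= mulrDl mul1r lerD//.
Qed.

Context d (T : measurableType d).
Variable nrm : T -> V -> R.
Hypothesis hn : forall g, complex_norm (nrm g).
Hypothesis mn : forall x, measurable_fun [set: T] (fun g => nrm g x).

(** Measurability is given only for fixed vectors. A rounded [f] takes countably many vector values,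
    and each norm is continuous, so the rounded norms converge pointwise. *)
Lemma measurable_nrm (f : T -> V) :
  (forall k, measurable_fun [set: T] (fun g => Re (f g 0 k))) ->
  (forall k, measurable_fun [set: T] (fun g => Im (f g 0 k))) ->
  measurable_fun [set: T] (fun g => nrm g (f g)).
Proof.
move=> mR mI.
pose fn n g : V := \row_k gridround n (f g 0 k).
apply: (@measurable_fun_cvg _ _ _ _ (fun n g => nrm g (fn n g))) => [n|g _].
  pose fl (a : {ffun 'I_N -> int * int}) : V :=
    \row_k (((a k).1%:~R / n.+1%:R) +i* ((a k).2%:~R / n.+1%:R))%C.
  pose idx g : {ffun 'I_N -> int * int} :=
    [ffun k => (Num.floor (n.+1%:R * Re (f g 0 k)), Num.floor (n.+1%:R * Im (f g 0 k)))].
  have fnE g : fn n g = fl (idx g).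
    by apply/rowP => k; rewrite !mxE ffunE.
  have mfl (z : int) (h : T -> R) : measurable_fun [set: T] h ->
      measurable [set g | Num.floor (n.+1%:R * h g) = z].
    move=> mh; have -> : [set g | Num.floor (n.+1%:R * h g) = z] =
        setT `&` (fun g => n.+1%:R * h g) @^-1` `[z%:~R, (z + 1)%:~R[%classic.
      rewrite setTI; apply/seteqP; split => g /=; rewrite in_itv/=.
        by move=> <-; exact: floor_itv.
      by move/floor_def.
    apply: (measurable_funM (measurable_cst _) mh) => //.
  have midx a : measurable [set g | idx g = a].
    have -> : [set g | idx g = a] = \bigcap_(k in [set: 'I_N])
        ([set g | Num.floor (n.+1%:R * Re (f g 0 k)) = (a k).1] `&`
         [set g | Num.floor (n.+1%:R * Im (f g 0 k)) = (a k).2]).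
      apply/seteqP; split => g /=; first by move=> <- k _; rewrite ffunE.
      move=> H; apply/ffunP => k; rewrite ffunE.
      by case: (H k I) => h1 h2; rewrite [RHS]surjective_pairing -h1 -h2.
    apply: fin_bigcap_measurable => // k _.
    by apply: measurableI; exact: mfl.
  move=> _ Y mY; rewrite setTI.
  have -> : (fun g => nrm g (fn n g)) @^-1` Y = \bigcup_(a : {ffun 'I_N -> int * int})
      ([set g | idx g = a] `&` (setT `&` (fun g => nrm g (fl a)) @^-1` Y)).
    apply/seteqP; split => g /=.
      by move=> gY; exists (idx g) => //; split => //; split => //=; rewrite -fnE.
    by move=> [a _ /= [<- [_]]]; rewrite -fnE.
  apply: countable_bigcupT_measurable => // a.
  by apply: measurableI => //; exact: mn.
pose S := \sum_(k < N) nrm g (basis_vector R k).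
have S0 : 0 <= S by apply: sumr_ge0 => k _; exact: complex_norm_ge0.
have bnd n : `|nrm g (f g) - nrm g (fn n g)| <= 2 / n.+1%:R * S.
  have a1 : nrm g (f g - fn n g) <= 2 / n.+1%:R * S.
    rewrite (le_trans (complex_norm_sum (hn g) _))// mulr_sumr ler_sum// => k _.
    by rewrite ler_wpM2r ?complex_norm_ge0// !mxE cmod_gridround.
  rewrite ler_norml lerBrDl lerBlDl; apply/andP; split.
    rewrite addrC (le_trans (complex_normB_le (hn g) _ (f g)))// lerD2l.
    by rewrite -complex_normN// opprB.
  by rewrite lerBlDl (le_trans (complex_normB_le (hn g) _ (fn n g)))// lerD2l.
apply/cvgrPdist_le => e e0; near=> n.
apply: (le_trans (bnd n)).
have h : 2 * S / e <= n%:R by near: n; exact: nbhs_infty_ger.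
rewrite mulrAC ler_pdivrMr ?ltr0n// [e * _]mulrC -ler_pdivrMr// (le_trans h)//.
by rewrite ler_nat.
Unshelve. all: by end_near. Qed.

End norms.

(** Boundary norms are bounded only almost everywhere; truncation at an essential bound alters them
    on a null set and makes them bounded everywhere. *)
Lemma bdmeas_minr_cst {R : realType} d (T : measurableType d) (h : T -> R) (L : R) :
  measurable_fun [set: T] h -> (forall g, 0 <= h g) -> 0 <= L ->
  bdmeas [set: T] (fun g => Num.min (h g) L).
Proof.
move=> mh h0 L0; split; first exact: measurable_minr.
by exists L => g _; rewrite ger0_norm ?le_min ?h0// ge_min lexx orbT.
Qed.

Lemma bdmeas_minr {R : realType} d (T : measurableType d) (D : set T) (f g : T -> R) :
  bdmeas D f -> bdmeas D g -> bdmeas D (fun x => Num.min (f x) (g x)).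
Proof.
move=> [mf [A hA]] [mg [B hB]]; split; first exact: measurable_minr.
exists (A + B) => x Dx; have a := hA x Dx; have b := hB x Dx.
have [_|_] := leP (f x) (g x).
  by rewrite (le_trans a)// lerDl (le_trans _ b).
by rewrite (le_trans b)// lerDr (le_trans _ a).
Qed.

(** * Integrals of logarithms over a probability space *)

Section probability_integrals.
Context {R : realType} d (T : measurableType d) (P : probability T R).
Implicit Types f g m : T -> R.

Lemma bdmeas_pintegrable f : bdmeas [set: T] f -> P.-integrable [set: T] (EFin \o f).
Proof.
move=> hf; apply: bdmeas_integrable hf => //.
by rewrite [ltLHS]probability_setT ltry.
Qed.

Lemma EFin_pint f : bdmeas [set: T] f ->
  (\int[P]_x f x)%:E = (\int[P]_x (f x)%:E)%E.
Proof.
by move=> hf; rewrite fineK//; apply: integrable_fin_num => //; exact: bdmeas_pintegrable.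
Qed.

Lemma pint_cst (c : R) : \int[P]_x c = c.
Proof. by rewrite Rintegral_cst//= probability_setT mulr1. Qed.

Lemma le_pint f g : bdmeas [set: T] f -> bdmeas [set: T] g -> (forall x, f x <= g x) ->
  \int[P]_x f x <= \int[P]_x g x.
Proof. by move=> hf hg fg; apply: le_Rintegral => //; exact: bdmeas_pintegrable. Qed.

Lemma ae_eq_pint f g : bdmeas [set: T] f -> bdmeas [set: T] g ->
  {ae P, forall x, f x = g x} -> \int[P]_x f x = \int[P]_x g x.
Proof.
move=> [mf _] [mg _] fg; rewrite /Rintegral; congr fine.
apply: ae_eq_integral => //; [exact/measurable_EFinP|exact/measurable_EFinP|].
by apply: ae_imp fg => x /= ->.
Qed.

Lemma pintD f g : bdmeas [set: T] f -> bdmeas [set: T] g ->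
  \int[P]_x (f x + g x) = \int[P]_x f x + \int[P]_x g x.
Proof. by move=> hf hg; rewrite RintegralD//; exact: bdmeas_pintegrable. Qed.

Lemma pintB f g :
  bdmeas [set: T] f -> bdmeas [set: T] g ->
  \int[P]_x (f x - g x) = \int[P]_x f x - \int[P]_x g x.
Proof. by move=> hf hg; rewrite RintegralB//; exact: bdmeas_pintegrable. Qed.

Lemma measurable_lne m : measurable_fun [set: T] m ->
  measurable_fun [set: T] (fun x => lne (m x)%:E).
Proof.
move=> mm; have -> : (fun x => lne (m x)%:E) =
    (fun x => if m x <= 0 then -oo%E else (ln (m x))%:E) by apply/funext.
apply: measurable_fun_ifT => //.
  exact: measurable_fun_ler.
by apply/measurable_EFinP; exact: (measurableT_comp (@measurable_ln R)).
Qed.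

(* Monotone convergence applied to the nonnegative functions [c - ln (m + e)]. *)
Lemma le_integral_lne m (A : R) : bdmeas [set: T] m -> (forall x, 0 <= m x) ->
  (forall e : R, 0 < e -> A <= \int[P]_x ln (m x + e)) ->
  (A%:E <= \int[P]_x lne (m x)%:E)%E.
Proof.
move=> hm m0 HA; have [mm [B0 mB0]] := hm.
pose B := B0 + 1.
have mB x : m x + 1 <= B by rewrite lerD2r (le_trans (ler_norm _))// mB0.
pose c := ln B.
pose e_ (n : nat) : R := n.+1%:R^-1.
have e0 n : 0 < e_ n by rewrite invr_gt0 ltr0n.
have e1 n : e_ n <= 1 by rewrite invf_le1 ?ltr0n// ler1n.
have me0 n x : 0 < m x + e_ n by rewrite ltr_wpDl.
have hl n : bdmeas [set: T] (fun x => ln (m x + e_ n)) by exact: bdmeas_ln.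
have lc n x : ln (m x + e_ n) <= c.
  have mb : m x + e_ n <= B by rewrite (le_trans _ (mB x))// lerD2l.
  by rewrite ler_ln ?posrE// (lt_le_trans (me0 n x)).
pose phi n x := (c - ln (m x + e_ n))%:E.
have hphi n : bdmeas [set: T] (fun x => c - ln (m x + e_ n)).
  by apply: bdmeasB => //; exact: bdmeas_cst.
have phi0 n x : (0 <= phi n x)%E by rewrite lee_fin subr_ge0.
have ndphi x : {homo phi^~ x : n k / (n <= k)%N >-> (n <= k)%E}.
  move=> n k nk; rewrite lee_fin lerD2l lerN2 ler_ln ?posrE// lerD2l.
  by rewrite lef_pV2 ?posrE ?ltr0n// ler_nat ltnS.
have mphi n : measurable_fun setT (phi n) by apply/measurable_EFinP; exact: (hphi n).1.
have limphi x : phi n x @[n --> \oo] --> (c%:E - lne (m x)%:E)%E.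
  have ce : (m x + e_ n) @[n --> \oo] --> m x.
    rewrite -[X in _ --> X]addr0; apply: cvgD; first exact: cvg_cst.
    exact: cvg_harmonic.
  have [mx0|mx0] := eqVneq (m x) 0; last first.
    have mxp : 0 < m x by rewrite lt_def mx0 m0.
    rewrite lne_EFin// -EFinB; apply: cvg_EFin; first by near=> n.
    apply: cvgB; first exact: cvg_cst.
    by apply: (cvg_comp _ _ ce); exact: continuous_ln.
  rewrite mx0 le0_lneNy// addey//; apply/cvgeyPge => K; near=> n.
  rewrite lee_fin mx0 add0r /e_ lnV ?posrE ?ltr0n// opprK -lerBlDl.
  have h : expR (K - c) <= n%:R by near: n; exact: nbhs_infty_ger.
  rewrite -[K - c]expRK ler_ln ?posrE ?expR_gt0 ?ltr0n// (le_trans h)//.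
  by rewrite ler_nat.
have cvgi := cvg_monotone_convergence (mu := P) measurableT mphi
  (fun n x _ => phi0 n x) (fun x _ => ndphi x).
pose psi x := (c%:E - lne (m x)%:E)%E.
have lE : (\int[P]_x limn (phi^~ x) = \int[P]_x psi x)%E.
  by apply: eq_integral => x _; apply/cvg_lim => //; exact: limphi.
have mpsi : measurable_fun setT psi.
  by apply: emeasurable_funB => //; exact: measurable_lne.
have psi0 x : (0 <= psi x)%E.
  rewrite /psi -(cvg_lim _ (limphi x))//; apply: lime_ge; first by apply/cvg_ex; eexists; exact: limphi.
  by near=> n.
have ipsi : (\int[P]_x psi x <= (c - A)%:E)%E.
  rewrite -lE -(cvg_lim _ cvgi)//; apply: lime_le; first by apply/cvg_ex; eexists; exact: cvgi.
  near=> n; rewrite -EFin_pint// lee_fin.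
  have -> : \int[P]_x (c - ln (m x + e_ n)) = c - \int[P]_x ln (m x + e_ n).
    by rewrite RintegralB//=; [rewrite pint_cst|apply: bdmeas_pintegrable; exact: bdmeas_cst
      |exact: bdmeas_pintegrable].
  by rewrite lerD2l lerN2 HA.
have intpsi : P.-integrable setT psi.
  apply/integrableP; split => //.
  under eq_integral do rewrite gee0_abs//.
  exact: (le_lt_trans ipsi (ltry _)).
have -> : (\int[P]_x lne (m x)%:E = \int[P]_x (c%:E - psi x))%E.
  apply: eq_integral => x _; rewrite /psi; case: (lne _) => [r||]//=.
  by rewrite -!EFinB opprB addrC subrK.
rewrite integralB//; last by apply: (bdmeas_pintegrable (f := cst c)); exact: bdmeas_cst.
rewrite -EFin_pint ?pint_cst; last exact: bdmeas_cst.
have fpsi : (\int[P]_x psi x)%E \is a fin_num by exact: integrable_fin_num.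
by move: ipsi; rewrite -(fineK fpsi) -EFinB !lee_fin => h; rewrite lerBrDr -lerBrDl.
Unshelve. all: by end_near. Qed.

(** A logarithm may integrate to [-oo], so the comparison is made on positive and negative parts
    rather than through integrability. *)
Lemma le_integral_measurable (f g : T -> \bar R) :
  measurable_fun [set: T] f -> measurable_fun [set: T] g ->
  (forall x, (f x <= g x)%E) -> (\int[P]_x f x <= \int[P]_x g x)%E.
Proof.
move=> mf mg fg; rewrite [leLHS]integralE [leRHS]integralE; apply: leeB.
- apply: ge0_le_integral => // [||x _]; try exact: measurable_funepos.
  by rewrite !funeposE ge_max !le_max fg lexx orbT.
- apply: ge0_le_integral => // [||x _]; try exact: measurable_funeneg.
  by rewrite !funenegE ge_max !le_max leeN2 fg lexx orbT.
Qed.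

Lemma integral_lne_le m (L : R) : measurable_fun [set: T] m -> (forall x, 0 <= m x) ->
  0 <= L -> {ae P, forall x, m x <= L} -> (\int[P]_x lne (m x)%:E <= lne L%:E)%E.
Proof.
move=> mm m0 L0 mL.
have mmin : measurable_fun [set: T] (fun x => Num.min (m x) L).
  exact: measurable_minr.
have -> : (\int[P]_x lne (m x)%:E = \int[P]_x lne (Num.min (m x) L)%:E)%E.
  apply: ae_eq_integral => //; [exact: measurable_lne|exact: measurable_lne|].
  by apply: ae_imp mL => x /= h _; rewrite min_l.
apply: (@le_trans _ _ (\int[P]_x cst (lne L%:E) x)%E).
  apply: le_integral_measurable => [||x]; [exact: measurable_lne|exact: measurable_cst|].
  rewrite lee_lne ?lee_fin ?ge_min ?lexx ?orbT// in_itv/= lee_fin ?le_min ?m0 ?L0 ?leey//.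
by rewrite integral_cst// [X in (_ * X)%E]probability_setT mule1.
Qed.

Lemma ae_eq_integral_lne f g : measurable_fun [set: T] f -> measurable_fun [set: T] g ->
  {ae P, forall x, f x = g x} -> (\int[P]_x lne (f x)%:E = \int[P]_x lne (g x)%:E)%E.
Proof.
move=> mf mg fg; apply: ae_eq_integral => //; [exact: measurable_lne|exact: measurable_lne|].
by apply: ae_imp fg => x /= ->.
Qed.

(** The bridge from extended-valued conditions to real integrals. One direction is monotonicity, as
    [lne (m x)] lies below [ln (m x + e)]; the other is the limit in [le_integral_lne]. *)
Lemma lne_le_integralP m (c : R) : bdmeas [set: T] m -> (forall x, 0 <= m x) -> 0 <= c ->
  (lne c%:E <= \int[P]_x lne (m x)%:E)%E <->
  (forall e : R, 0 < e -> c <= expR (\int[P]_x ln (m x + e))).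
Proof.
move=> hm m0 c0; split => [H e e0|H].
  have hl : bdmeas [set: T] (fun x => ln (m x + e)) by exact: bdmeas_ln.
  have [->|cn0] := eqVneq c 0; first exact: expR_ge0.
  have cp : 0 < c by rewrite lt_def cn0.
  rewrite -[c]lnK ?posrE// ler_expR -lee_fin -lne_EFin// (le_trans H)// EFin_pint//.
  apply: le_integral_measurable => [||x]; first by apply: measurable_lne; case: hm.
    by apply/measurable_EFinP; case: hl.
  have me0 : 0 < m x + e by rewrite ltr_wpDl.
  rewrite -lne_EFin// lee_lne ?lee_fin ?lerDl ?(ltW e0)// in_itv/= lee_fin ?m0 ?(ltW me0) ?leey//.
have [->|cn0] := eqVneq c 0; first by rewrite le0_lneNy// leNye.
have cp : 0 < c by rewrite lt_def cn0.
rewrite lne_EFin//; apply: le_integral_lne => // e e0.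
by rewrite -ler_expR lnK ?posrE// H.
Qed.

End probability_integrals.

(** * Analytic competitors *)

Section boundary_values.
Context {R : realType}.
Local Notation C := R[i].
Local Notation Re := complex.Re.
Local Notation Im := complex.Im.
Local Notation mu := (@lebesgue_measure R).
Local Notation P := (@circle_mu R).

Lemma lim_radial (h : C -> C) (z w : C) :
  (forall e : R, 0 < e -> exists2 q : R, 0 < q & forall r : R, 0 <= r < 1 -> 1 - r < q ->
     cmod (h (r%:C%C * z) - w) <= e) ->
  lim ((h (r%:C%C * z) : C^o) @[r --> (1 : R)^'-]) = w.
Proof.
move=> H; apply: (cvg_lim (@norm_hausdorff _ _)).
apply/cvgrPdist_le => e e0.
have [ee er] : e = (Re e)%:C%C /\ 0 < Re e.
  by case: e e0 => a b; rewrite ltcE /= => /andP[/eqP -> a0].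
have [q q0 Hq] := H _ er; near=> r.
rewrite ee distrC normc_cmod lecR; apply: Hq.
  apply/andP; split; last by near: r; exact: nbhs_left_lt.
  by near: r; apply: nbhs_left_ge; exact: ltr01.
rewrite ltrBlDl -ltrBlDr; near: r; apply: nbhs_left_gt.
by rewrite ltrBlDr ltrDl.
Unshelve. all: by end_near. Qed.

Context {N : nat}.
Local Notation V := 'rV[C]_N.
Local Notation T := (circle R).

(** The functions [W k] are bounded and measurable everywhere on the line, which [boundary_value] is
    not known to be; the two agree almost everywhere by Fatou's theorem. *)
Lemma bounded_analytic_boundary (F : C -> V) : bounded_analytic F ->
  exists W : 'I_N -> R -> C, [/\
    (forall k, bdmeas [set: R] (fun t => Re (W k t))),
    (forall k, bdmeas [set: R] (fun t => Im (W k t))),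
    (forall k, {ae mu, forall t, 0 < t < 1 -> forall e : R, 0 < e ->
      exists2 q : R, 0 < q & forall r : R, 0 <= r < 1 -> 1 - r < q ->
      cmod (F (r%:C%C * expi t) 0 k - W k t) <= e}) &
    {ae P, forall g, boundary_value F g = \row_k W k (carg g)}].
Proof.
move=> [Fd Fb].
have hF k z : cmod z < 1 -> holo (fun w => F w 0 k) z.
  by move=> z1; apply: Fd; rewrite -[1]/(1%:C%C) cmod_lt.
have H k : exists UV : (R -> R) * (R -> R), [/\ bdmeas [set: R] UV.1, bdmeas [set: R] UV.2 &
    {ae mu, forall t, 0 < t < 1 -> forall e : R, 0 < e ->
      exists2 q : R, 0 < q & forall r : R, 0 <= r < 1 -> 1 - r < q ->
      cmod (F (r%:C%C * expi t) 0 k - (UV.1 t +i* UV.2 t)%C) <= e}].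
  have [K FK] := Fb k.
  have FK' z : cmod z < 1 -> cmod (F z 0 k) <= K.
    by move=> z1; apply: FK; rewrite -[1]/(1%:C%C) cmod_lt.
  have [U [V' [hU hV h]]] := fatou (hF k) FK'.
  by exists (U, V').
have [UV hUV] := choice H.
exists (fun k t => ((UV k).1 t +i* (UV k).2 t)%C); split.
- by move=> k; case: (hUV k).
- by move=> k; case: (hUV k).
- by move=> k; case: (hUV k).
have ae1 : {ae P, forall g, forall k, forall e : R, 0 < e ->
      exists2 q : R, 0 < q & forall r : R, 0 <= r < 1 -> 1 - r < q ->
      cmod (F (r%:C%C * expi (carg g)) 0 k - ((UV k).1 (carg g) +i* (UV k).2 (carg g))%C) <= e}.
  apply: filter_forall => k; case: (hUV k) => _ _ h; exact: ae_carg h.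
apply: ae_imp ae1 => g hg; apply/rowP => k; rewrite !mxE.
by rewrite -expi_carg; apply: (@lim_radial (fun z => F z 0 k)); exact: hg.
Qed.

End boundary_values.

Section interpolation_formula.
Context {R : realType} {N : nat}.
Local Notation C := R[i].
Local Notation Re := complex.Re.
Local Notation Im := complex.Im.
Local Notation mu := (@lebesgue_measure R).
Local Notation P := (@circle_mu R).
Local Notation V := 'rV[C]_N.
Local Notation T := (circle R).

(** Coordinatewise outer functions have the prescribed boundary moduli, and a constant factor in
    each coordinate adjusts the value at [0]. *)
Lemma outer_competitor (u : 'I_N -> T -> R) (x : V) :
  (forall k, bdmeas [set: T] (u k)) -> (forall k, cmod (x 0 k) <= expR (\int[P]_g u k g)) ->
  exists2 F : C -> V, bounded_analytic F /\ F 0 = x &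
    {ae P, forall g, forall k, cmod (boundary_value F g 0 k) <= expR (u k g)}.
Proof.
move=> hu xu.
have rep k : exists v : R -> R, bdmeas [set: R] v /\ {ae P, forall g, u k g = v (carg g)}.
  by have [v h1 h2] := borel_representative (hu k); exists v.
have [v hv] := choice rep.
have hvb k : bdmeas [set: R] (v k) by case: (hv k).
have intE k : \int[P]_g u k g = \int[mu]_(t in `[0, 1]) v k t.
  by rewrite -(circle_int_carg (hvb k)); apply: (ae_eq_pint (hu k) (bdmeas_carg (hvb k)) (hv k).2).
(* By [xu] the factor has modulus at most [1], so adjusting the value at [0] does not raise the
   boundary modulus. *)
pose a k : C := x 0 k / outer (v k) 0.
have o0 k : outer (v k) 0 = (expR (\int[P]_g u k g))%:C%C by rewrite outer0 intE.
have o0n k : outer (v k) 0 != 0.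
  by rewrite -cmod_gt0 o0 cmodr gtr0_norm ?expR_gt0.
have a1 k : cmod (a k) <= 1.
  by rewrite cmodM cmodV o0 cmodr gtr0_norm ?expR_gt0// ler_pdivrMr ?expR_gt0// mul1r.
pose F (z : C) : V := \row_k (a k * outer (v k) z).
have FE k : (fun z => F z 0 k) = (fun z => a k * outer (v k) z).
  by apply/funext => z; rewrite mxE.
have bF : bounded_analytic F.
  split => k.
    move=> z; rewrite -[1]/(1%:C%C) cmod_lt FE => z1.
    by apply: (@holoM _ (cst (a k)) (outer (v k))); [exact: holo_cst|exact: holo_outer].
  have [M vM] := (hvb k).2.
  exists (expR M) => z; rewrite -[1]/(1%:C%C) cmod_lt => z1.
  rewrite mxE cmodM -[leRHS]mul1r ler_pM ?cmod_ge0//.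
  by apply: outer_bounded => // t; exact: vM.
exists F; first by split=> //; apply/rowP => k; rewrite mxE mulfVK.
have [W [_ _ hW bvW]] := bounded_analytic_boundary bF.
have le1 : {ae P, forall g, forall k, cmod (W k (carg g)) <= expR (v k (carg g))}.
  apply: filter_forall => k.
  apply: (ae_carg (P := fun t => cmod (W k t) <= expR (v k t))).
  apply: ae_imp2 (hW k) (outer_radial_limit (hvb k)) => t h1 h2 t01.
  apply/ler_addgt0Pr => e e0.
  have e2 : 0 < e / 2 by rewrite divr_gt0.
  have [q1 q10 Hq1] := h1 t01 _ e2; have [q2 q20 Hq2] := h2 t01 _ e2.
  pose q := Num.min (Num.min q1 q2) 1; pose r := 1 - q / 2.
  have q0 : 0 < q by rewrite !lt_min q10 q20 ltr01.
  have r01 : 0 <= r < 1.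
    rewrite subr_ge0 gtrBl divr_gt0// andbT ler_pdivrMr// mul1r.
    by rewrite (@le_trans _ _ 1) ?ler1n// ge_min lexx orbT.
  have rq : 1 - r < q by rewrite /r opprB addrC subrK gtr_pMr// invf_lt1// ltr1n.
  have rq1 : 1 - r < q1 by rewrite (lt_le_trans rq)// !ge_min lexx.
  have rq2 : 1 - r < q2 by rewrite (lt_le_trans rq)// !ge_min lexx orbT.
  have := Hq1 _ r01 rq1; have := Hq2 _ r01 rq2.
  rewrite mxE => d2 d1.
  have := cmod_sub_ge (W k t) (a k * outer (v k) (r%:C%C * expi t)).
  rewrite cmodB => d3; have := le_trans d3 d1.
  rewrite cmodM lerBlDl => d4; apply: (le_trans d4).
  have d5 : cmod (outer (v k) (r%:C%C * expi t)) <= e / 2 + expR (v k t).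
    by move: d2; rewrite ler_norml => /andP[_]; rewrite lerBlDr.
  have d6 : cmod (a k) * cmod (outer (v k) (r%:C%C * expi t)) <= e / 2 + expR (v k t).
    by apply: le_trans d5; rewrite ler_piMl ?cmod_ge0.
  rewrite [e in leRHS](splitr e); lra.
have uv : {ae P, forall g, forall k, u k g = v k (carg g)}.
  by apply: filter_forall => k; case: (hv k).
apply: ae_imp2 (ae_imp2 (fun g h1 h2 => conj h1 h2) le1 bvW) uv => g [h1 ->] h2 k.
by rewrite mxE h2.
Qed.

Variable nrm : T -> V -> R.
Hypothesis hnrm : compatible_family nrm.

Lemma family_upper : exists2 E : R, 0 <= E &
  {ae P, forall g, forall k, nrm g (basis_vector R k) <= E}.
Proof.
have H k : exists Ek : R, {ae P, forall g, nrm g (basis_vector R k) <= Ek}.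
  have [_ _ h] := family_bounds hnrm k.
  exact: (@ess_supr_bounded _ _ _ P (fun g => nrm g (basis_vector R k))).
have [E hE] := choice H.
exists (\sum_k `|E k|); first by apply: sumr_ge0.
apply: filter_forall => k; apply: ae_imp (hE k) => g /le_trans; apply.
rewrite (bigD1 k)//= (le_trans (ler_norm _))// lerDl; exact: sumr_ge0.
Qed.

Lemma measurable_family (f : T -> V) :
  (forall k, measurable_fun [set: T] (fun g => Re (f g 0 k))) ->
  (forall k, measurable_fun [set: T] (fun g => Im (f g 0 k))) ->
  measurable_fun [set: T] (fun g => nrm g (f g)).
Proof. by apply: measurable_nrm; [exact: family_norm|exact: family_measurable]. Qed.

Lemma family_ge0 g x : 0 <= nrm g x.
Proof. exact/complex_norm_ge0/family_norm. Qed.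

Lemma interp_norm_ge0 x : (0 <= interp_norm nrm x)%E.
Proof.
apply/ereal_infP => _ [F _ <-]; apply: ess_sup_ger.
  by rewrite [ltRHS]probability_setT lte_fin ltr01.
by move=> g; rewrite lee_fin family_ge0.
Qed.

(** By the lattice property a bound on the moduli of the boundary values bounds their norm. *)
Lemma interp_norm_le (u : 'I_N -> T -> R) (x : V) (A : R) :
  (forall k, bdmeas [set: T] (u k)) -> (forall k, cmod (x 0 k) <= expR (\int[P]_g u k g)) ->
  {ae P, forall g, nrm g (\row_k (expR (u k g))%:C%C) <= A} ->
  (interp_norm nrm x <= A%:E)%E.
Proof.
move=> hu xu uA; have [F hF bF] := outer_competitor hu xu.
apply: (@le_trans _ _ (ess_sup P (fun g => (nrm g (boundary_value F g))%:E))).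
  by apply: ereal_inf_lbound; exists F.
apply/ess_supP.
apply: ae_imp2 (ae_imp2 (fun g h1 h2 => conj h1 h2) bF uA) (family_lattice hnrm).
move=> g [h1 h2] hl; rewrite lee_fin (le_trans _ h2)//; apply: hl => k.
by rewrite [X in _ <= cmod X]mxE cmodr gtr0_norm ?expR_gt0.
Qed.

End interpolation_formula.

Section interpolation_formula_bounds.
Context {R : realType} {N : nat}.
Local Notation C := R[i].
Local Notation Re := complex.Re.
Local Notation Im := complex.Im.
Local Notation mu := (@lebesgue_measure R).
Local Notation P := (@circle_mu R).
Local Notation V := 'rV[C]_N.
Local Notation T := (circle R).
Variable nrm : T -> V -> R.
Hypothesis hnrm : compatible_family nrm.

Lemma bdmeas_cmod_coord (f : T -> V) k : bounded_measurable f ->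
  bdmeas [set: T] (fun g => cmod (f g 0 k)).
Proof.
move=> /(_ k)[mR mI [K fK]]; split; first exact: measurable_cmod.
by exists K => g _; rewrite ger0_norm ?cmod_ge0.
Qed.

Lemma bounded_measurable_unif (f : T -> V) : bounded_measurable f ->
  exists2 B : R, 0 <= B & forall g k, cmod (f g 0 k) <= B.
Proof.
move=> hf; have H k : exists K : R, forall g, cmod (f g 0 k) <= K by case: (hf k).
have [K hK] := choice H.
exists (\sum_k `|K k|) => [|g k]; first exact: sumr_ge0.
rewrite (le_trans (hK k g))// (bigD1 k)//= (le_trans (ler_norm _))// lerDl; exact: sumr_ge0.
Qed.

Lemma measurable_bounded_nrm (f : T -> V) : bounded_measurable f ->
  measurable_fun [set: T] (fun g => nrm g (f g)).
Proof. by move=> hf; apply: (measurable_family hnrm) => k; case: (hf k). Qed.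

Lemma ae_nrm_le (f : T -> V) (B E : R) : 0 <= B ->
  (forall g k, cmod (f g 0 k) <= B) ->
  {ae P, forall g, forall k, nrm g (basis_vector R k) <= E} ->
  {ae P, forall g, nrm g (f g) <= (B * E) *+ N}.
Proof.
move=> B0 fB; apply: ae_imp => g hE.
apply: (le_trans (complex_norm_sum (family_norm hnrm g) _)).
rewrite -[N in X in _ <= X]card_ord -sumr_const ler_sum// => k _.
by rewrite ler_pM ?cmod_ge0 ?(family_ge0 hnrm).
Qed.

(** For [e > 0] all coordinates are positive, so their logarithms are finite, while the norm grows
    by little. *)
Definition absplus (e : R) (x : V) : V := \row_k (cmod (x 0 k) + e)%:C%C.

Lemma nrm_absplus_le (g : T) (e E : R) (x : V) : lattice_norm (nrm g) -> 0 <= e ->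
  (forall k, nrm g (basis_vector R k) <= E) ->
  nrm g (absplus e x) <= nrm g x + e * E *+ N.
Proof.
move=> hl e0 hE.
have hn := family_norm hnrm g.
pose y : V := \row_k (cmod (x 0 k))%:C%C; pose z : V := \row_k e%:C%C.
have -> : absplus e x = y + z by apply/rowP => k; rewrite !mxE rmorphD.
apply: (le_trans (complex_normD hn _ _)); apply: lerD.
  by apply: hl => k; rewrite mxE cmodr ger0_norm ?cmod_ge0.
apply: (le_trans (complex_norm_sum hn _)).
rewrite -[N in X in _ <= X]card_ord -sumr_const ler_sum// => k _.
by rewrite mxE cmodr ger0_norm// ler_wpM2l.
Qed.

End interpolation_formula_bounds.

(** * Averaging along a measure-preserving map *)

Section finite_valued.
Context {R : realType} d (T : measurableType d) (P : probability T R).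

Definition finite_valued (J : finType) (c : T -> J) :=
  forall j, measurable [set g | c g = j].

Lemma finite_valued_measurable (J : finType) (c : T -> J) : finite_valued c ->
  forall Y : set J, measurable (c @^-1` Y).
Proof.
move=> hc Y; have -> : c @^-1` Y = \bigcup_(j in Y) [set g | c g = j].
  by apply/seteqP; split => [g Yg|g [j Yj /= gj]]; [exists (c g)|rewrite /= gj].
exact: fin_bigcup_measurable.
Qed.

Lemma bdmeas_finite_valued (J : finType) (c : T -> J) (f : J -> R) : finite_valued c ->
  bdmeas [set: T] (fun g => f (c g)).
Proof.
move=> hc; split.
  move=> _ Y _; rewrite setTI; exact: (finite_valued_measurable hc (f @^-1` Y)).
exists (\sum_j `|f j|) => g _; rewrite (bigD1 (c g))//= lerDl; exact: sumr_ge0.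
Qed.

Lemma pint_sum (I : Type) (s : seq I) (f : I -> T -> R) :
  (forall i, bdmeas [set: T] (f i)) ->
  bdmeas [set: T] (fun g => \sum_(i <- s) f i g) /\
  \int[P]_g (\sum_(i <- s) f i g) = \sum_(i <- s) \int[P]_g f i g.
Proof.
move=> hf; elim: s => [|i s [IH1 IH2]].
  split; last by under eq_Rintegral do rewrite big_nil; rewrite big_nil pint_cst.
  by under eq_fun do rewrite big_nil; exact: bdmeas_cst.
have e : (fun g => \sum_(j <- i :: s) f j g) = (fun g => f i g + \sum_(j <- s) f j g).
  by apply/funext => g; rewrite big_cons.
split; first by rewrite e; exact: bdmeasD.
by rewrite e pintD// IH2 big_cons.
Qed.

Lemma pint_finite_valued (J : finType) (c : T -> J) (f : J -> R) : finite_valued c ->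
  \int[P]_g f (c g) = \sum_j f j * fine (P [set g | c g = j]).
Proof.
move=> hc.
have -> : (fun g => f (c g)) = (fun g => \sum_j (f j * \1_[set g | c g = j] g)).
  apply/funext => g; rewrite (bigD1 (c g))//= indicE mem_set// mulr1 big1 ?addr0// => j jc.
  by rewrite indicE memNset ?mulr0// => /= e; rewrite e eqxx in jc.
have hb (j : J) : bdmeas [set: T] (\1_[set g | c g = j] : T -> R).
  split; first exact: measurable_indic.
  by exists 1 => g _; rewrite indicE; case: (_ \in _); rewrite ?normr1// normr0.
have hf (j : J) : bdmeas [set: T] (fun g => f j * \1_[set g | c g = j] g).
  by apply: bdmeasM (hb j); exact: bdmeas_cst.
rewrite (pint_sum _ hf).2; apply: eq_bigr => j _.
rewrite RintegralZl//; last exact: bdmeas_pintegrable.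
by rewrite /Rintegral integral_indic// setIT.
Qed.

(** The bounded range of each [r i] is cut into cells of length [dl], and [c g] records the cell of
    every [r i g]. *)
Lemma finite_partition (I : finType) (r : I -> T -> R) (dl : R) : 0 < dl ->
  (forall i, bdmeas [set: T] (r i)) ->
  exists J : finType, exists2 c : T -> J, finite_valued c &
    forall g g', c g = c g' -> forall i, `|r i g - r i g'| <= dl.
Proof.
move=> dl0 hr.
have H i : exists B : R, forall g, `|r i g| <= B by have [_ [B hB]] := hr i; exists B => g; exact: hB.
have [B0 hB0] := choice H.
pose B := \sum_i `|B0 i|.
have hB i g : `|r i g| <= B.
  rewrite (le_trans (hB0 i g))// (le_trans (ler_norm _))// /B (bigD1 i)//= lerDl.
  exact: sumr_ge0.
pose y i g := (r i g + B) / dl.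
have y0 i g : 0 <= y i g.
  rewrite divr_ge0 ?(ltW dl0)// -lerBlDr sub0r.
  by have := hB i g; rewrite ler_norml => /andP[].
pose Q := Num.truncn ((B + B) / dl).
have yQ i g : (Num.truncn (y i g) < Q.+1)%N.
  rewrite ltnS; apply: le_truncn; rewrite ler_pM2r ?invr_gt0// lerD2r.
  by rewrite (le_trans (ler_norm _)).
exists {ffun I -> 'I_Q.+1}; exists (fun g => [ffun i => Ordinal (yQ i g)]) => [j|g g' e i].
  have -> : [set g | [ffun i => Ordinal (yQ i g)] = j] =
      \bigcap_(i in [set: I]) (setT `&` (y i) @^-1` `[(j i)%:R, (j i).+1%:R[%classic).
    apply/seteqP; split => g /=.
      move=> <- i _; split => //=; rewrite ffunE in_itv/=; exact: truncn_itv.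
    move=> h; apply/ffunP => i; rewrite ffunE; apply: val_inj => /=.
    by have [_ /=] := h i Logic.I; rewrite in_itv/= => /truncn_def.
  apply: fin_bigcap_measurable => // i _.
  have my : measurable_fun [set: T] (y i).
    apply: measurable_funM => //; apply: measurable_funD => //; exact: (hr i).1.
  exact: my.
have e1 : Num.truncn (y i g) = Num.truncn (y i g').
  by have /ffunP/(_ i) := e; rewrite !ffunE => -[].
have := truncn_itv (y0 i g'); have := truncn_itv (y0 i g); rewrite e1.
rewrite -natr1 => /andP[a1 a2] /andP[b1 b2].
have -> : r i g - r i g' = (y i g - y i g') * dl.
  by rewrite /y -mulrBl divfK ?gt_eqF// opprD addrACA subrr addr0.
rewrite normrM (gtr0_norm dl0) -[leRHS]mul1r ler_pM2r// ler_norml; lra.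
Qed.

End finite_valued.

(** * Logarithmic convexity of lattice norms *)

Section log_convexity.
Context {R : realType} {I : finType}.
Implicit Types (w t : I -> R).

(** Each [expR (t i)] lies above the tangent line of [expR] at the mean [a]. *)
Lemma expR_jensen w t : (forall i, 0 <= w i) -> \sum_i w i = 1 ->
  expR (\sum_i w i * t i) <= \sum_i w i * expR (t i).
Proof.
move=> w0 w1; set a := \sum_i _.
have -> : expR a = \sum_i w i * (expR a * (1 + (t i - a))).
  under eq_bigr do rewrite mulrCA mulrDr mulr1 mulrBr.
  rewrite -mulr_sumr big_split/= w1 sumrB -mulr_suml w1 mul1r -/a subrr addr0 mulr1//.
apply: ler_sum => i _; apply: ler_wpM2l => //.
have -> : expR (t i) = expR a * expR (t i - a) by rewrite -expRD addrC subrK.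
by rewrite ler_pM2l ?expR_gt0// expR_ge1Dx.
Qed.

(** After division by the bounds [expR (r i)], the weighted arithmetic mean [z] of the vectors has
    norm at most [1] by the triangle inequality. It dominates the normalised geometric mean
    coordinatewise, and the lattice property transfers the bound. *)
Lemma lattice_norm_log_convex (N : nat) (p : 'rV[R[i]]_N -> R) (tau : I -> 'I_N -> R) w r :
  complex_norm p -> lattice_norm p -> (forall i, 0 <= w i) -> \sum_i w i = 1 ->
  (forall i, p (\row_k (expR (tau i k))%:C%C) <= expR (r i)) ->
  p (\row_k (expR (\sum_i w i * tau i k))%:C%C) <= expR (\sum_i w i * r i).
Proof.
move=> hp hl w0 w1 hr; set S := \sum_i w i * r i.
pose y i : 'rV[R[i]]_N := \row_k (expR (tau i k))%:C%C.
pose z := \sum_i (w i * expR (- r i))%:C%C *: y i.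
have pz : p z <= 1.
  apply: (@le_trans _ _ (\sum_i w i)); last by rewrite w1.
  apply: (big_ind2 (fun u v => p u <= v)) => [|u a v b ua vb|i _].
  - by rewrite complex_norm0.
  - by rewrite (le_trans (complex_normD hp _ _))// lerD.
  - rewrite (complex_normZ hp) cmodr ger0_norm ?mulr_ge0 ?expR_ge0// -mulrA.
    by rewrite ler_piMr// expRN mulrC ler_pdivrMr ?expR_gt0// mul1r; exact: hr.
have zE k : z 0 k = (\sum_i w i * expR (tau i k - r i))%:C%C.
  rewrite /z summxE rmorph_sum; apply: eq_bigr => i _ /=.
  by rewrite !mxE -rmorphM/= -mulrA -expRD addrC.
apply: (@le_trans _ _ (p ((expR S)%:C%C *: z))); last first.
  by rewrite (complex_normZ hp) cmodr gtr0_norm ?expR_gt0// ler_piMr ?expR_ge0.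
apply: hl => k; rewrite !mxE zE -rmorphM !cmodr ger0_norm ?expR_ge0//.
rewrite (le_trans _ (ler_norm _))// mulrC -ler_pdivrMr ?expR_gt0// -expRN -expRD -sumrB.
by under eq_bigr do rewrite -mulrBr; exact: expR_jensen.
Qed.

End log_convexity.

(** * Invariance under measure-preserving maps *)

Section measure_preserving_maps.
Context {R : realType} d (T : measurableType d) (P : probability T R) (M : T -> T).
Hypothesis mM : measurable_fun [set: T] M.
Hypothesis PM : forall A, measurable A -> P (M @^-1` A) = P A.

Lemma ae_measure_preserving (Q : T -> Prop) : {ae P, forall g, Q g} ->
  {ae P, forall g, Q (M g)}.
Proof.
move=> [A [mA A0 QA]]; exists (M @^-1` A); split.
- by rewrite -[X in measurable X]setTI; exact: mM.
- by rewrite PM.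
- by move=> g /= nQ; apply: QA.
Qed.

Lemma ge0_integral_measure_preserving (f : T -> \bar R) : measurable_fun [set: T] f ->
  (forall g, (0 <= f g)%E) -> (\int[P]_g f (M g) = \int[P]_g f g)%E.
Proof.
move=> mf f0; have := @ge0_integral_pushforward _ _ _ _ _ _ mM P setT f measurableT mf
  (fun g _ => f0 g).
rewrite preimage_setT => <-.
pose nu : {measure set T -> \bar R} := pushforward P M.
apply: (@eq_measure_integral _ _ _ _ P (nu mM)) => A mA _.
exact: PM.
Qed.

Lemma integral_measure_preserving (f : T -> \bar R) : measurable_fun [set: T] f ->
  (\int[P]_g f (M g) = \int[P]_g f g)%E.
Proof.
move=> mf; rewrite [LHS]integralE [RHS]integralE; congr (_ - _)%E.
  rewrite -(@ge0_integral_measure_preserving (funepos f)) //; last exact: measurable_funepos.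
  by apply: eq_integral => g _; rewrite !funeposE.
rewrite -(@ge0_integral_measure_preserving (funeneg f)) //; last exact: measurable_funeneg.
by apply: eq_integral => g _; rewrite !funenegE.
Qed.

End measure_preserving_maps.

Section composed_family.
Context {R : realType} {N : nat}.
Local Notation C := R[i].
Local Notation Re := complex.Re.
Local Notation Im := complex.Im.
Local Notation P := (@circle_mu R).
Local Notation V := 'rV[C]_N.
Local Notation T := (circle R).
Variable nrm : T -> V -> R.
Hypothesis hnrm : compatible_family nrm.
Variable M : T -> T.
Hypothesis hM : measure_preserving M.

Let mM : measurable_fun [set: T] M. Proof. by case: hM. Qed.
Let PM A : measurable A -> P (M @^-1` A) = P A. Proof. by case: hM => _; apply. Qed.

Lemma compatible_family_comp : compatible_family (fun g => nrm (M g)).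
Proof.
split.
- by move=> g; exact: family_norm.
- by move=> x; exact: (measurableT_comp (family_measurable hnrm x) mM).
- exact: (ae_measure_preserving mM PM (family_lattice hnrm)).
- move=> k e; have [h1 h2 h3] := family_bounds hnrm k.
  pose e0 g := (nrm g (basis_vector R k))%:E.
  split.
  + apply: (lt_le_trans h1); apply/ess_infP.
    exact: (ae_measure_preserving mM PM (ess_inf_le P e0)).
  + by apply: ess_sup_gee (ess_inf_le P _); rewrite [ltRHS]probability_setT lte_fin ltr01.
  + apply: le_lt_trans h3; apply/ess_supP.
    exact: (ae_measure_preserving mM PM (ess_sup_ge P e0)).
Qed.

End composed_family.

Lemma finite_valued_comp d (T : measurableType d) (M : T -> T) (J : finType) (c : T -> J) :
  measurable_fun [set: T] M -> finite_valued c -> finite_valued (c \o M).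
Proof. by move=> mM hc j; have := mM measurableT _ (hc j); rewrite setTI. Qed.

Lemma finite_valued_pair d (T : measurableType d) (I J : finType) (ci : T -> I) (cj : T -> J) :
  finite_valued ci -> finite_valued cj -> finite_valued (fun g => (ci g, cj g)).
Proof.
move=> hi hj -[i j].
have -> : [set g | (ci g, cj g) = (i, j)] = [set g | ci g = i] `&` [set g | cj g = j].
  by apply/seteqP; split => g /= [h1 h2]; [rewrite h1 h2|rewrite h1 h2].
exact: measurableI.
Qed.

(* The weights [w i j] are the conditional probabilities of [ci = i] given [cj \o M = j]. *)
Lemma finite_average {R : realType} d (T : measurableType d) (P : probability T R)
    (M : T -> T) (I J : finType) (ci : T -> I) (cj : T -> J) :
  measurable_fun [set: T] M -> (forall A, measurable A -> P (M @^-1` A) = P A) ->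
  finite_valued ci -> finite_valued cj ->
  exists w : I -> J -> R, [/\ forall i j, 0 <= w i j,
    {ae P, forall g, \sum_i w i (cj g) = 1} &
    forall a : I -> J -> R,
      \int[P]_g (\sum_i w i (cj g) * a i (cj g)) = \int[P]_g a (ci g) (cj (M g))].
Proof.
move=> mM PM hci hcj.
pose cij g := (ci g, cj (M g)).
have hcM : finite_valued (cj \o M) := finite_valued_comp mM hcj.
have hcij : finite_valued cij := finite_valued_pair hci hcM.
pose p i j := fine (P [set g | cij g = (i, j)]).
pose q j := fine (P [set g | cj g = j]).
have p0 i j : 0 <= p i j by exact: fine_ge0.
have pairE (F : I -> J -> R) :
    \int[P]_g F (ci g) (cj (M g)) = \sum_j \sum_i F i j * p i j.
  have := pint_finite_valued P (fun ij => F ij.1 ij.2) hcij; rewrite /= => ->.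
  by rewrite exchange_big/= pair_bigA/=; apply: eq_bigr => -[i j] _.
(* Summing the joint law over [i] gives the law of [cj \o M], which is that of [cj] since [M]
   preserves the measure. *)
have qE j : \sum_i p i j = q j.
  have e1 := pairE (fun _ j' => (j' == j)%:R).
  rewrite (bigD1 j)//= [X in _ + X]big1 ?addr0 in e1; last first.
    by move=> j' /negbTE ->; apply: big1 => i _; rewrite mul0r.
  rewrite eqxx in e1; under eq_bigr do rewrite -[p _ _]mul1r.
  rewrite -e1; have := pint_finite_valued P (fun j' => (j' == j)%:R) hcM; rewrite /= => ->.
  rewrite (bigD1 j)//= eqxx mul1r big1 ?addr0; last by move=> j' /negbTE ->; rewrite mul0r.
  by rewrite /q -(PM _ (hcj j)).
have q0 j : 0 <= q j by rewrite -qE; exact: sumr_ge0.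
exists (fun i j => p i j / q j); split.
- by move=> i j; rewrite divr_ge0.
(* If [q j = 0] all weights vanish by the convention for division and do not add up to [1], but then
   the class [j] is a null set. *)
- have h : {ae P, forall g, forall j, cj g = j -> q j != 0}.
    apply: filter_forall => j; have [qj|qj] := eqVneq (q j) 0; last first.
      by apply: (@ae_imp _ _ _ P (fun=> True)) => //; exact: aeW.
    exists [set g | cj g = j]; split; [exact: hcj| |by move=> g /= h; apply: contrapT => h'; apply: h].
    by move: qj; rewrite /q => /eqP; rewrite fine_eq0 ?fin_num_measure// => /eqP.
  apply: ae_imp h => g /(_ _ erefl) qg.
  by rewrite -mulr_suml qE divff.
- move=> a.
  have := pint_finite_valued P (fun j => \sum_i p i j / q j * a i j) hcj; rewrite /= => ->.
  rewrite pairE.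
  apply: eq_bigr => j _; rewrite mulr_suml; apply: eq_bigr => i _.
  rewrite -/(q j) mulrAC [a i j * _]mulrC; congr (_ * _).
  have [qj|qj] := eqVneq (q j) 0; last by rewrite divfK.
  rewrite qj mulr0; apply/esym/eqP; rewrite eq_le p0 andbT.
  by rewrite -qj -qE (bigD1 i)//= lerDl sumr_ge0.
Qed.

(** * Competitors from conditional averages *)

Section averaging.
Context {R : realType} {N : nat}.
Local Notation C := R[i].
Local Notation P := (@circle_mu R).
Local Notation V := 'rV[C]_N.
Local Notation T := (circle R).
Variable nrm : T -> V -> R.
Hypothesis hnrm : compatible_family nrm.
Variable M : T -> T.
Hypothesis hM : measure_preserving M.

(** Here [s] stands for logarithms of moduli of a function admissible for the composed family, and
    [l] for the logarithm of its norm at [M g]. The shift by [dl] in the last hypothesis absorbs the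
    replacement of [s] by [tau]. In the conclusion one [dl] pays for the loss in the mean of [s],
    and two for replacing [rho] by [r], at [g] and at [M g]. *)
Lemma interp_norm_le_average (s : 'I_N -> T -> R) (l : T -> R) (x : V) (e dl : R) :
  0 < e -> 0 < dl -> (forall k, bdmeas [set: T] (s k)) -> bdmeas [set: T] l ->
  (forall k, cmod (x 0 k) <= expR (\int[P]_g s k g)) ->
  {ae P, forall g, ln (nrm (M g) (\row_k (expR (dl + s k g))%:C%C) + e) <= l g} ->
  (interp_norm nrm x <= (expR (dl *+ 3 + \int[P]_g l g))%:E)%E.
Proof.
move=> e0 dl0 hs hl hx hsl; have [mM PM] := hM.
have nrm0 g y : 0 <= nrm g y := family_ge0 hnrm g y.
have [E E0 hE] := family_upper hnrm.
have [S hS] : exists S : R, forall k g, s k g <= S.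
  have H k : exists B : R, forall g, `|s k g| <= B.
    by have [_ [B hB]] := hs k; exists B => g; exact: hB.
  have [B0 hB0] := choice H; exists (\sum_k `|B0 k|) => k g.
  rewrite (le_trans (ler_norm _))// (le_trans (hB0 k g))// (le_trans (ler_norm _))//.
  by rewrite (bigD1 k)//= lerDl sumr_ge0.
(* A representative is chosen in each class; empty classes receive an arbitrary point. *)
have repr (J : finType) (c : T -> J) : exists r : J -> T, forall g, c (r (c g)) = c g.
  have H j : exists g0, forall g, c g = j -> c g0 = j.
    have [[g0 hg0]|h] := pselect (exists g, c g = j); first by exists g0.
    by exists point => g gj; exfalso; apply: h; exists g.
  by have [r hr] := choice H; exists r => g; exact: (hr (c g) g).
have [I [ci hci HI]] := finite_partition dl0 hs.
have [ri hri] := repr I ci.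
pose tau i k := s k (ri i).
have tauP g k : `|tau (ci g) k - s k g| <= dl by apply: HI; rewrite hri.
pose y i : V := \row_k (expR (tau i k))%:C%C.
pose K : R := (expR S * E) *+ N.
have K0 : 0 <= K by rewrite mulrn_wge0// mulr_ge0// expR_ge0.
have hK : {ae P, forall g, forall i, nrm g (y i) <= K}.
  apply: filter_forall => i.
  apply: (@ae_nrm_le _ _ _ hnrm (fun=> y i) _ _ (expR_ge0 S)) => // g k.
  by rewrite mxE cmodr gtr0_norm ?expR_gt0// ler_expR; exact: hS.
(* The minimum with [K] changes nothing outside a null set and makes [rho] bounded everywhere, as
   [finite_partition] requires. *)
pose rho i g := ln (Num.min (nrm g (y i)) K + e).
have hrho i : bdmeas [set: T] (rho i).
  apply: (bdmeas_ln e0) => [|g]; last by rewrite le_min nrm0.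
  exact: (bdmeas_minr_cst (family_measurable hnrm (y i)) (fun g => nrm0 g (y i)) K0).
have [J [cj hcj HJ]] := finite_partition dl0 hrho.
have [rj hrj] := repr J cj.
pose r i j := rho i (rj j).
have rP i g : `|r i (cj g) - rho i g| <= dl by apply: HJ; rewrite hrj.
have [w [w0 w1 wint]] := finite_average mM PM hci hcj.
pose psi j := dl + \sum_i w i j * r i j.
have hpsi : bdmeas [set: T] (fun g => psi (cj g)) := bdmeas_finite_valued psi hcj.
pose A := \int[P]_g psi (cj g).
pose sb k j := \sum_i w i j * tau i k.
have hsb k : bdmeas [set: T] (fun g => sb k (cj g)) := bdmeas_finite_valued (sb k) hcj.
have intsb k : \int[P]_g s k g - dl <= \int[P]_g sb k (cj g).
  rewrite (wint (fun i j => tau i k)) -[X in _ - X](pint_cst P) -(pintB P (hs k) (bdmeas_cst _ dl)).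
  apply: (le_pint P (bdmeasB (hs k) (bdmeas_cst _ dl))).
    exact: (bdmeas_finite_valued (fun i => tau i k) hci).
  by move=> g; have := tauP g k; rewrite ler_norml lerBlDl => /andP[h _]; lra.
(* By log-convexity the norm of the exponential of [sb] is at most [expR (psi (cj g))]. Subtracting
   [psi] makes the bound constant, adding its mean [A] preserves integrals, and the extra [dl] makes
   up for [intsb]. *)
pose u k g := sb k (cj g) + (dl + A - psi (cj g)).
have hd : bdmeas [set: T] (fun g => dl + A - psi (cj g)) := bdmeasB (bdmeas_cst _ (dl + A)) hpsi.
have hu k : bdmeas [set: T] (u k) := bdmeasD (hsb k) hd.
have intu k : \int[P]_g s k g <= \int[P]_g u k g.
  rewrite (pintD P (hsb k) hd) (pintB P (bdmeas_cst _ (dl + A)) hpsi) pint_cst -/A addrK.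
  by rewrite -lerBlDr.
have stepA : (interp_norm nrm x <= (expR (dl + A))%:E)%E.
  apply: (interp_norm_le hnrm hu) => [k|]; first by rewrite (le_trans (hx k))// ler_expR.
  apply: ae_imp2 (ae_imp2 (fun g h1 h2 => conj h1 h2) w1 hK) (family_lattice hnrm) => g [w1g hKg] hlat.
  have -> : \row_k (expR (u k g))%:C%C = (expR (dl + A - psi (cj g)))%:C%C *:
      \row_k (expR (\sum_i w i (cj g) * tau i k))%:C%C.
    by apply/rowP => k; rewrite !mxE -[RHS]rmorphM/= -expRD /u /sb [in LHS]addrC.
  have hn := family_norm hnrm g.
  rewrite (complex_normZ hn) cmodr gtr0_norm ?expR_gt0//.
  have Hc : nrm g (\row_k (expR (\sum_i w i (cj g) * tau i k))%:C%C) <=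
      expR (\sum_i w i (cj g) * (r i (cj g) + dl)).
    apply: (lattice_norm_log_convex hn hlat) => // i.
    have : rho i g <= r i (cj g) + dl.
      by have := rP i g; rewrite ler_norml => /andP[h _]; lra.
    rewrite -ler_expR; apply: le_trans; rewrite /rho min_l ?hKg// lnK ?posrE ?ltr_wpDl//.
    by rewrite lerDl ltW.
  apply: (le_trans (ler_wpM2l (expR_ge0 _) Hc)); rewrite -expRD ler_expR.
  under eq_bigr do rewrite mulrDr.
  by rewrite big_split/= -mulr_suml w1g mul1r /psi; lra.
apply: (le_trans stepA); rewrite lee_fin ler_expR.
have hsum : bdmeas [set: T] (fun g => \sum_i w i (cj g) * r i (cj g)) :=
  bdmeas_finite_valued (fun j => \sum_i w i j * r i j) hcj.
have -> : A = dl + \int[P]_g r (ci g) (cj (M g)).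
  by rewrite /A /psi (pintD P (bdmeas_cst _ dl) hsum) pint_cst wint.
have hrc : bdmeas [set: T] (fun g => r (ci g) (cj (M g))).
  exact: (bdmeas_finite_valued (fun ij => r ij.1 ij.2)
    (finite_valued_pair hci (finite_valued_comp mM hcj))).
have hdl : bdmeas [set: T] (fun g => dl + l g) := bdmeasD (bdmeas_cst _ dl) hl.
suff : \int[P]_g r (ci g) (cj (M g)) <= \int[P]_g (dl + l g).
  by rewrite (pintD P (bdmeas_cst _ dl) hl) pint_cst; lra.
(* The comparison with [dl + l] holds only almost everywhere, whereas [le_pint] asks for it
   everywhere; the minimum bridges the two. *)
have hmin := bdmeas_minr hrc hdl.
rewrite (ae_eq_pint hrc hmin); first by apply: (le_pint P hmin hdl) => g; rewrite ge_min lexx orbT.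
have hKM := ae_measure_preserving mM PM hK.
have hlM := ae_measure_preserving mM PM (family_lattice hnrm).
apply: ae_imp2 (ae_imp2 (fun g h1 h2 => conj h1 h2) hKM hlM) hsl => g [hKg hlat] hlg.
rewrite min_l//.
have h1 : r (ci g) (cj (M g)) <= rho (ci g) (M g) + dl.
  by have := rP (ci g) (M g); rewrite ler_norml => /andP[_ h]; lra.
apply: (le_trans h1); rewrite addrC lerD2l; apply: le_trans hlg.
rewrite /rho min_l ?hKg// ler_ln ?posrE ?ltr_wpDl// lerD2r; apply: hlat => k.
rewrite !mxE !cmodr !gtr0_norm ?expR_gt0// ler_expR.
by have := tauP g k; rewrite ler_norml => /andP[_ h]; lra.
Qed.

End averaging.

Section interpolation_upper_bound.
Context {R : realType} {N : nat}.
Local Notation C := R[i].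
Local Notation P := (@circle_mu R).
Local Notation V := 'rV[C]_N.
Local Notation T := (circle R).
Variable nrm : T -> V -> R.
Hypothesis hnrm : compatible_family nrm.
Variable M : T -> T.
Hypothesis hM : measure_preserving M.

(** For [M = id] this is one half of the formula. General [M] serves the isometry in the direction
    where a function admissible for the composed family has to be brought back. *)
Lemma lne_interp_norm_le_comp (f : T -> V) (x : V) :
  bounded_measurable f -> log_dominates f x ->
  (lne (interp_norm nrm x) <= \int[P]_g lne (nrm (M g) (f g))%:E)%E.
Proof.
move=> hf hfx.
have hnM := compatible_family_comp hnrm hM.
have [E E0 hE] := family_upper hnM.
have [B B0 fB] := bounded_measurable_unif hf.
pose K : R := (B * E) *+ N.
have nrm0 g y : 0 <= nrm g y := family_ge0 hnrm g y.
have mf := measurable_bounded_nrm hnM hf.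
have K0 : 0 <= K by rewrite mulrn_wge0// mulr_ge0.
pose m g := Num.min (nrm (M g) (f g)) K.
have hm : bdmeas [set: T] m := bdmeas_minr_cst mf (fun g => nrm0 (M g) (f g)) K0.
have m0 g : 0 <= m g by rewrite le_min nrm0.
have aem : {ae P, forall g, nrm (M g) (f g) = m g}.
  by apply: ae_imp (ae_nrm_le hnM B0 fB hE) => g h; rewrite /m min_l.
rewrite (ae_eq_integral_lne mf hm.1 aem).
suff main e : 0 < e -> (interp_norm nrm x <= (expR (\int[P]_g ln (m g + e)))%:E)%E.
  have := interp_norm_ge0 hnrm x; have := main 1 ltr01.
  case: (interp_norm nrm x) main => [r|//|//] main _; rewrite lee_fin => r0.
  by apply/lne_le_integralP => // e e0; rewrite -lee_fin; exact: main.
move=> e0.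
(* This splits [e] into the shift [e1] required by [interp_norm_le_average] and the cost
   [e1 * E *+ N] of adding [e1] to every modulus. *)
pose D : R := 1 + E *+ N.
have D0 : 0 < D by rewrite ltr_pwDl// mulrn_wge0.
pose e1 := e / D; have e10 : 0 < e1 by rewrite divr_gt0.
have e1E : e = e1 + e1 * E *+ N.
  by rewrite -mulrnAr -[X in X + _]mulr1 -mulrDr -/D divfK// gt_eqF.
pose s k g := ln (cmod (f g 0 k) + e1).
have hs k : bdmeas [set: T] (s k) :=
  bdmeas_ln e10 (bdmeas_cmod_coord k hf) (fun g => cmod_ge0 _).
have hx k : cmod (x 0 k) <= expR (\int[P]_g s k g).
  have [H _] := lne_le_integralP P (bdmeas_cmod_coord k hf)
    (fun g => cmod_ge0 _) (cmod_ge0 (x 0 k)).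
  exact: (H (hfx k)).
have hlm : bdmeas [set: T] (fun g => ln (m g + e)) := bdmeas_ln e0 hm m0.
(* Three [dl] come from [interp_norm_le_average], the fourth from the factor [expR dl] in its norm
   hypothesis. *)
have step dl : 0 < dl ->
    (interp_norm nrm x <= (expR (dl *+ 4 + \int[P]_g ln (m g + e)))%:E)%E.
  move=> dl0; have hl : bdmeas [set: T] (fun g => dl + ln (m g + e)) :=
    bdmeasD (bdmeas_cst _ dl) hlm.
  have := interp_norm_le_average hnrm hM e10 dl0 hs hl hx.
  rewrite (pintD P (bdmeas_cst _ dl) hlm) pint_cst addrA -mulrSr; apply.
  apply: ae_imp2 aem (ae_imp2 (fun g h1 h2 => conj h1 h2) (family_lattice hnM) hE) => g mE [hl' hEg].
  have p1 : 0 < m g + e by rewrite ltr_wpDl.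
  rewrite -[dl in leRHS]expRK -lnM ?posrE ?expR_gt0// ler_ln ?posrE; last 2 first.
  - by rewrite ltr_wpDl.
  - by rewrite mulr_gt0 ?expR_gt0.
  have -> : \row_k (expR (dl + s k g))%:C%C = (expR dl)%:C%C *: absplus e1 (f g).
    apply/rowP => k; rewrite !mxE expRD lnK ?posrE; first exact: rmorphM.
    by rewrite ltr_wpDl ?cmod_ge0.
  rewrite (complex_normZ (family_norm hnrm (M g))) cmodr gtr0_norm ?expR_gt0//.
  have h1 := nrm_absplus_le hnM (f g) hl' (ltW e10) hEg.
  have b1 : 1 <= expR dl by rewrite -expR0 ler_expR ltW.
  apply: (@le_trans _ _ (expR dl * (nrm (M g) (absplus e1 (f g)) + e1))).
    by rewrite mulrDr lerD2l ler_peMl// ltW.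
  by rewrite ler_pM2l ?expR_gt0// -mE e1E addrCA [leLHS]addrC lerD2l.
have := interp_norm_ge0 hnrm x; have := step 1 ltr01.
case: (interp_norm nrm x) step => [r|//|//] step _; rewrite !lee_fin => r0.
have [->|rn0] := eqVneq r 0; first exact: expR_ge0.
have rp : 0 < r by rewrite lt_def rn0.
rewrite -[r]lnK ?posrE// ler_expR; apply/ler_addgt0Pr => d d0.
have d4 : 0 < d / 4 by rewrite divr_gt0.
have e4 : d / 4 *+ 4 = d by rewrite -mulr_natr divfK.
by have := step _ d4; rewrite e4 lee_fin -{1}[r]lnK ?posrE// ler_expR addrC.
Qed.

End interpolation_upper_bound.

(** * The interpolation formula *)

Section interpolation_formula_converse.
Context {R : realType} {N : nat}.
Local Notation C := R[i].
Local Notation Re := complex.Re.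
Local Notation Im := complex.Im.
Local Notation mu := (@lebesgue_measure R).
Local Notation P := (@circle_mu R).
Local Notation V := 'rV[C]_N.
Local Notation T := (circle R).
Variable nrm : T -> V -> R.
Hypothesis hnrm : compatible_family nrm.

Definition log_infimum (x : V) : \bar R :=
  ereal_inf [set (\int[P]_g lne (nrm g (f g))%:E)%E |
             f in [set f : T -> V | bounded_measurable f /\ log_dominates f x]].

(** Jensen's inequality makes the boundary function admissible, and on a probability space the mean
    of a logarithm is at most the logarithm of the essential supremum. *)
Lemma log_infimum_le_ess_sup (F : C -> V) : bounded_analytic F ->
  (log_infimum (F 0%R) <= lne (ess_sup P (fun g => (nrm g (boundary_value F g))%:E)))%E.
Proof.
move=> bF; have [W [WR WI hW bv]] := bounded_analytic_boundary bF.
(* Admissible functions must be bounded and measurable everywhere, so [W] replaces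
   [boundary_value F]; the essential supremum is the same. *)
pose f (g : T) : V := \row_k W k (carg g).
have hf : bounded_measurable f.
  move=> k; have [mc [K cK]] := bdmeas_cmod (WR k) (WI k); split.
  - have -> : (fun g => Re (f g 0 k)) = (fun t => Re (W k t)) \o carg.
      by apply/funext => g; rewrite mxE.
    by case: (bdmeas_carg (WR k)).
  - have -> : (fun g => Im (f g 0 k)) = (fun t => Im (W k t)) \o carg.
      by apply/funext => g; rewrite mxE.
    by case: (bdmeas_carg (WI k)).
  - by exists K => g; rewrite mxE (le_trans (ler_norm _))// cK.
have hdom : log_dominates f (F 0).
  move=> k; apply/(lne_le_integralP P (bdmeas_cmod_coord k hf)
    (fun g => cmod_ge0 _) (cmod_ge0 (F 0 0 k))) => e e0.
  have [Fd Fb] := bF; have [K FK] := Fb k.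
  have hF z : cmod z < 1 -> holo (fun w => F w 0 k) z.
    by move=> z1; apply: Fd; rewrite -[1]/(1%:C%C) cmod_lt.
  have FK' z : cmod z < 1 -> cmod (F z 0 k) <= K.
    by move=> z1; apply: FK; rewrite -[1]/(1%:C%C) cmod_lt.
  have hW' : {ae mu, forall t, 0 < t < 1 -> forall e : R, 0 < e ->
      exists2 q : R, 0 < q & forall r : R, 0 <= r < 1 -> 1 - r < q ->
      cmod (F (r%:C%C * expi t) 0 k - (Re (W k t) +i* Im (W k t))%C) <= e}.
    by apply: ae_imp (hW k) => t h t01 e' e'0; case: (W k t) (h t01 e' e'0).
  have := jensen hF FK' (WR k) (WI k) hW' e0.
  have hc : bdmeas [set: R] (fun t => ln (cmod (Re (W k t) +i* Im (W k t))%C + e)).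
    apply: (bdmeas_ln e0) => [|t]; last exact: cmod_ge0.
    exact: (@bdmeas_cmod _ _ _ _ (fun t => (Re (W k t) +i* Im (W k t))%C) (WR k) (WI k)).
  rewrite -(circle_int_carg hc).
  suff -> : (fun g => ln (cmod (f g 0 k) + e)) =
    (fun g => ln (cmod (Re (W k (carg g)) +i* Im (W k (carg g)))%C + e)) by [].
  by apply/funext => g; rewrite mxE; case: (W k (carg g)).
have mf := measurable_bounded_nrm hnrm hf.
have feq : ess_sup P (fun g => (nrm g (boundary_value F g))%:E) =
    ess_sup P (fun g => (nrm g (f g))%:E).
  by apply: eq_ess_sup; apply: ae_imp bv => g ->.
rewrite feq; apply: (@le_trans _ _ (\int[P]_g lne (nrm g (f g))%:E)%E).
  by apply: ereal_inf_lbound; exists f.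
have L0 : (0 <= ess_sup P (fun g => (nrm g (f g))%:E))%E.
  apply: ess_sup_ger => [|g]; first by rewrite [ltRHS]probability_setT lte_fin ltr01.
  by rewrite lee_fin (family_ge0 hnrm).
have := ess_sup_ge P (fun g => (nrm g (f g))%:E).
case: (ess_sup P _) L0 => [L|_ _|//]; last by rewrite leey.
rewrite lee_fin => L0 hL; apply: (integral_lne_le mf) L0 _ => [g|].
  exact: family_ge0.
by apply: ae_imp hL => g; rewrite lee_fin.
Qed.

Lemma lne_interp_normE x : lne (interp_norm nrm x) = log_infimum x.
Proof.
apply/eqP; rewrite eq_le; apply/andP; split.
  apply/ereal_infP => _ [f [hf hfx] <-].
  by apply: (lne_interp_norm_le_comp hnrm (M := id) _ hf hfx); split.
have I0 : interp_norm nrm x \in `[0%E, +oo%E].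
  by rewrite in_itv/= interp_norm_ge0// leey.
rewrite -lee_expeR lneK//; apply/ereal_infP => _ [F [bF Fx] <-].
set L := ess_sup _ _.
have L0 : L \in `[0%E, +oo%E].
  rewrite in_itv/= leey andbT; apply: ess_sup_ger => [|g].
    by rewrite [ltRHS]probability_setT lte_fin ltr01.
  by rewrite lee_fin (family_ge0 hnrm).
by rewrite -[leRHS]lneK// lee_expeR -Fx; exact: log_infimum_le_ess_sup.
Qed.

End interpolation_formula_converse.

Section log_infimum_composition.
Context {R : realType} {N : nat}.
Local Notation P := (@circle_mu R).
Local Notation V := 'rV[R[i]]_N.
Local Notation T := (circle R).
Variable nrm : T -> V -> R.
Hypothesis hnrm : compatible_family nrm.
Variable M : T -> T.
Hypothesis hM : measure_preserving M.

Let mM : measurable_fun [set: T] M. Proof. by case: hM. Qed.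
Let PM A : measurable A -> P (M @^-1` A) = P A. Proof. by case: hM => _; apply. Qed.

(** Composition with [M] preserves bounds and every integral involved, so [f \o M] is admissible for
    the same [x] and gives the same value. *)
Lemma log_infimum_comp_le x : (log_infimum (fun g => nrm (M g)) x <= log_infimum nrm x)%E.
Proof.
apply/ereal_infP => _ [f [hf hfx] <-].
have mf := measurable_bounded_nrm hnrm hf.
rewrite -(integral_measure_preserving mM PM (measurable_lne mf)).
apply: ereal_inf_lbound; exists (fun g => f (M g)); last by [].
split.
  move=> k; have [mR mI [K fK]] := hf k; split.
  - exact: (measurableT_comp mR mM).
  - exact: (measurableT_comp mI mM).
  - by exists K => g; exact: fK.
move=> k; have [mc _] := bdmeas_cmod_coord k hf.
apply: (le_trans (hfx k)).
by rewrite -(integral_measure_preserving mM PM (measurable_lne mc)).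
Qed.

End log_infimum_composition.

Unset Implicit Arguments.

Theorem proposition4p1 (R : realType) (N : nat)
    (nrm : circle R -> 'rV[R[i]]_N -> R) (hnrm : compatible_family nrm) :
  (forall x : 'rV[R[i]]_N,
     lne (interp_norm nrm x) =
     ereal_inf [set (\int[circle_mu]_g lne (nrm g (f g))%:E)%E |
                f in [set f : circle R -> 'rV[R[i]]_N |
                      bounded_measurable f /\ log_dominates f x]]) /\
  (forall M : circle R -> circle R, measure_preserving M ->
     forall x : 'rV[R[i]]_N,
       interp_norm (fun g => nrm (M g)) x = interp_norm nrm x).
Proof.
split=> [x|M hM x]; first exact: lne_interp_normE.
have hnM := compatible_family_comp hnrm hM.
have nneg (p : circle R -> 'rV[R[i]]_N -> R) (hp : compatible_family p) :
    interp_norm p x \in `[0%E, +oo%E].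
  by rewrite in_itv/= (interp_norm_ge0 hp) leey.
(* Both norms lie in [[0, +oo]], where [lne] is injective, so two inequalities between logarithms
   suffice. *)
apply: lne_inj; rewrite ?nneg//; apply/eqP; rewrite eq_le; apply/andP; split.
  by rewrite !lne_interp_normE//; exact: log_infimum_comp_le.
(* In this direction averaging along [M] stands in for composition with an inverse. *)
rewrite [leRHS]lne_interp_normE//; apply/ereal_infP => _ [f [hf hfx] <-].
exact: lne_interp_norm_le_comp.
Qed.
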